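(* Let $\mathcal{M}_\star$ be the rank $3$ matroid on $\{0,1,\dots,9\}$ whose nonbases are $$\{0,2,6\},\{0,3,9\},\{0,5,8\},\{1,3,7\},\{1,4,5\},\{1,6,9\},\{2,4,8\},\{2,5,7\},\{3,6,8\},\{4,7,9\}.$$ Modulo lineality and intersecting with a sphere, the Dressian $\mathrm{Dr}_{\mathcal{M}_\star}$ is a $2$-dimensional polyhedral complex with $30$ vertices, $65$ edges, and $20$ triangles. In characteristic $0$, the tropical Grassmannian $\mathrm{Gr}_{\mathcal{M}_\star}$ (modulo lineality and intersecting with a sphere) is a graph with $30$ vertices and $55$ edges.
   Context: For a matroid $\mathcal{M}$ of rank $d$ on a finite set $E$ with bases $\mathcal{B}$ and a field $K$ with valuation, let $G_{\mathcal{M}}\subset K[p_\sigma^{\pm1}:\sigma\in\mathcal{B}]$ be the set of polynomials obtained from the three-term Plücker relations $p_{Sij}p_{Skl}-p_{Sik}p_{Sjl}+p_{Sil}p_{Sjk}$ ($S\in\binom{E}{d-2}$, $i,j,k,l$ distinct in $E\setminus S$, $Sij=S\cup\{i,j\}$) by replacing $p_\sigma$ by $0$ if $\sigma\notin\mathcal{B}$, and let $I_{\mathcal{M}}$ be the ideal it generates. For $f=\sum_u c_u p^u$, $\mathrm{trop}(V(f))\subset\mathbb{R}^{\mathcal{B}}$ is the set of $w$ at which $\min_{u:\,c_u\ne0}(\mathrm{val}(c_u)+u\cdot w)$ is attained at least twice. The Dressian is $\mathrm{Dr}_{\mathcal{M}}=\bigcap_{f\in G_{\mathcal{M}}}\mathrm{trop}(V(f))$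 (independent of $K$) and the tropical Grassmannian is $\mathrm{Gr}_{\mathcal{M}}=\bigcap_{f\in I_{\mathcal{M}}}\mathrm{trop}(V(f))\subset\mathrm{Dr}_{\mathcal{M}}$. ''In characteristic $0$'' means that $K$ is algebraically closed with residue field of characteristic $0$ (e.g. $K=\mathbb{C}\{\{t\}\}$). The Dressian is a polyhedral fan, with the fan structure given by the common refinement of the tropical hypersurfaces $\mathrm{trop}(V(f))$, $f\in G_{\mathcal{M}}$; the Grassmannian is regarded as a subcomplex. The lineality space is the largest linear subspace $L$ with $w+u$ in the fan for all $w$ in the fan and $u\in L$. ''Modulo lineality and intersecting with a sphere'' means: take the image of the fan in $\mathbb{R}^{\mathcal{B}}/L$ and intersect with a sphere centered at the origin, so that cones of dimension $\dim L+i+1$ become cells of dimension $i$ (vertices for $i=0$, edges for $i=1$, etc.). *)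

(* Defs.v *)
From HB Require Import structures.
From mathcomp Require Import all_boot all_order all_algebra.
From mathcomp Require Import finmap.
From mathcomp.multinomials Require Import monalg.

Set Implicit Arguments.
Unset Strict Implicit.
Unset Printing Implicit Defensive.

Import Order.TTheory GRing.Theory Num.Theory.
Local Open Scope ring_scope.

Record matroid (n d : nat) := Matroid {
  bases : {set {set 'I_n}};
  bases_neq0 : bases != set0;
  bases_card : forall A, A \in bases -> #|A| = d;
  bases_exchange : forall A B x, A \in bases -> B \in bases ->
    x \in A :\: B -> exists2 y, y \in B :\: A & y |: (A :\ x) \in bases
}.

Notation basis M := {A : {set _} | A \in bases M}.

Definition star_nonbases : seq (seq nat) :=
  [:: [:: 0; 2; 6]; [:: 0; 3; 9]; [:: 0; 5; 8]; [:: 1; 3; 7]; [:: 1; 4; 5];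
      [:: 1; 6; 9]; [:: 2; 4; 8]; [:: 2; 5; 7]; [:: 3; 6; 8]; [:: 4; 7; 9]]%N.

Definition points (s : seq nat) : {set 'I_10} := [set x | val x \in s].

Definition star_bases : {set {set 'I_10}} :=
  [set A : {set 'I_10} | (#|A| == 3) && (A \notin map points star_nonbases)].

Lemma star_nonbases_inj (l l' : seq nat) (x y : 'I_10) :
  l \in star_nonbases -> l' \in star_nonbases -> x != y ->
  x \in points l -> y \in points l -> x \in points l' -> y \in points l' ->
  l = l'.
Proof.
move=> hl hl' nxy; rewrite !inE => xl yl xl' yl'.
have: all (fun l : seq nat => all (fun l' : seq nat =>
  all (fun x => all (fun y => [|| x == y, x \notin l', y \notin l' | l == l']) l) l)
  star_nonbases) star_nonbases by vm_compute.
move=> /allP/(_ _ hl)/allP/(_ _ hl')/allP/(_ _ xl)/allP/(_ _ yl).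
by rewrite xl' yl' val_eqE (negPf nxy) /= => /eqP.
Qed.

Lemma star_bases_neq0 : star_bases != set0.
Proof.
pose A : {set 'I_10} := inord 0 |: (inord 1 |: [set inord 2]).
apply/set0Pn; exists A; rewrite inE; apply/andP; split.
  by rewrite !cardsU1 cards1 !inE -!val_eqE /= !inordK.
apply/negP => /mapP[l hl E].
have i0 : inord 0 \in points l by rewrite -E !inE eqxx.
have i1 : inord 1 \in points l by rewrite -E !inE eqxx orbT.
have i2 : inord 2 \in points l by rewrite -E !inE eqxx !orbT.
move: i0 i1 i2; rewrite !inE /= !inordK //.
have: all (fun l : seq nat => ~~ [&& 0 \in l, 1 \in l & 2 \in l]%N) star_nonbases by [].
by move=> /allP/(_ _ hl) /negP h i0 i1 i2; apply: h; rewrite i0 i1 i2.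
Qed.

Lemma star_bases_card A : A \in star_bases -> #|A| = 3.
Proof. by rewrite inE => /andP[/eqP]. Qed.

Lemma star_bases_exchange A B x : A \in star_bases -> B \in star_bases ->
  x \in A :\: B -> exists2 y, y \in B :\: A & y |: (A :\ x) \in star_bases.
Proof.
move=> hA hB hx; have cA := star_bases_card hA; have cB := star_bases_card hB.
have /setDP[xA xB] := hx.
have cAx : #|A :\ x| = 2 by move: cA; rewrite (cardsD1 x) xA => -[].
have cyA y : y \in B :\: A -> #|y |: (A :\ x)| = 3.
  by move=> /setDP[_ yA]; rewrite cardsU1 cAx !inE (negPf yA) andbF.
have cBA : #|B :\: A| = #|A :\: B|.
  by apply/eqP; rewrite -(eqn_add2l #|A :&: B|) {1}setIC !cardsID cA cB.
have [y hy] : exists y, y \in B :\: A.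
  by apply/set0Pn; rewrite -card_gt0 cBA card_gt0; apply/set0Pn; exists x.
have [/existsP[y1 /andP[hy1 by1]]|/existsPn nb] :=
  boolP [exists y, (y \in B :\: A) && (y |: (A :\ x) \in star_bases)].
  by exists y1.
have ney z : z \in B :\: A ->
    exists2 l, l \in star_nonbases & z |: (A :\ x) = points l.
  move=> hz; have := nb z; rewrite hz [_ \in star_bases]in_set cyA // eqxx !andTb negbK.
  by case/mapP=> l hl El; exists l.
have [/cards1P[a Ba]|cBA1] := boolP (#|B :\: A| == 1)%N.
  have Ax : A :\: B = [set x].
    apply/esym/eqP; rewrite eqEcard sub1set hx cards1 -cBA Ba cards1 //.
  have EB : y |: (A :\ x) = B.
    apply/eqP; rewrite eqEcard cyA // cB leqnn andbT subUset sub1set.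
    have /setDP[-> _] := hy; rewrite subDset -Ax.
    by apply/subsetP=> z zA; rewrite !inE zA; case: (z \in B).
  by have := nb y; rewrite hy EB hB.
have [z hz yz] : exists2 z, z \in B :\: A & z != y.
  have /card_gt1P[a [b [ha hb ab]]] : (1 < #|B :\: A|)%N.
    by rewrite ltn_neqAle eq_sym cBA1 card_gt0; apply/set0Pn; exists y.
  have [ay|ay] := eqVneq a y; last by exists a.
  by exists b => //; rewrite -ay eq_sym.
have [l hl El] := ney y hy; have [l' hl' El'] := ney z hz.
have /card_gt1P[a [b [ha hb ab]]] : (1 < #|A :\ x|)%N by rewrite cAx.
have Ell : l = l'.
  apply: (star_nonbases_inj hl hl' ab); rewrite -?El -?El' in_setU;
  by rewrite ?ha ?hb orbT.
have : z \in y |: (A :\ x) by rewrite El Ell -El' setU11.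
by have /setDP[_ zA] := hz; rewrite !inE (negPf yz) (negPf zA) andbF.
Qed.

Definition M_star : matroid 10 3 :=
  Matroid star_bases_neq0 star_bases_card star_bases_exchange.

From mathcomp Require Import classical_sets cardinality reals.

Local Open Scope classical_set_scope.

(* The value at 0, morally +oo, is irrelevant. *)
Record valuation (R : realType) (K : fieldType) := Valuation {
  valuation_fun :> K -> R;
  valuationM : forall x y, x != 0 -> y != 0 ->
    valuation_fun (x * y) = valuation_fun x + valuation_fun y;
  valuationD : forall x y, x != 0 -> y != 0 -> x + y != 0 ->
    Num.min (valuation_fun x) (valuation_fun y) <= valuation_fun (x + y)
}.

Section ResidueField.
Variables (R : realType) (K : fieldType) (v : valuation R K).

Lemma valuation1 : v 1 = 0.
Proof.
apply: (addIr (v 1)); rewrite add0r -valuationM ?oner_eq0 //.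
by rewrite mulr1.
Qed.

Lemma valuationN x : v (- x) = v x.
Proof.
have N1 : (-1 : K) != 0 by rewrite oppr_eq0 oner_eq0.
have [->|x0] := eqVneq x 0; first by rewrite oppr0.
rewrite -mulN1r valuationM //; suff -> : v (-1) = 0 by rewrite add0r.
have : v (-1) *+ 2 == 0.
  by rewrite mulr2n -valuationM // mulrNN mulr1 valuation1.
by rewrite mulrn_eq0 => /eqP.
Qed.

Definition valring_pred : {pred K} := fun x => (x == 0) || (0 <= v x).

Lemma valring_subring : subring_closed valring_pred.
Proof.
split=> [|x y|x y]; rewrite !unfold_in /valring_pred.
- by rewrite valuation1 lexx orbT.
- have [->|x0] := eqVneq x 0.
    by rewrite sub0r oppr_eq0 valuationN.
  have [->|y0] := eqVneq y 0; first by rewrite subr0 (negPf x0).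
  rewrite /= => vx vy; have [//|xy0] := eqVneq (x - y) 0.
  apply: le_trans (valuationD _ _ _ _) => //; last by rewrite oppr_eq0.
  by rewrite valuationN le_min vx.
- have [->|x0] := eqVneq x 0; first by rewrite mul0r eqxx.
  have [->|y0] := eqVneq y 0; first by rewrite mulr0 eqxx.
  by rewrite /= valuationM // => vx vy; rewrite addr_ge0 ?orbT.
Qed.

HB.instance Definition _ :=
  GRing.isSubringClosed.Build K valring_pred valring_subring.

Record valring := Valring {
  valring_val : K;
  valring_valP : valring_val \in valring_pred }.

HB.instance Definition _ := [isSub for valring_val].
HB.instance Definition _ := [Choice of valring by <:].
HB.instance Definition _ := [SubChoice_isSubComNzRing of valring by <:].

Definition maxideal : {pred valring} :=
  fun x => (val x == 0) || (0 < v (val x)).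

Lemma maxideal_closed : idealr_closed maxideal.
Proof.
split=> [||a x y]; rewrite !unfold_in /maxideal.
- by rewrite raddf0 eqxx.
- by rewrite rmorph1 oner_eq0 valuation1 ltxx.
- have va : val a \in valring_pred := valP a; move: va.
  rewrite unfold_in !rmorphD !rmorphM /valring_pred /=; set c := val a; set r := val x.
  set s := val y => vc vr vs.
  have [->|c0] := eqVneq c 0; first by rewrite mul0r add0r.
  have [->|r0] := eqVneq r 0; first by rewrite mulr0 add0r.
  have [->|s0] := eqVneq s 0.
    rewrite addr0 mulf_eq0 (negPf c0) (negPf r0) /= valuationM //.
    by move: vc vr; rewrite (negPf c0) (negPf r0) /= => vc vr; rewrite ltr_wpDl.
  have [//|cs0] := eqVneq (c * r + s) 0.
  rewrite /=; apply: lt_le_trans (valuationD _ _ _ _) => //.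
    move: vc vr vs; rewrite (negPf c0) (negPf r0) (negPf s0) /= => vc vr vs.
    by rewrite lt_min valuationM // vs ltr_wpDl.
  by rewrite mulf_neq0.
Qed.

HB.instance Definition _ := isIdealr.Build valring maxideal maxideal_closed.

Definition residue_char0 : Prop := [pchar {ideal_quot maxideal}] =i pred0.

End ResidueField.

(* [{malg K[G]}] is the free K-module on G; monalg only makes it a ring for
   monoids G without nontrivial units, which excludes Laurent exponents. *)
Notation laurent K I := {malg K[{ffun I -> int}]}.

Section Laurent.
Variables (K : fieldType) (I : finType).
Implicit Types f g h : laurent K I.

Definition laurent_mul f g : laurent K I :=
  \sum_(a <- msupp f) \sum_(b <- msupp g) << f@_a * g@_b *g a + b >>.

Definition laurent_var (i : I) : laurent K I :=
  << [ffun j => (j == i)%:Z] >>.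

Definition laurent_ideal (G : set (laurent K I)) : set (laurent K I) :=
  [set f | exists2 s : seq (laurent K I * laurent K I),
     forall hg, hg \in s -> G hg.2 &
     f = \sum_(hg <- s) laurent_mul hg.1 hg.2].

End Laurent.

(* R^o is R as a vector space over itself, so that this is a [vectType R]. *)
Notation weight R I := {ffun I -> R^o}.

Section Tropical.
Variables (R : realType) (K : fieldType) (v : valuation R K) (I : finType).
Implicit Types (f : laurent K I) (w : weight R I).

Definition trop_term f w (a : {ffun I -> int}) : R :=
  v f@_a + \sum_i (a i)%:~R * w i.

Definition min_terms f w : set {ffun I -> int} :=
  [set a | a \in msupp f /\
    forall b, b \in msupp f -> trop_term f w a <= trop_term f w b].

(* For f = 0 the condition is vacuous and the hypersurface is everything. *)
Definition trop_hypersurface f : set (weight R I) :=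
  [set w | forall a, min_terms f w a -> exists2 b, b != a & min_terms f w b].

Definition trop_intersection (G : set (laurent K I)) : set (weight R I) :=
  \bigcap_(f in G) trop_hypersurface f.

(* The closed cell containing w in its relative interior. *)
Definition trop_cell f w : set (weight R I) :=
  [set w' | min_terms f w `<=` min_terms f w'].

Definition trop_cells f : set (set (weight R I)) :=
  [set trop_cell f w | w in trop_hypersurface f].

Definition common_refinement (G : set (laurent K I)) :
    set (set (weight R I)) :=
  [set C | C !=set0 /\ exists2 c : laurent K I -> set (weight R I),
     forall f, G f -> trop_cells f (c f) & C = \bigcap_(f in G) c f].

End Tropical.

Section Plucker.
Variables (K : fieldType) (n d : nat) (M : matroid n d).

Definition plucker_var (A : {set 'I_n}) : laurent K (basis M) :=
  if insub A is Some b then laurent_var K b else 0.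

Definition three_term (S : {set 'I_n}) (i j k l : 'I_n) :
    laurent K (basis M) :=
  let p x y := plucker_var (x |: (y |: S))%SET in
  laurent_mul (p i j) (p k l) - laurent_mul (p i k) (p j l)
  + laurent_mul (p i l) (p j k).

(* The variables are indexed by sets, not by ordered tuples, so the signs are
   those of the Grassmann-Pluecker relations only when i < j < k < l; in other
   orders the signs would be wrong (the ideal would contain monomials in
   characteristic other than 2). *)
Definition three_term_relations : set (laurent K (basis M)) :=
  [set f | exists (S : {set 'I_n}) (i j k l : 'I_n),
    [/\ (#|S| + 2 = d)%N, [&& i < j, j < k & k < l]%N,
        [/\ i \notin S, j \notin S, k \notin S & l \notin S] &
        f = three_term S i j k l]].

End Plucker.

Arguments three_term_relations K {n d} M _.

Section Fans.
Variables (R : realFieldType) (V : vectType R).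
Implicit Types (C D A : set V) (F : set (set V)) (L : {vspace V}).

Definition polyhedral_cone C : Prop :=
  exists s : seq 'Hom(V, R^o),
    C = [set w | forall l, l \in s -> 0 <= (l w : R)].

Definition face D C : Prop :=
  exists l : 'Hom(V, R^o),
    (forall w, C w -> 0 <= (l w : R)) /\ D = [set w | C w /\ l w = 0].

Definition polyhedral_fan F : Prop :=
  [/\ finite_set F,
      forall C, F C -> polyhedral_cone C,
      forall C D, F C -> face D C -> F D &
      forall C D, F C -> F D -> face (C `&` D) C /\ face (C `&` D) D].

Definition fan_support F : set V := \bigcup_(C in F) C.

Definition translation_invariant A L : Prop :=
  forall w u, A w -> u \in L -> A (w + u).

Definition lineality_space A L : Prop :=
  translation_invariant A L /\
  forall L', translation_invariant A L' -> (L' <= L)%VS.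

Definition linear_hull C (U : {vspace V}) : Prop :=
  (forall w, C w -> w \in U) /\
  forall U' : {vspace V}, (forall w, C w -> w \in U') -> (U <= U')%VS.

(* The cones giving rise, modulo lineality and in the sphere, to the
   i-dimensional cells. *)
Definition cells F (i : nat) : set (set V) :=
  [set C | F C /\ exists L U,
    [/\ lineality_space (fan_support F) L, linear_hull C U &
        \dim U = (\dim L + i.+1)%N]].

Definition complex_dim F (i : nat) : Prop :=
  cells F i !=set0 /\ forall j, (i < j)%N -> cells F j = set0.

Definition vertices_of F C : set (set V) :=
  [set D | cells F 0 D /\ face D C].

End Fans.

Section Dressian.
Variables (R : realType) (K : fieldType) (v : valuation R K).
Variables (n d : nat) (M : matroid n d).

Definition dressian : set (weight R (basis M)) :=
  trop_intersection v (three_term_relations K M).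

Definition grassmannian : set (weight R (basis M)) :=
  trop_intersection v (laurent_ideal (three_term_relations K M)).

Definition dressian_fan : set (set (weight R (basis M))) :=
  common_refinement v (three_term_relations K M).

Definition grassmannian_fan : set (set (weight R (basis M))) :=
  [set C | dressian_fan C /\ C `<=` grassmannian].

End Dressian.

Arguments dressian {R K} v {n d} M _.
Arguments grassmannian {R K} v {n d} M _.
Arguments dressian_fan {R K} v {n d} M _.
Arguments grassmannian_fan {R K} v {n d} M _.

(* Main.v *)
(* Adding an element of the lineality space and using the two-term relations, a
   point of the Dressian is given by ten coordinates, in which fifty tropical
   linear trinomials remain. Branching over their minimal pairs, with generators
   of the cones updated by double description, covers the solutions by 45
   simplicial cones on 30 rays. Which terms are minimal on which rays determines
   all further incidences, hence the fan and its cells.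

   If the residue characteristic is 0, the Pluecker ideal contains a polynomial
   2 + p^a - p^b whose constant term is the only minimal one in the relative
   interior of each of the 20 triangles and of 10 of the edges. On the other 55
   edges points of the Grassmannian come from realizations of the matroid over
   K[s, t], where s and t carry the coordinates of the edge as values: up to
   automorphisms of the matroid there are six of them, and each depends on a root
   of an equation in s, t and e that Newton iteration approximates to any order.
   The vertices follow by passing to the limit. *)
Require Import Defs.
From Stdlib Require Import ZArith.
From mathcomp Require Import all_boot all_order all_algebra.
From mathcomp Require Import classical_sets cardinality reals.
From mathcomp Require Import boolp.
From mathcomp Require Import finmap ssrZ zify ring lra.
From mathcomp.multinomials Require Import monalg.

Set Implicit Arguments.
Unset Strict Implicit.
Unset Printing Implicit Defensive.

Import Order.TTheory GRing.Theory Num.Theory.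
Local Open Scope ring_scope.
Local Open Scope classical_set_scope.

(* The polyhedral side hangs on one relation between weights: every term minimal at [w] is minimal
   at [w'], for all relations at once. Between points in the relative interiors of the explicit
   cones it is inclusion of the lists of rays, so the disjointness of interiors and the common
   refinement itself are read off from integer incidences. Coefficients are 1 and -1, of value 0,
   which is why the field does not matter there.

   On the side of the Grassmannian the obstacle is that the value group of K may be too small, even
   trivial, for a point over K to have prescribed values, and that the root e need not be a
   polynomial in s and t. Values are therefore carried by the variables of K[s, t] under a weighted
   Gauss filtration, and exact zeros are replaced by approximate ones: at these an element of the
   ideal exceeds every bound, which a single minimal term would contradict. *)
Delimit Scope Z_scope with BZ.

(** * Fans of simplicial cones given by lists of rays *)

Section SimplicialFan.
Variables (R : realType) (V : vectType R).
Variables (L : {vspace V}) (ray : nat -> V) (Delta : seq (seq nat)).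
Implicit Types (sigma tau : seq nat) (lam : nat -> R) (u w : V).

Definition combi sigma lam : V := \sum_(i <- sigma) lam i *: ray i.

Definition ray_cone sigma : set V :=
  [set w | exists u lam, [/\ u \in L, forall i, i \in sigma -> 0 <= lam i &
     w = u + combi sigma lam]].

Definition ray_relint sigma : set V :=
  [set w | exists u lam, [/\ u \in L, forall i, i \in sigma -> 0 < lam i &
     w = u + combi sigma lam]].

Lemma combi_filter sigma lam (p : pred nat) :
  (forall i, i \in sigma -> ~~ p i -> lam i = 0) ->
  combi sigma lam = combi (filter p sigma) lam.
Proof.
move=> h; rewrite /combi big_filter [LHS](bigID p) /= [X in _ + X]big1_seq ?addr0 //.
by move=> i /andP[pi si]; rewrite h ?scale0r.
Qed.

Lemma combi_extend sigma lam (p : pred nat) :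
  combi (filter p sigma) lam = combi sigma (fun i => if p i then lam i else 0).
Proof.
rewrite /combi big_filter big_mkcond /=; apply: eq_bigr => i _.
by case: (p i); rewrite ?scale0r.
Qed.

Lemma combiD sigma lam mu :
  combi sigma lam + combi sigma mu = combi sigma (fun i => lam i + mu i).
Proof. by rewrite /combi -big_split; apply: eq_bigr => i _; rewrite scalerDl. Qed.

Lemma combiZ sigma lam (a : R) :
  a *: combi sigma lam = combi sigma (fun i => a * lam i).
Proof. by rewrite /combi scaler_sumr; apply: eq_bigr => i _; rewrite scalerA. Qed.

Lemma eq_in_combi sigma lam mu :
  {in sigma, lam =1 mu} -> combi sigma lam = combi sigma mu.
Proof. by move=> h; apply: eq_big_seq => i si; rewrite h. Qed.

Lemma ray_cone_filter sigma (p : pred nat) w :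
  ray_cone (filter p sigma) w -> ray_cone sigma w.
Proof.
case=> u [lam [uL lam0 ->]]; exists u, (fun i => if p i then lam i else 0).
split=> //; last by rewrite combi_extend.
by move=> i si; case: ifP => // pi; rewrite lam0 // mem_filter pi.
Qed.

Lemma ray_cone_relint sigma w : ray_cone sigma w ->
  exists p : pred nat, ray_relint (filter p sigma) w.
Proof.
case=> u [lam [uL lam0 ->]]; exists (fun i => 0 < lam i).
exists u, lam; split=> // [i|]; first by rewrite mem_filter => /andP[].
congr (_ + _); apply: combi_filter => i si; rewrite lt_neqAle lam0 // andbT.
by rewrite negbK => /eqP.
Qed.

Lemma ray_relint_cone sigma w : ray_relint sigma w -> ray_cone sigma w.
Proof. by case=> u [lam [uL lam0 ->]]; exists u, lam; split=> // i /lam0/ltW. Qed.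

Lemma ray_relint_addL sigma w u :
  u \in L -> ray_relint sigma w -> ray_relint sigma (w + u).
Proof.
move=> uL [u' [lam [u'L lam0 ->]]]; exists (u' + u), lam; split=> //.
  by rewrite memvD.
by rewrite addrAC.
Qed.

Hypothesis Delta_uniq : uniq Delta.
Hypothesis Delta_sorted : forall sigma, sigma \in Delta -> sorted ltn sigma.
Hypothesis Delta_filter : forall sigma (p : pred nat),
  sigma \in Delta -> filter p sigma \in Delta.
(** Together with [relint_pointed] this is the geometric input: independence of the rays modulo [L],
    intersections and the number of cones follow from uniqueness of the relative interior, the
    lineality space from pointedness. *)
Hypothesis relint_inj : forall sigma tau w, sigma \in Delta -> tau \in Delta ->
  ray_relint sigma w -> ray_relint tau w -> sigma = tau.
Hypothesis relint_pointed : forall sigma tau w, sigma \in Delta -> tau \in Delta ->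
  ray_relint sigma w -> ray_relint tau (- w) -> w \in L.

Lemma Delta_uniq_in sigma : sigma \in Delta -> uniq sigma.
Proof. by move/Delta_sorted; apply: sorted_uniq; [apply: ltn_trans | apply: ltnn]. Qed.

(* Moving along a linear relation until a coefficient vanishes would put a
   point in the relative interiors of two different cones. *)
Lemma combi_free sigma c : sigma \in Delta -> combi sigma c \in L ->
  forall i, i \in sigma -> c i = 0.
Proof.
move=> sD; wlog: c / exists2 i, i \in sigma & 0 < c i.
  move=> H cL i si; have [ci|ci|//] := ltgtP (c i) 0; last first.
    by apply: (H c) => //; exists i.
  have cN : combi sigma (fun i => - c i) \in L.
    have -> : (fun i => - c i) = (fun i => -1 * c i) by apply/funext => j; rewrite mulN1r.
    by rewrite -combiZ scaleN1r memvN.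
  by apply: oppr_inj; rewrite oppr0; apply: (H (fun i => - c i)) => //; exists i; rewrite ?oppr_gt0.
case=> i0 si0 ci0 cL; exfalso.
pose M := \big[Num.max/c i0]_(i <- sigma) c i.
have cM i : i \in sigma -> c i <= M by move=> si; apply: le_bigmax_seq.
have M0 : 0 < M by apply: lt_le_trans ci0 (cM _ si0).
have [j sj jM] : exists2 j, j \in sigma & c j = M.
  have : M = c i0 \/ exists2 j, j \in sigma & c j = M.
    rewrite /M; elim: (sigma) => [|x s [IH|[j js IH]]]; first by left; rewrite big_nil.
    - rewrite big_cons; case: (leP (c x) (\big[Num.max/c i0]_(i <- s) c i)); rewrite IH; first by left.
      by move=> _; right; exists x; rewrite ?mem_head.
    - rewrite big_cons; right; case: (leP (c x) (\big[Num.max/c i0]_(i <- s) c i)) => _; last first.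
        by exists x; rewrite ?mem_head.
      by exists j => //; rewrite in_cons js orbT.
  by case=> [e|//]; exists i0.
pose mu i := M - c i.
have w1 : ray_relint sigma (combi sigma (fun=> M)).
  by exists 0, (fun=> M); split; rewrite ?mem0v ?add0r.
have w2 : ray_cone sigma (combi sigma (fun=> M)).
  exists (combi sigma c), mu; split=> // [i si|]; first by rewrite subr_ge0 cM.
  by rewrite combiD; congr combi; apply/funext => i; rewrite /mu addrC subrK.
have w2' : ray_relint (filter (fun i => 0 < mu i) sigma) (combi sigma (fun=> M)).
  exists (combi sigma c), mu; split=> // [i|]; first by rewrite mem_filter => /andP[].
  rewrite -(combi_filter (p := fun i => 0 < mu i)).
    by rewrite combiD; congr combi; apply/funext => i; rewrite /mu addrC subrK.
  move=> i si; rewrite lt_neqAle subr_ge0 cM // andbT negbK => /eqP <- //.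
have := relint_inj sD (Delta_filter (fun i => 0 < mu i) sD) w1 w2'.
by move=> E; move: sj; rewrite E mem_filter /mu jM subrr ltxx.
Qed.

Definition cone_basis sigma := [tuple of vbasis L ++ map_tuple ray (in_tuple sigma)].

Lemma cone_basis_sum sigma (k : 'I_(\dim L + size sigma) -> R) :
  \sum_i k i *: (cone_basis sigma)`_i =
  \sum_(i < \dim L) k (lshift (size sigma) i) *: (vbasis L)`_i
  + \sum_(i < size sigma) k (rshift (\dim L) i) *: ray (nth 0%N sigma i).
Proof.
rewrite big_split_ord /=; congr (_ + _); apply: eq_bigr => i _; congr (_ *: _).
  by rewrite nth_cat size_tuple /= ltn_ord.
by rewrite nth_cat size_tuple /= ltnNge leq_addr /= addKn (nth_map 0%N).
Qed.

Lemma sum_vbasis_mem (k : 'I_(\dim L) -> R) :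
  \sum_(i < \dim L) k i *: (vbasis L)`_i \in L.
Proof. by apply: memv_suml => i _; rewrite memvZ // vbasis_mem // mem_nth // size_tuple. Qed.

(** Passes from coefficients indexed by position in [sigma] to coefficients indexed by ray number,
    the form in which cones are described; distinctness of the rays makes the position
    recoverable. *)
Lemma sum_ray_combi sigma (k : 'I_(size sigma) -> R) : uniq sigma ->
  exists2 c, forall i : 'I_(size sigma), c (nth 0%N sigma i) = k i &
  \sum_(i < size sigma) k i *: ray (nth 0%N sigma i) = combi sigma c.
Proof.
move=> us; pose c j := if insub (index j sigma) is Some i then k i else 0.
have cE (i : 'I_(size sigma)) : c (nth 0%N sigma i) = k i.
  rewrite /c index_uniq ?ltn_ord //; case: insubP => [j _ jE|]; last by rewrite ltn_ord.
  by congr (k _); apply: val_inj.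
exists c => //.
by rewrite /combi (big_nth 0%N) big_mkord; apply: eq_bigr => i _; rewrite cE.
Qed.

Lemma cone_basis_free sigma : sigma \in Delta -> free (cone_basis sigma).
Proof.
move=> sD; apply/freeP => k; rewrite cone_basis_sum.
have [c cE ->] := sum_ray_combi (fun i => k (rshift (\dim L) i)) (Delta_uniq_in sD).
have SL := sum_vbasis_mem (fun i => k (lshift (size sigma) i)).
set S := (X in X + _ = 0) in SL * => E.
have cL : combi sigma c \in L.
  by move/eqP: E; rewrite addrC addr_eq0 => /eqP ->; rewrite memvN.
have c0 := combi_free sD cL.
have S0 : S = 0.
  move: E; rewrite (@eq_in_combi sigma c (fun=> 0)) // [combi _ _]big1 ?addr0 // => i _.
  by rewrite scale0r.
move=> i; case: (split_ordP i) => j ->; last by rewrite -cE c0 // mem_nth.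
by apply: (freeP (basis_free (vbasisP L)) (fun j => k (lshift (size sigma) j))).
Qed.

Definition cone_span sigma : {vspace V} := <<cone_basis sigma>>%VS.

Lemma cone_spanE sigma : cone_span sigma = (L + <<[seq ray i | i <- sigma]>>)%VS.
Proof. by rewrite /cone_span /= span_cat (span_basis (vbasisP L)). Qed.

Lemma dim_cone_span sigma : sigma \in Delta ->
  \dim (cone_span sigma) = (\dim L + size sigma)%N.
Proof. by move/cone_basis_free/eqP->; rewrite size_tuple. Qed.

Lemma cone_spanP sigma w : sigma \in Delta ->
  reflect (exists u lam, u \in L /\ w = u + combi sigma lam) (w \in cone_span sigma).
Proof.
move=> sD; apply: (iffP idP) => [/coord_span|[u [lam [uL ->]]]].
  rewrite cone_basis_sum.
  have [c _ ->] := sum_ray_combi (fun i => coord (cone_basis sigma) (rshift (\dim L) i) w) (Delta_uniq_in sD).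
  by eexists; eexists; split; last eassumption; apply: sum_vbasis_mem.
rewrite cone_spanE memv_add // /combi big_seq; apply: memv_suml => i si.
by rewrite memvZ // memv_span // map_f.
Qed.

(** The coordinate along ray [i] in the basis of the span that extends a basis of [L]. These forms
    are the inequalities of the cone and, summed, supporting forms of its faces. *)
Lemma dual_form sigma i : sigma \in Delta -> i \in sigma ->
  exists l : 'Hom(V, R^o), (forall u, u \in L -> l u = 0) /\
    (forall lam, l (combi sigma lam) = lam i).
Proof.
move=> sD si; have is_ : (index i sigma < size sigma)%N by rewrite index_mem.
pose k := rshift (\dim L) (Ordinal is_).
exists (linfun (coord (cone_basis sigma) k : V -> R^o)); split.
  move=> u uL; rewrite lfunE /= (coord_vbasis uL) linear_sum big1 // => j _.
  rewrite linearZ /=.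
  have -> : (vbasis L)`_j = (cone_basis sigma)`_(lshift (size sigma) j).
    by rewrite /= nth_cat size_tuple /= ltn_ord.
  have jk : (lshift (size sigma) j == k) = false.
    by apply/eqP => /(congr1 val) /= e; have := ltn_ord j; rewrite e -ltn_subRL subnn.
  by rewrite coord_free ?cone_basis_free // jk mulr0.
move=> lam; rewrite lfunE /= /combi (linear_sum (coord (cone_basis sigma) k)).
rewrite (bigD1_seq i si (Delta_uniq_in sD)).
have rE j : j \in sigma -> ray j = (cone_basis sigma)`_(\dim L + index j sigma).
  move=> sj; rewrite /= nth_cat size_tuple /= ltnNge leq_addr /= addKn.
  by rewrite (nth_map 0%N) ?index_mem // nth_index.
rewrite linearZ /= rE // (coord_free k k) ?cone_basis_free // eqxx mulr1 big1_seq ?addr0 //.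
move=> j /andP[ji sj]; have js_ : (index j sigma < size sigma)%N by rewrite index_mem.
rewrite linearZ /= rE // (coord_free (rshift (\dim L) (Ordinal js_)) k) ?cone_basis_free //.
rewrite (inj_eq (@rshift_inj _ _)) -val_eqE /=.
have -> : (index j sigma == index i sigma) = false.
  by apply: contraNF ji => /eqP e; rewrite -(nth_index 0%N sj) e nth_index.
by rewrite mulr0.
Qed.

Lemma dual_forms sigma : sigma \in Delta ->
  exists d : nat -> 'Hom(V, R^o), forall i, i \in sigma ->
    (forall u, u \in L -> d i u = 0) /\ (forall lam, d i (combi sigma lam) = lam i).
Proof.
move=> sD; have : forall i, exists l : 'Hom(V, R^o), i \in sigma ->
    (forall u, u \in L -> l u = 0) /\ (forall lam, l (combi sigma lam) = lam i).
  move=> i; case: (boolP (i \in sigma)) => [si|_]; last by exists 0.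
  by have [l hl] := dual_form sD si; exists l.
by case/choice=> d hd; exists d => i; apply: hd.
Qed.

(** [U] is where [1 - projv U] vanishes, so the coordinates of that map cut it out. Polyhedral cones
    are given by inequalities, so these forms are used below with both signs. *)
Lemma vspace_forms (U : {vspace V}) : exists s : seq 'Hom(V, R^o),
  forall w, w \in U <-> (forall l, l \in s -> l w = 0).
Proof.
pose l (k : 'I_(\dim (fullv : {vspace V}))) : 'Hom(V, R^o) :=
  (linfun (coord (vbasis fullv) k : V -> R^o) \o (\1 - projv U))%VF.
have lE k w : l k w = coord (vbasis fullv) k (w - projv U w).
  by rewrite comp_lfunE lfunE /= add_lfunE opp_lfunE id_lfunE.
exists [seq l k | k <- enum 'I_(\dim (fullv : {vspace V}))] => w.
split=> [wU _ /mapP[k _ ->]|h]; first by rewrite lE projv_id // subrr linear0.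
suff /eqP : w - projv U w = 0 by rewrite subr_eq0 => /eqP ->; apply: memv_proj.
rewrite (coord_vbasis (memvf (w - projv U w))) big1 // => k _.
by rewrite -lE h ?scale0r // map_f // mem_enum.
Qed.

Lemma ray_cone_polyhedral sigma : sigma \in Delta -> polyhedral_cone (ray_cone sigma).
Proof.
move=> sD; have [d hd] := dual_forms sD; have [s hs] := vspace_forms (cone_span sigma).
exists (s ++ [seq - l | l <- s] ++ [seq d i | i <- sigma]); apply/seteqP; split=> w /=.
  case=> u [lam [uL lam0 wE]] l; rewrite !mem_cat => /or3P[ls|/mapP[l' ls ->]|/mapP[i si ->]].
  - rewrite ((hs w).1 _ l ls) //; apply/(cone_spanP _ sD); by exists u, lam.
  - rewrite opp_lfunE ((hs w).1 _ l' ls) ?oppr0 //; apply/(cone_spanP _ sD); by exists u, lam.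
  - by rewrite wE linearD /= (hd i si).1 // (hd i si).2 add0r lam0.
move=> h; have : w \in cone_span sigma.
  apply/hs => l ls; apply/eqP; rewrite eq_le.
  have h1 := h l; have h2 := h (- l); rewrite !mem_cat ls map_f ?orbT // in h1 h2.
  by rewrite h1 // andbT -oppr_ge0; have := h2 isT; rewrite opp_lfunE.
case/(cone_spanP _ sD) => u [lam [uL wE]]; exists u, lam; split=> // i si.
have := h (d i); rewrite !mem_cat map_f ?orbT // => /(_ isT).
by rewrite wE linearD /= (hd i si).1 // (hd i si).2 add0r.
Qed.

Lemma ray_cone_mem sigma i : i \in sigma -> uniq sigma -> ray_cone sigma (ray i).
Proof.
move=> si us; exists 0, (fun j => (j == i)%:R); split; rewrite ?mem0v //.
by rewrite add0r /combi (bigD1_seq i) //= eqxx scale1r big1 ?addr0 // => j /negPf->; rewrite scale0r.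
Qed.

Lemma ray_cone_L sigma u : u \in L -> ray_cone sigma u.
Proof.
move=> uL; exists u, (fun=> 0); split=> //.
by rewrite /combi big1 ?addr0 // => i _; rewrite scale0r.
Qed.

(** A form nonnegative on the cone vanishes on [L], which contains opposites, and is nonnegative on
    each ray; so it kills exactly the nonnegative combinations of the rays on which it is zero. *)
Lemma face_ray_cone sigma (D : set V) : sigma \in Delta -> face D (ray_cone sigma) ->
  exists p : pred nat, D = ray_cone (filter p sigma).
Proof.
move=> sD [l [l0 ->]]; have us := Delta_uniq_in sD.
have lL u : u \in L -> l u = 0.
  move=> uL; have uN : - u \in L by rewrite memvN.
  apply/eqP; rewrite eq_le (l0 _ (ray_cone_L sigma uL)) andbT -oppr_ge0.
  by have := l0 _ (ray_cone_L sigma uN); rewrite linearN.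
have lr i : i \in sigma -> 0 <= l (ray i) by move=> si; apply/l0/ray_cone_mem.
have lE lam : l (combi sigma lam) = \sum_(i <- sigma) lam i * l (ray i).
  by rewrite /combi linear_sum; apply: eq_bigr => i _; rewrite linearZ.
exists (fun i => l (ray i) == 0); apply/seteqP; split=> w /=.
  case=> [[u [lam [uL lam0 wE]]]]; rewrite wE linearD /= lL // add0r lE => /eqP.
  rewrite big_seq psumr_eq0 => [/allP h|i si]; last by rewrite mulr_ge0 ?lam0 ?lr.
  exists u, lam; split=> // [i|]; first by rewrite mem_filter => /andP[_ /lam0].
  congr (_ + _); apply: combi_filter => i si li.
  by have := h i si; rewrite si mulf_eq0 (negPf li) orbF => /eqP.
move=> h; split; first exact: ray_cone_filter h.
case: h => u [lam [uL lam0 ->]]; rewrite linearD /= lL // add0r combi_extend lE.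
by rewrite big1 // => i _; case: eqP => [->|_]; rewrite ?mulr0 ?mul0r.
Qed.

Lemma ray_cone_face sigma (p : pred nat) : sigma \in Delta ->
  face (ray_cone (filter p sigma)) (ray_cone sigma).
Proof.
move=> sD; have [d hd] := dual_forms sD.
(* The dual forms of the rays to be discarded: on the cone their sum is zero only if all these
   coefficients are. *)
pose l := \sum_(i <- sigma | ~~ p i) d i.
have lE u lam : u \in L -> l (u + combi sigma lam) = \sum_(i <- sigma | ~~ p i) lam i.
  move=> uL; rewrite sum_lfunE big_seq_cond [RHS]big_seq_cond; apply: eq_bigr => i /andP[si _].
  by rewrite linearD /= (hd i si).1 // (hd i si).2 add0r.
exists l; split=> [w [u [lam [uL lam0 ->]]]|].
  by rewrite lE // big_seq_cond sumr_ge0 // => i /andP[/lam0].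
apply/seteqP; split=> w /=.
  move=> h; split; first exact: ray_cone_filter h.
  case: h => u [lam [uL lam0 ->]]; rewrite combi_extend lE // big1 // => i.
  by move/negPf ->.
case=> [[u [lam [uL lam0 wE]]]]; rewrite wE lE // => /eqP.
rewrite big_seq_cond psumr_eq0 => [/allP h|i /andP[/lam0]//].
exists u, lam; split=> // [i|]; first by rewrite mem_filter => /andP[_ /lam0].
congr (_ + _); apply: combi_filter => i si pi.
by apply/eqP; have := h i si; rewrite si pi.
Qed.

(** A common point lies in the relative interior of one face of each cone; by [relint_inj] the two
    faces have the same rays, which are then common to both cones. *)
Lemma ray_coneI sigma tau : sigma \in Delta -> tau \in Delta ->
  ray_cone sigma `&` ray_cone tau = ray_cone [seq i <- sigma | i \in tau].
Proof.
move=> sD tD; have tE : [seq i <- sigma | i \in tau] = [seq i <- tau | i \in sigma].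
  apply: (irr_sorted_eq ltn_trans ltnn).
  - by apply: sorted_filter; [apply: ltn_trans | apply: Delta_sorted].
  - by apply: sorted_filter; [apply: ltn_trans | apply: Delta_sorted].
  - by move=> i; rewrite !mem_filter andbC.
apply/seteqP; split=> [w [/ray_cone_relint[p wp] /ray_cone_relint[q wq]]|w wst]; last first.
  by split; [|rewrite tE in wst]; apply: ray_cone_filter wst.
have E := relint_inj (Delta_filter p sD) (Delta_filter q tD) wp wq.
apply: (@ray_cone_filter _ p); rewrite -filter_predI.
rewrite (_ : filter _ _ = filter p sigma); first exact: ray_relint_cone.
apply: eq_in_filter => i si /=; case: (boolP (p i)) => //= pi.
have : i \in filter p sigma by rewrite mem_filter pi.
by rewrite E mem_filter => /andP[].
Qed.

Definition ray_fan : set (set V) := [set ray_cone sigma | sigma in [set` Delta]].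

Lemma ray_fanP : polyhedral_fan ray_fan.
Proof.
split.
- by apply: finite_image; apply: finite_seq.
- by move=> _ [sigma sD <-]; apply: ray_cone_polyhedral.
- move=> _ D [sigma sD <-] /(face_ray_cone sD)[p ->].
  by exists (filter p sigma) => //; apply: Delta_filter.
- move=> _ _ [sigma sD <-] [tau tD <-].
  split; first by rewrite ray_coneI //; apply: ray_cone_face.
  by rewrite setIC ray_coneI //; apply: ray_cone_face.
Qed.

(** The sum of the rays of either cone is interior to a face of the other, so each list of rays is
    contained in the other. *)
Lemma ray_cone_inj : {in Delta &, injective ray_cone}.
Proof.
move=> sigma tau sD tD E.
have h s : ray_relint s (combi s (fun=> 1)).
  by exists 0, (fun=> 1); split; rewrite ?mem0v ?add0r.
have [p hp] := ray_cone_relint (eq_ind _ (fun A => A _) (ray_relint_cone (h sigma)) _ E).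
have E1 := relint_inj sD (Delta_filter p tD) (h sigma) hp.
have [q hq] := ray_cone_relint (eq_ind _ (fun A => A _) (ray_relint_cone (h tau)) _ (esym E)).
have E2 := relint_inj tD (Delta_filter q sD) (h tau) hq.
have st i : i \in sigma -> i \in tau by rewrite E1 mem_filter => /andP[].
have ts i : i \in tau -> i \in sigma by rewrite E2 mem_filter => /andP[].
apply: (irr_sorted_eq ltn_trans ltnn); rewrite ?Delta_sorted // => i.
by apply/idP/idP; [apply: st | apply: ts].
Qed.

Hypothesis Delta_nil : [::] \in Delta.

Lemma fan_support_relint w : fan_support ray_fan w <->
  exists2 sigma, sigma \in Delta & ray_relint sigma w.
Proof.
split=> [[_ [sigma sD <-] /ray_cone_relint[p hp]]|[sigma sD h]].
  by exists (filter p sigma) => //; apply: Delta_filter.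
by exists (ray_cone sigma); [exists sigma | apply: ray_relint_cone].
Qed.

(** The origin is in the support, so a subspace preserving the support is contained in it together
    with the opposites of its vectors, and [relint_pointed] applies. *)
Lemma ray_fan_lineality : lineality_space (fan_support ray_fan) L.
Proof.
split=> [w u /fan_support_relint[sigma sD h] uL|L' hL'].
  by apply/fan_support_relint; exists sigma => //; apply: ray_relint_addL.
apply/subvP => u uL'.
have h0 : fan_support ray_fan 0.
  by exists (ray_cone [::]); [exists [::] | apply: ray_cone_L; rewrite mem0v].
have := hL' _ _ h0 uL'; rewrite add0r => /fan_support_relint[sigma sD hs].
have uN : - u \in L' by rewrite memvN.
have := hL' _ _ h0 uN; rewrite add0r => /fan_support_relint[tau tD ht].
exact: relint_pointed sD tD hs ht.
Qed.

Lemma lineality_space_unique (A : set V) (L1 L2 : {vspace V}) :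
  lineality_space A L1 -> lineality_space A L2 -> L1 = L2.
Proof.
move=> [t1 m1] [t2 m2]; apply/eqP; rewrite eqEsubv.
by rewrite m2 // m1.
Qed.

Lemma linear_hull_ray_cone sigma : sigma \in Delta ->
  linear_hull (ray_cone sigma) (cone_span sigma).
Proof.
move=> sD; split=> [w [u [lam [uL _ ->]]]|U' hU'].
  by apply/(cone_spanP _ sD); exists u, lam.
rewrite cone_spanE subv_add; apply/andP; split.
  by apply/subvP => u uL; apply/hU'/ray_cone_L.
apply/span_subvP => _ /mapP[i si ->].
by apply: hU'; apply: ray_cone_mem => //; apply: Delta_uniq_in.
Qed.

(** The span of a cone has dimension [\dim L + size sigma], by freeness of [cone_basis]; the shift
    by one comes from cutting with the sphere. *)
Lemma cells_ray_fan k :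
  cells ray_fan k = [set ray_cone sigma | sigma in [set` [seq s <- Delta | size s == k.+1]]].
Proof.
apply/seteqP; split=> [C [[sigma sD <-] [L' [U [hL' [hU1 hU2] dU]]]]|_ [sigma /= sk <-]].
  exists sigma => //=; rewrite mem_filter sD andbT.
  have [h1 h2] := linear_hull_ray_cone sD.
  have EU : U = cone_span sigma by apply/eqP; rewrite eqEsubv hU2 // h2.
  move/eqP: dU; rewrite EU dim_cone_span // (lineality_space_unique hL' ray_fan_lineality).
  by rewrite eqn_add2l.
move: sk; rewrite mem_filter => /andP[/eqP sk sD]; split; first by exists sigma.
exists L, (cone_span sigma); split; last by rewrite dim_cone_span ?sk.
  exact: ray_fan_lineality.
exact: linear_hull_ray_cone.
Qed.

Lemma card_ray_cones (s : seq (seq nat)) : uniq s -> {subset s <= Delta} ->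
  ([set ray_cone sigma | sigma in [set` s]] #= `I_(size s))%card.
Proof.
move=> us sD.
have -> : [set ray_cone sigma | sigma in [set` s]] =
    [set ray_cone (nth [::] s i) | i in `I_(size s)].
  apply/seteqP; split=> [_ [sigma /= ss <-]|_ [i /= is_ <-]].
    by exists (index sigma s); rewrite /= ?index_mem // nth_index.
  by exists (nth [::] s i) => //=; apply: mem_nth.
apply: inj_card_eq => i j /set_mem /= is_ /set_mem /= js_ /ray_cone_inj.
by rewrite !sD ?mem_nth // => /(_ isT isT)/eqP; rewrite nth_uniq // => /eqP.
Qed.

Lemma card_cells_ray_fan k :
  (cells ray_fan k #= `I_(count (fun s => size s == k.+1) Delta))%card.
Proof.
rewrite cells_ray_fan -size_filter; apply: card_ray_cones; first exact: filter_uniq.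
by move=> s; rewrite mem_filter => /andP[].
Qed.

Lemma complex_dim_ray_fan k : has (fun s => size s == k.+1) Delta ->
  all (fun s => size s <= k.+1)%N Delta -> complex_dim ray_fan k.
Proof.
move=> /hasP[sigma sD sk] /allP dle; split.
  exists (ray_cone sigma); rewrite cells_ray_fan; exists sigma => //=.
  by rewrite mem_filter sk.
move=> j kj; rewrite cells_ray_fan; apply/seteqP; split=> // C [tau /=].
rewrite mem_filter => /andP[/eqP tj /dle]; rewrite tj ltnS => jk.
by have := leq_trans kj jk; rewrite ltnn.
Qed.

Lemma card_vertices_of k C : cells ray_fan k C -> (vertices_of ray_fan C #= `I_k.+1)%card.
Proof.
rewrite cells_ray_fan => -[sigma /=]; rewrite mem_filter => /andP[/eqP sk sD] <-.
have us := Delta_uniq_in sD.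
have D1 i : i \in sigma -> [:: i] \in Delta.
  by move=> si; have := Delta_filter (pred1 i) sD; rewrite filter_pred1_uniq.
have -> : vertices_of ray_fan (ray_cone sigma) =
    [set ray_cone tau | tau in [set` [seq [:: i] | i <- sigma]]].
  rewrite /vertices_of cells_ray_fan; apply/seteqP; split.
    move=> D [[tau /=]]; rewrite mem_filter => /andP[/eqP t1 tD] <-.
    case/(face_ray_cone sD) => p /ray_cone_inj E; have {}E := E tD (Delta_filter p sD).
    exists tau => //=; case: tau t1 tD E => [|i [|]] //= _ _ E; apply: map_f.
    have : i \in filter p sigma by rewrite -E mem_head.
    by rewrite mem_filter => /andP[].
  move=> _ [tau /= /mapP[i si ->] <-]; split.
    by exists [:: i] => //=; rewrite mem_filter /= D1.
  by rewrite -(filter_pred1_uniq us si); apply: ray_cone_face.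
rewrite -sk -(size_map (fun i => [:: i])); apply: card_ray_cones.
  by rewrite map_inj_uniq // => i j [].
by move=> _ /mapP[i si ->]; apply: D1.
Qed.

End SimplicialFan.

(** * Integer vectors and their real images *)

Section IntegerVectors.
Variable R : realFieldType.

(** Certificates are computed over binary integers, which suit [vm_compute]; this map transports the
    results to the reals. *)
Definition zreal (z : Z) : R := (int_of_Z z)%:~R.

Lemma zrealD x y : zreal (x + y)%BZ = zreal x + zreal y.
Proof. by rewrite /zreal -intrD -(rmorphD int_of_Z). Qed.

Lemma zrealM x y : zreal (x * y)%BZ = zreal x * zreal y.
Proof. by rewrite /zreal -intrM -(rmorphM int_of_Z). Qed.

Lemma zrealN x : zreal (- x)%BZ = - zreal x.
Proof. by rewrite /zreal -rmorphN -(rmorphN int_of_Z). Qed.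

Lemma zreal0 : zreal 0%BZ = 0. Proof. by []. Qed.
Lemma zreal1 : zreal 1%BZ = 1. Proof. by []. Qed.

Lemma int_of_Z_ge0 x : (0 <= int_of_Z x) = Z.leb 0 x.
Proof. by case: x => [|p|p] //=; have [n ->] := Pos2Nat.is_succ p. Qed.

Lemma zreal_ge0 x : (0 <= zreal x) = Z.leb 0 x.
Proof. by rewrite /zreal ler0z int_of_Z_ge0. Qed.

Lemma zreal_eq0 x : (zreal x == 0) = (x == 0%BZ).
Proof. by rewrite /zreal intr_eq0 -(inj_eq (can_inj int_of_ZK)). Qed.

Lemma zreal_gt0 x : (0 < zreal x) = Z.ltb 0 x.
Proof.
rewrite lt_neqAle eq_sym zreal_eq0 zreal_ge0.
by case: x.
Qed.

(** Lists are read as vectors padded by zeros, so [[::]] is the zero vector and lists of different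
    lengths may be combined. *)
Definition zvec := seq Z.

Fixpoint zdot (l g : zvec) : Z :=
  match l, g with x :: l, y :: g => (x * y + zdot l g)%BZ | _, _ => 0%BZ end.

Fixpoint zcomb (a : Z) (g : zvec) (b : Z) (h : zvec) : zvec :=
  match g, h with
  | [::], h => [seq b * y | y <- h]%BZ
  | g, [::] => [seq a * x | x <- g]%BZ
  | x :: g, y :: h => (a * x + b * y)%BZ :: zcomb a g b h
  end.

Definition zscale a (g : zvec) : zvec := [seq a * x | x <- g]%BZ.

(* The quotient is kept only when it is exact, so that no property of the gcd is needed. *)
Definition zprim (g : zvec) : zvec :=
  let d := foldr Z.gcd 0%BZ g in
  let h := [seq Z.div x d | x <- g] in
  if Z.ltb 1 d && (zscale d h == g) then h else g.

Definition znull (g : zvec) := all (fun x => x == 0%BZ) g.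

Variable n : nat.

Definition rvec (g : zvec) : 'rV[R]_n := \row_i zreal (nth 0%BZ g i).

Definition rdot (l : zvec) (q : 'rV[R]_n) : R := \sum_(i < n) zreal (nth 0%BZ l i) * q 0 i.

Lemma rdotD l q q' : rdot l (q + q') = rdot l q + rdot l q'.
Proof. by rewrite /rdot -big_split; apply: eq_bigr => i _; rewrite !mxE mulrDr. Qed.

Lemma rdotZ l a q : rdot l (a *: q) = a * rdot l q.
Proof. by rewrite /rdot big_distrr; apply: eq_bigr => i _; rewrite !mxE mulrCA. Qed.

Lemma rdot0 l : rdot l 0 = 0.
Proof. by rewrite -(scale0r 0) rdotZ mul0r. Qed.

Lemma rdot_sum l (I : Type) (r : seq I) (F : I -> 'rV[R]_n) :
  rdot l (\sum_(i <- r) F i) = \sum_(i <- r) rdot l (F i).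
Proof. by apply: big_morph; [apply: rdotD | apply: rdot0]. Qed.

Lemma rdot_rvec l g : (size l <= n)%N -> rdot l (rvec g) = zreal (zdot l g).
Proof.
move=> sl; rewrite /rdot.
under eq_bigr do rewrite mxE -zrealM.
rewrite -(big_mkord xpredT (fun i => zreal (nth 0 l i * nth 0 g i)%BZ)).
elim: l g n sl => [|x l IH] g m sl /=.
  by rewrite big1 // => i _; rewrite nth_nil /= zreal0.
case: m sl => // m sl; case: g => [|y g].
  by rewrite big1 // => i _; rewrite nth_nil Z.mul_0_r zreal0.
by rewrite big_nat_recl // zrealD -(IH g m).
Qed.

Lemma nth_zscale a g i : nth 0%BZ (zscale a g) i = (a * nth 0 g i)%BZ.
Proof.
have [ig|gi] := ltnP i (size g); first by rewrite (nth_map 0%BZ).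
by rewrite !nth_default ?size_map // Z.mul_0_r.
Qed.

Lemma nth_zcomb a g b h i :
  nth 0%BZ (zcomb a g b h) i = (a * nth 0 g i + b * nth 0 h i)%BZ.
Proof.
elim: g h i => [|x g IH] [|y h] i /=.
- by rewrite !nth_nil !Z.mul_0_r.
- by rewrite nth_nil Z.mul_0_r (nth_zscale b (y :: h)).
- by rewrite nth_nil Z.mul_0_r (nth_zscale a (x :: g)) Z.add_0_r.
- by case: i => [|i] //=.
Qed.

Lemma rvec_scale a g : rvec (zscale a g) = zreal a *: rvec g.
Proof. by apply/rowP => i; rewrite !mxE nth_zscale zrealM. Qed.

Lemma rvec_comb a g b h : rvec (zcomb a g b h) = zreal a *: rvec g + zreal b *: rvec h.
Proof. by apply/rowP => i; rewrite !mxE nth_zcomb zrealD !zrealM. Qed.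

Lemma rdot_comb a g b h q : rdot (zcomb a g b h) q = zreal a * rdot g q + zreal b * rdot h q.
Proof.
rewrite /rdot !big_distrr -big_split; apply: eq_bigr => i _ /=.
by rewrite nth_zcomb zrealD !zrealM mulrDl !mulrA.
Qed.

Lemma rvec_prim g : exists2 c, 0 < c & rvec g = c *: rvec (zprim g).
Proof.
rewrite /zprim; case: ifP => [/andP[d1 /eqP {1}<-]|_]; last by exists 1; rewrite ?scale1r.
rewrite rvec_scale; eexists; last reflexivity.
by rewrite zreal_gt0; move/Z.ltb_lt: d1 => d1; apply/Z.ltb_lt/(Z.lt_trans _ _ _ _ d1).
Qed.

Lemma rvec_null g : znull g -> rvec g = 0.
Proof.
move=> /allP g0; apply/rowP => i; rewrite !mxE.
have [ig|gi] := ltnP i (size g); last by rewrite nth_default.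
by rewrite (eqP (g0 _ (mem_nth 0%BZ ig))).
Qed.

End IntegerVectors.

(** * Double description of polyhedral cones *)

Section Branching.
Variables (R : realFieldType) (n : nat).
Local Notation rvec := (rvec R n).
Local Notation rdot := (@rdot R n).
Implicit Types (st : seq zvec * seq zvec) (q : 'rV[R]_n) (l g : zvec).

(** A state lists the generators of a cone, lines with arbitrary and rays with nonnegative
    coefficients. The inductive form lets generators repeat, so the lists can be altered without
    bookkeeping of coefficients. *)
Inductive generated st : 'rV[R]_n -> Prop :=
| generated0 : generated st 0
| generated_line a g q : g \in st.1 -> generated st q -> generated st (a *: rvec g + q)
| generated_ray a g q : 0 <= a -> g \in st.2 -> generated st q -> generated st (a *: rvec g + q).

Lemma generatedD st q q' : generated st q -> generated st q' -> generated st (q + q').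
Proof.
move=> h h'; elim: h => [|a g x gL _ IH|a g x a0 gR _ IH]; rewrite ?add0r // -addrA.
  exact: generated_line.
exact: generated_ray.
Qed.

Lemma generatedZ st a q : 0 <= a -> generated st q -> generated st (a *: q).
Proof.
move=> a0; elim=> [|b g x gL _ IH|b g x b0 gR _ IH]; rewrite ?scaler0.
- exact: generated0.
- by rewrite scalerDr scalerA; apply: generated_line.
- by rewrite scalerDr scalerA; apply: generated_ray => //; apply: mulr_ge0.
Qed.

Lemma generated_sum st (I : eqType) (r : seq I) (F : I -> 'rV[R]_n) :
  (forall i, i \in r -> generated st (F i)) -> generated st (\sum_(i <- r) F i).
Proof.
elim: r => [|i r IH] h; first by rewrite big_nil; apply: generated0.
rewrite big_cons; apply: generatedD; first by apply: h; rewrite mem_head.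
by apply: IH => j jr; apply: h; rewrite in_cons jr orbT.
Qed.

(** Repeated uses of a generator are collected into one coefficient, so that the rays can be sorted
    by the sign of a linear form. *)
Lemma generated_coef st q : generated st q -> exists c m : zvec -> R,
  (forall g, 0 <= m g) /\
  q = \sum_(g <- undup st.1) c g *: rvec g + \sum_(g <- undup st.2) m g *: rvec g.
Proof.
have upd s a g (c : zvec -> R) : g \in s ->
    \sum_(h <- undup s) (c h + (h == g)%:R * a) *: rvec h =
    a *: rvec g + \sum_(h <- undup s) c h *: rvec h.
  move=> gs; under eq_bigr do rewrite scalerDl.
  rewrite big_split /= addrC; congr (_ + _).
  rewrite (bigD1_seq g) ?mem_undup ?undup_uniq //= eqxx mul1r big1 ?addr0 // => h /negPf ->.
  by rewrite mul0r scale0r.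
elim=> [|a g x gL _ [c [m [m0 ->]]]|a g x a0 gR _ [c [m [m0 ->]]]].
- exists (fun=> 0), (fun=> 0); split=> //.
  by rewrite !big1 ?addr0 // => i _; rewrite scale0r.
- exists (fun h => c h + (h == g)%:R * a), m; split=> //.
  by rewrite upd // addrA.
- exists c, (fun h => m h + (h == g)%:R * a); split; last by rewrite upd // addrCA.
  by move=> h; rewrite addr_ge0 // mulr_ge0 // ler0n.
Qed.

(** Normalization between cuts keeps the state small: only the direction of a generator matters. *)
Definition clean (s : seq zvec) : seq zvec := undup [seq g <- map zprim s | ~~ znull g].

Lemma generated_clean st q :
  generated st q -> generated (clean st.1, clean st.2) q.
Proof.
have cl s g : g \in s -> rvec g = 0 \/
    exists c h, [/\ 0 < c, h \in clean s & rvec g = c *: rvec h].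
  move=> gs; have [c c0 ->] := rvec_prim R n g.
  case: (boolP (znull (zprim g))) => [/rvec_null->|nz]; first by left; rewrite scaler0.
  by right; exists c, (zprim g); split=> //; rewrite mem_undup mem_filter nz map_f.
elim=> [|a g x gL _ IH|a g x a0 gR _ IH]; first exact: generated0.
  have [->|[c [h [c0 hL ->]]]] := cl _ _ gL; first by rewrite scaler0 add0r.
  by rewrite scalerA; apply: generated_line.
have [->|[c [h [c0 hL ->]]]] := cl _ _ gR; first by rewrite scaler0 add0r.
by rewrite scalerA; apply: generated_ray => //; rewrite mulr_ge0 // ltW.
Qed.

(** With [d] the value of [l] at [x], the form [l] vanishes here; for positive [d] this is a
    positive multiple of the projection of [g] along [x]. If moreover [l] is negative at [g], both
    coefficients are positive, which is how two rays on opposite sides of the hyperplane are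
    combined. *)
Definition project l d x g := zcomb d g (- zdot l g)%BZ x.

(** A line transverse to the hyperplane, oriented so that [l] is positive on it, absorbs the
    [l]-component of all generators. Without such a line, rays on the hyperplane are kept and each
    positive ray is joined to each negative one. *)
Definition cut_eq l st : seq zvec * seq zvec :=
  if [seq x <- st.1 | zdot l x != 0%BZ] is x :: _ then
    let x := if Z.ltb 0 (zdot l x) then x else zscale (-1) x in
    let d := zdot l x in
    (clean (map (project l d x) st.1), clean (map (project l d x) st.2))
  else
    let P := [seq g <- undup st.2 | Z.ltb 0 (zdot l g)] in
    let N := [seq g <- undup st.2 | Z.ltb (zdot l g) 0] in
    let Z := [seq g <- undup st.2 | zdot l g == 0%BZ] in
    (clean st.1, clean (Z ++ [seq project l (zdot l y) y z | y <- P, z <- N])).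

(** Differs from [cut_eq] in what survives on the positive side: half of the transverse line, or the
    positive rays. *)
Definition cut_ge l st : seq zvec * seq zvec :=
  if [seq x <- st.1 | zdot l x != 0%BZ] is x :: _ then
    let x := if Z.ltb 0 (zdot l x) then x else zscale (-1) x in
    let d := zdot l x in
    (clean (map (project l d x) st.1), clean (x :: map (project l d x) st.2))
  else
    let P := [seq g <- undup st.2 | Z.ltb 0 (zdot l g)] in
    let N := [seq g <- undup st.2 | Z.ltb (zdot l g) 0] in
    let Z := [seq g <- undup st.2 | zdot l g == 0%BZ] in
    (clean st.1, clean (Z ++ P ++ [seq project l (zdot l y) y z | y <- P, z <- N])).

Lemma zdot_scale l a g : zdot l (zscale a g) = (a * zdot l g)%BZ.
Proof.
elim: l g => [|x l IH] [|y g] /=; rewrite ?Z.mul_0_r // IH.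
by rewrite Z.mul_add_distr_l !Z.mul_assoc (Z.mul_comm x a).
Qed.

Lemma rvec_project l d x g :
  rvec (project l d x g) = zreal R d *: rvec g - zreal R (zdot l g) *: rvec x.
Proof. by rewrite rvec_comb zrealN scaleNr. Qed.

Lemma generated_project l d x st q : (size l <= n)%N -> 0 < zreal R d ->
  zdot l x = d -> generated st q ->
  exists2 q', generated (map (project l d x) st.1, map (project l d x) st.2) q' &
    q = q' + (rdot l q / zreal R d) *: rvec x.
Proof.
move=> sl d0 xd; elim=> [|a g y gL _ [y' hy' yE]|a g y a0 gR _ [y' hy' yE]].
- by exists 0; [apply: generated0 | rewrite rdot0 mul0r scale0r addr0].
- exists ((a / zreal R d) *: rvec (project l d x g) + y').
    by apply: generated_line => //=; apply: map_f.
  rewrite {1}yE rdotD rdotZ rdot_rvec // rvec_project scalerBr !scalerA divfK ?gt_eqF //.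
  by rewrite mulrDl scalerDl mulrAC addrACA subrK.
- exists ((a / zreal R d) *: rvec (project l d x g) + y').
    by apply: generated_ray => //=; [rewrite divr_ge0 // ltW | apply: map_f].
  rewrite {1}yE rdotD rdotZ rdot_rvec // rvec_project scalerBr !scalerA divfK ?gt_eqF //.
  by rewrite mulrDl scalerDl mulrAC addrACA subrK.
Qed.

Lemma orient_line l st x : x \in [seq x <- st.1 | zdot l x != 0%BZ] ->
  let y := if Z.ltb 0 (zdot l x) then x else zscale (-1) x in
  0 < zreal R (zdot l y).
Proof.
rewrite mem_filter => /andP[lx _] /=; case: ifP => [|lx0]; first by rewrite zreal_gt0.
by rewrite zdot_scale zreal_gt0; move: lx lx0; case: (zdot l x).
Qed.

Lemma generated_mono st st' q : {subset st.1 <= st'.1} ->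
  (forall g, g \in st.2 -> generated st' (rvec g)) ->
  generated st q -> generated st' q.
Proof.
move=> h1 h2; elim=> [|a g x gL _ IH|a g x a0 gR _ IH]; first exact: generated0.
  by apply: generated_line => //; apply: h1.
by apply: generatedD => //; apply: generatedZ => //; apply: h2.
Qed.

Lemma generated_mem st g : g \in st.2 -> generated st (rvec g).
Proof.
move=> gR; rewrite -[rvec g]scale1r -[_ *: _]addr0.
by apply: generated_ray => //; apply: generated0.
Qed.

(* Write T for the l-value of the positive part of q: the negative part is
   absorbed by the combinations of the rays on both sides of the hyperplane. *)
Lemma generated_split (Z P N : seq zvec) (A : 'rV[R]_n) lines l (m : zvec -> R)
    (st := (lines, Z ++ [seq project l (zdot l y) y z | y <- P, z <- N]))
    (T := \sum_(g <- P) m g * zreal R (zdot l g))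
    (T' := \sum_(g <- N) m g * - zreal R (zdot l g)) :
  (forall g, 0 <= m g) ->
  (forall g, g \in P -> 0 < zreal R (zdot l g)) ->
  (forall g, g \in N -> zreal R (zdot l g) < 0) ->
  generated st A -> T' <= T ->
  exists2 q', generated st q' & exists2 c, 0 <= c &
    A + \sum_(g <- P) m g *: rvec g + \sum_(g <- N) m g *: rvec g =
    q' + c *: \sum_(g <- P) m g *: rvec g /\ c * T = T - T'.
Proof.
move=> m0 hP hN hA TT.
have T'0 : 0 <= T'.
  by rewrite /T' big_seq sumr_ge0 // => g /hN h; rewrite mulr_ge0 // oppr_ge0 ltW.
have T0 := le_trans T'0 TT.
have [T0E|Tn0] := eqVneq T 0.
  have T'E : T' = 0 by apply/eqP; rewrite eq_le T'0 -T0E TT.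
  exists A => //; exists 1 => //; rewrite scale1r mul1r T'E subr0; split=> //.
  rewrite [X in _ + X](_ : _ = 0) ?addr0 // big_seq big1 // => g gN.
  move/eqP: T'E; rewrite /T' big_seq psumr_eq0 => [/allP/(_ _ gN)|i /hN h].
    by rewrite gN /= mulf_eq0 oppr_eq0 (lt_eqF (hN _ gN)) orbF => /eqP->; rewrite scale0r.
  by rewrite mulr_ge0 // oppr_ge0 ltW.
have Tp : 0 < T by rewrite lt_neqAle eq_sym Tn0.
pose B := \sum_(y <- P) \sum_(z <- N) (m y * m z / T) *: rvec (project l (zdot l y) y z).
exists (A + B).
  apply: generatedD => //; apply: generated_sum => y yP; apply: generated_sum => z zN.
  apply: generatedZ; first by rewrite divr_ge0 ?mulr_ge0.
  by apply: generated_mem; rewrite mem_cat; apply/orP; right; apply: allpairs_f.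
exists ((T - T') / T); first by rewrite divr_ge0 // subr_ge0.
split; last by rewrite divfK.
rewrite -!addrA; congr (A + _).
have -> : B = \sum_(z <- N) m z *: rvec z + (T' / T) *: \sum_(y <- P) m y *: rvec y.
  rewrite /B; under eq_bigr => y _.
    under eq_bigr do rewrite rvec_project scalerBr !scalerA.
    rewrite sumrB; over.
  rewrite sumrB exchange_big /=; congr (_ + _).
    apply: eq_bigr => z _; rewrite -scaler_suml; congr (_ *: _).
    transitivity (m z / T * T); last by rewrite divfK.
    by rewrite {2}/T big_distrr; apply: eq_bigr => y _ /=; ring.
  rewrite scaler_sumr -sumrN; apply: eq_bigr => y _; rewrite -scaler_suml -scaleNr scalerA.
  congr (_ *: _); rewrite /T' !big_distrl /= -sumrN; apply: eq_bigr => z _; ring.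
rewrite addrC -addrA; congr (_ + _).
by rewrite -scalerDl -mulrDl addrC subrK divff // scale1r.
Qed.

(** Shared by both cuts when no line is transverse: what the new generators do not account for is a
    combination of positive rays carrying the whole value of [l] at [q]. For the equation this value
    is zero and the remainder disappears; for the inequality the positive rays are kept. *)
Lemma cut_pointed l st q : (size l <= n)%N -> generated st q -> 0 <= rdot l q ->
  [seq x <- st.1 | zdot l x != 0%BZ] = [::] ->
  let P := [seq g <- undup st.2 | Z.ltb 0 (zdot l g)] in
  let N := [seq g <- undup st.2 | Z.ltb (zdot l g) 0] in
  let Z := [seq g <- undup st.2 | zdot l g == 0%BZ] in
  let st' := (st.1, Z ++ [seq project l (zdot l y) y z | y <- P, z <- N]) in
  exists2 q', generated st' q' & exists m : zvec -> R,
    [/\ forall g, 0 <= m g, q = q' + \sum_(g <- P) m g *: rvec g &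
        \sum_(g <- P) m g * zreal R (zdot l g) = rdot l q].
Proof.
move=> sl hq lq nolines P N Z st'.
have lines0 x : x \in st.1 -> zreal R (zdot l x) = 0.
  move=> xL; apply/eqP; rewrite zreal_eq0; apply: contraT => lx.
  have h : x \in [seq x <- st.1 | zdot l x != 0%BZ] by rewrite mem_filter lx.
  by rewrite nolines in h.
have [c [m [m0 qE]]] := generated_coef hq.
have hP g : g \in P -> 0 < zreal R (zdot l g).
  by rewrite mem_filter zreal_gt0 => /andP[].
have hN g : g \in N -> zreal R (zdot l g) < 0.
  rewrite mem_filter => /andP[h _]; rewrite -oppr_gt0 -zrealN zreal_gt0.
  by move: h; case: (zdot l g).
have split3 (F : zvec -> 'rV[R]_n) : \sum_(g <- undup st.2) F g =
    \sum_(g <- Z) F g + \sum_(g <- P) F g + \sum_(g <- N) F g.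
  rewrite !big_filter (bigID (fun g => zdot l g == 0%BZ)) /= -addrA; congr (_ + _).
  rewrite (bigID (fun g => Z.ltb 0 (zdot l g))) /=.
  by congr (_ + _); apply: eq_bigl => g; case: (zdot l g).
pose A := \sum_(g <- undup st.1) c g *: rvec g + \sum_(g <- Z) m g *: rvec g.
have qE' : q = A + \sum_(g <- P) m g *: rvec g + \sum_(g <- N) m g *: rvec g.
  by rewrite qE split3 !addrA.
have hA : generated st' A.
  apply: generatedD; apply: generated_sum => g.
    rewrite mem_undup => gL; rewrite -[_ *: _]addr0.
    by apply: generated_line => //; apply: generated0.
  move=> gZ; apply: generatedZ => //; apply: generated_mem.
  by rewrite /= mem_cat gZ.
have A0 : rdot l A = 0.
  rewrite /A rdotD !rdot_sum !big1_seq ?addr0 // => g /=.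
    by rewrite mem_filter => /andP[/eqP lg _]; rewrite rdotZ rdot_rvec // lg mulr0.
  by rewrite mem_undup => gL; rewrite rdotZ rdot_rvec // lines0 ?mulr0.
have lqE : rdot l q = \sum_(g <- P) m g * zreal R (zdot l g)
    - \sum_(g <- N) m g * - zreal R (zdot l g).
  rewrite {1}qE' (rdotD _ (A + _)) (rdotD _ A) A0 add0r !rdot_sum -sumrN; congr (_ + _).
    by apply: eq_bigr => g _; rewrite rdotZ rdot_rvec.
  by apply: eq_bigr => g _; rewrite rdotZ rdot_rvec // mulrN opprK.
have TT := lq; rewrite lqE subr_ge0 in TT.
have [q' hq' [e e0 [E1 E2]]] := generated_split m0 hP hN hA TT.
exists q' => //; exists (fun g => e * m g); split.
- by move=> g; rewrite mulr_ge0.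
- by rewrite {1}qE' E1 scaler_sumr; congr (_ + _); apply: eq_bigr => g _; rewrite scalerA.
- by rewrite lqE -E2 big_distrr; apply: eq_bigr => g _ /=; rewrite mulrA.
Qed.

Lemma cut_eqP l st q : (size l <= n)%N -> generated st q -> rdot l q = 0 ->
  generated (cut_eq l st) q.
Proof.
move=> sl hq lq; rewrite /cut_eq; case E : [seq x <- st.1 | zdot l x != 0%BZ] => [|x s].
  apply: (@generated_clean (_, _)).
  have lq0 : 0 <= rdot l q by rewrite lq.
  have [q' hq' [m [m0 qE mT]]] := cut_pointed sl hq lq0 E.
  rewrite qE [X in _ + X]big1_seq ?addr0 // => g /andP[_ gP].
  move/eqP: mT; rewrite lq big_seq psumr_eq0 => [/allP/(_ _ gP)|h]; last first.
    by rewrite mem_filter => /andP[h0 _]; rewrite mulr_ge0 // ltW // zreal_gt0.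
  rewrite gP /= mulf_eq0 => /orP[/eqP->|]; first by rewrite scale0r.
  by move: gP; rewrite mem_filter zreal_eq0 => /andP[]; case: (zdot l g).
apply: (@generated_clean (_, _)).
have xin : x \in [seq x <- st.1 | zdot l x != 0%BZ] by rewrite E mem_head.
have /= d0 := orient_line xin.
have [q' hq' ->] := generated_project sl d0 erefl hq.
by rewrite lq mul0r scale0r addr0.
Qed.

Lemma cut_geP l st q : (size l <= n)%N -> generated st q -> 0 <= rdot l q ->
  generated (cut_ge l st) q.
Proof.
move=> sl hq lq; rewrite /cut_ge; case E : [seq x <- st.1 | zdot l x != 0%BZ] => [|x s].
  apply: (@generated_clean (_, _)).
  have [q' hq' [m [m0 qE _]]] := cut_pointed sl hq lq E.
  rewrite qE; apply: generatedD; last first.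
    apply: generated_sum => g gP; apply: generatedZ => //; apply: generated_mem.
    by rewrite !mem_cat gP orbT.
  apply: generated_mono hq' => //= g; rewrite mem_cat => h.
  by apply: generated_mem; rewrite /= !mem_cat; case/orP: h => ->; rewrite ?orbT.
apply: (@generated_clean (_, _)).
have xin : x \in [seq x <- st.1 | zdot l x != 0%BZ] by rewrite E mem_head.
have /= d0 := orient_line xin.
have [q' hq' ->] := generated_project sl d0 erefl hq.
apply: generatedD.
  by apply: generated_mono hq' => //= g gR; apply: generated_mem; rewrite inE gR orbT.
apply: generatedZ; first by rewrite divr_ge0 // ltW.
by apply: generated_mem; rewrite mem_head.
Qed.

End Branching.

(** * Branching over the minimal pairs of trinomials *)

Section BranchTree.
Variables (R : realFieldType) (n : nat).
Local Notation rvec := (rvec R n).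
Local Notation rdot := (@rdot R n).
Variables (triples : seq (zvec * zvec * zvec)) (rays : seq zvec).
Variable leaves : seq (seq (nat * zvec)).
Implicit Types (st : seq zvec * seq zvec) (q : 'rV[R]_n).

Definition vanishes (t : zvec * zvec * zvec) q : Prop :=
  let: (a, b, c) := t in
  [\/ rdot b q = rdot c q /\ rdot b q <= rdot a q,
      rdot a q = rdot c q /\ rdot a q <= rdot b q |
      rdot a q = rdot b q /\ rdot a q <= rdot c q].

Definition zsub g h := zcomb 1 g (-1) h.

Definition branch (a b c : zvec) st := cut_ge (zsub a b) (cut_eq (zsub b c) st).

(** A leaf pairs ray numbers with linear forms; the form attached to ray [i] proposes the
    coefficient of [g] along that ray. *)
Definition coefficient (c : seq (nat * zvec)) (g : zvec) i : Z :=
  zdot (nth [::] (unzip2 c) (index i (unzip1 c))) g.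

(** Containment in the leaf cone is tested without solving equations: the proposed coefficients are
    nonnegative and reproduce each generator. *)
Definition leaf_ok (c : seq (nat * zvec)) st : bool :=
  nilp st.1 && all (fun g =>
    all (fun i => Z.leb 0 (coefficient c g i)) (unzip1 c)
    && znull (zsub g (foldr (fun i h => zcomb (coefficient c g i) (nth [::] rays i) 1 h)
                      [::] (unzip1 c)))) st.2.

(* The codes list the nodes of the search tree in preorder: an index into
   triples for an inner node, and size triples plus the index of a leaf cone
   otherwise; nodes without generators carry no code. *)
Fixpoint explore fuel st (codes : seq nat) : option (seq nat) :=
  if fuel isn't fuel'.+1 then None else
  if nilp st.1 && nilp st.2 then Some codes else
  if codes isn't k :: codes1 then None else
  if (k < size triples)%N then
    let: (a, b, c) := nth ([::], [::], [::]) triples k in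
    if explore fuel' (branch a b c st) codes1 is Some codes2 then
      if explore fuel' (branch b a c st) codes2 is Some codes3 then
        explore fuel' (branch c a b st) codes3
      else None
    else None
  else if leaf_ok (nth [::] leaves (k - size triples)) st then Some codes1 else None.

Definition in_cone (s : seq nat) q : Prop :=
  exists2 lam : nat -> R, forall i, i \in s -> 0 <= lam i &
    q = \sum_(i <- s) lam i *: rvec (nth [::] rays i).

Definition covered q : Prop := exists c, in_cone (unzip1 (nth [::] leaves c)) q.

Hypothesis size_triples : all (fun t : zvec * zvec * zvec =>
  let: (a, b, c) := t in [&& size a == n, size b == n & size c == n]) triples.

Lemma size_zsub g h : size g = n -> size h = n -> size (zsub g h) = n.
Proof.
rewrite /zsub; move: n => m; elim: g h m => [|x g IH] [|y h] [|m] //= [sg] [sh].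
by rewrite (IH h m).
Qed.

Lemma rdot_sub g h q : rdot (zsub g h) q = rdot g q - rdot h q.
Proof. by rewrite rdot_comb zreal1 mul1r -[(-1)%BZ]/(Z.opp 1) zrealN mulN1r. Qed.

Lemma branchP a b c st q : size a = n -> size b = n -> size c = n ->
  generated st q -> rdot b q = rdot c q -> rdot b q <= rdot a q ->
  generated (branch a b c st) q.
Proof.
move=> sa sb sc hq bc ba; apply: cut_geP; rewrite ?size_zsub //.
  by apply: cut_eqP; rewrite ?size_zsub // rdot_sub bc subrr.
by rewrite rdot_sub subr_ge0.
Qed.

Lemma in_coneD s q q' : in_cone s q -> in_cone s q' -> in_cone s (q + q').
Proof.
move=> [lam lam0 ->] [mu mu0 ->]; exists (fun i => lam i + mu i).
  by move=> i si; rewrite addr_ge0 ?lam0 ?mu0.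
by rewrite -big_split; apply: eq_bigr => i _; rewrite scalerDl.
Qed.

Lemma in_coneZ s a q : 0 <= a -> in_cone s q -> in_cone s (a *: q).
Proof.
move=> a0 [lam lam0 ->]; exists (fun i => a * lam i).
  by move=> i si; rewrite mulr_ge0 ?lam0.
by rewrite scaler_sumr; apply: eq_bigr => i _; rewrite scalerA.
Qed.

Lemma in_cone0 s : in_cone s 0.
Proof. by exists (fun=> 0) => //; rewrite big1 // => i _; rewrite scale0r. Qed.

Lemma leaf_okP c st q : leaf_ok c st -> generated st q -> in_cone (unzip1 c) q.
Proof.
case/andP=> /nilP L0 /allP R0; elim=> [|a g x gL|a g x a0 gR _ IH].
- exact: in_cone0.
- by move: gL; rewrite L0.
apply: in_coneD => //; apply: in_coneZ => //.
have /andP[/allP c0 /(rvec_null R n)] := R0 _ gR.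
rewrite rvec_comb zreal1 scale1r -[(-1)%BZ]/(Z.opp 1) zrealN scaleN1r => /eqP.
rewrite subr_eq0 => /eqP ->; exists (fun i => zreal R (coefficient c g i)).
  by move=> i /c0; rewrite zreal_ge0.
elim: (unzip1 c) => [|i s IHs] /=; last by rewrite rvec_comb zreal1 scale1r IHs big_cons.
by rewrite big_nil; apply/rowP => i; rewrite !mxE nth_nil.
Qed.

(** The three ways in which the minimum of a trinomial can be attained twice are the three children
    of a node, so [q] follows a path down to a leaf whose cone contains it. *)
Lemma exploreP fuel st codes codes' q : explore fuel st codes = Some codes' ->
  generated st q -> (forall t, t \in triples -> vanishes t q) -> covered q.
Proof.
elim: fuel st codes codes' => // fuel IH st codes codes' /=.
case: ifP => [/andP[/nilP L0 /nilP R0] _ hq _|_].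
  (* Without generators [q] is the origin, which lies in every cone, so any leaf will do. *)
  exists 0%N; case: hq => [|a g x gL|a g x a0 gR]; first exact: in_cone0.
    by move: gL; rewrite L0.
  by move: gR; rewrite R0.
case: codes => // k codes; case: ltnP => [ks|_]; last first.
  by case: ifP => // ok _ hq _; exists (k - size triples)%N; apply: leaf_okP ok hq.
have := mem_nth ([::], [::], [::]) ks; case: (nth _ triples k) => [[a b] c] tin.
case E1: explore => [c1|] //; case E2: explore => [c2|] // E3 hq hv.
have /and3P[/eqP sa /eqP sb /eqP sc] := allP size_triples _ tin.
case: (hv _ tin) => -[e l].
- by apply: IH E1 _ hv; apply: branchP.
- by apply: IH E2 _ hv; apply: branchP.
- by apply: IH E3 _ hv; apply: branchP.
Qed.

Definition unit_vectors : seq zvec :=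
  [seq [seq if j == i then 1%BZ else 0%BZ | j <- iota 0 n] | i <- iota 0 n].

Lemma generated_all q : generated (unit_vectors, [::]) q.
Proof.
have -> : q = \sum_(i <- enum 'I_n) q 0 i *: rvec (nth [::] unit_vectors i).
  rewrite {1}[q]row_sum_delta big_enum; apply: eq_bigr => i _; congr (_ *: _).
  apply/rowP => j; rewrite !mxE (nth_map 0%N) ?size_iota // nth_iota // add0n.
  rewrite (nth_map 0%N) ?size_iota // nth_iota // add0n.
  by have [->|ji] := eqVneq j i; rewrite ?eqxx //; case: eqP => // /val_inj/eqP; rewrite (negPf ji).
apply: generated_sum => i _; rewrite -[_ *: _]addr0; apply: generated_line; last exact: generated0.
by apply: mem_nth; rewrite size_map size_iota.
Qed.

Lemma explore_covers fuel codes q :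
  explore fuel (unit_vectors, [::]) codes = Some [::] ->
  (forall t, t \in triples -> vanishes t q) -> covered q.
Proof. by move=> h; apply: exploreP h (generated_all q). Qed.

End BranchTree.

(** * Laurent polynomials as sums of signed monomials *)

Section LaurentPolynomials.
Variables (K : fieldType) (I : finType).
Local Notation mon := {ffun I -> int}.
Implicit Types (f g h : laurent K I) (a b m : mon).

(** Additive extension of a map on terms. Multiplication here and the evaluations of ideal elements
    below are instances, so additivity is proved once. *)
Definition lextend (W : zmodType) (phi : K -> mon -> W) f : W :=
  \sum_(a <- msupp f) phi f@_a a.

Section Extension.
Variables (W : zmodType) (phi : K -> mon -> W).
Hypothesis phiD : forall c d a, phi (c + d) a = phi c a + phi d a.

Lemma lextend_phi0 a : phi 0 a = 0.
Proof. by apply: (addrI (phi 0 a)); rewrite -phiD !addr0. Qed.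

Lemma lextendEw (D : {fset mon}) f :
  (msupp f `<=` D)%fset -> lextend phi f = \sum_(a <- D) phi f@_a a.
Proof.
move=> sub; rewrite /lextend; apply: big_fset_incl sub _ => a _ na.
by rewrite mcoeff_outdom // lextend_phi0.
Qed.

Lemma lextendD f g : lextend phi (f + g) = lextend phi f + lextend phi g.
Proof.
pose D := (msupp f `|` msupp g)%fset.
rewrite (lextendEw (D := D)) ?msuppD_le // (lextendEw (D := D) (f := f)) ?fsubsetUl //.
rewrite (lextendEw (D := D) (f := g)) ?fsubsetUr // -big_split.
by apply: eq_bigr => a _; rewrite mcoeffD phiD.
Qed.

Lemma lextend0 : lextend phi 0 = 0.
Proof. by rewrite /lextend msupp0 big_nil. Qed.

Lemma lextend_sum (T : Type) (r : seq T) F :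
  lextend phi (\sum_(t <- r) F t) = \sum_(t <- r) lextend phi (F t).
Proof. by apply: big_morph; [apply: lextendD | apply: lextend0]. Qed.

Lemma lextendU (c : K) a : lextend phi << c *g a >> = phi c a.
Proof.
rewrite (lextendEw (D := [fset a]%fset)) ?msuppU_le //.
by rewrite big_seq_fset1 mcoeffUU.
Qed.

End Extension.

Lemma malgUD (c d : K) a : << c + d *g a >> = << c *g a >> + << d *g a >> :> laurent K I.
Proof. by apply/malgP => b; rewrite mcoeffD !mcoeffU mulrnDl. Qed.

Let mulU g c a : laurent K I := lextend (fun d b => << c * d *g a + b >>) g.

Let mulUD c a : {morph (fun g => mulU g c a) : f g / f + g}.
Proof. by move=> f g; apply: lextendD => d d' b; rewrite mulrDr malgUD. Qed.

Let mulDU g c d a : mulU g (c + d) a = mulU g c a + mulU g d a.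
Proof. by rewrite -big_split; apply: eq_bigr => b _; rewrite /= mulrDl malgUD. Qed.

Let laurent_mulE f g : laurent_mul f g = lextend (mulU g) f.
Proof. by []. Qed.

Lemma laurent_mulDl f g h : laurent_mul (f + g) h = laurent_mul f h + laurent_mul g h.
Proof. by rewrite !laurent_mulE lextendD. Qed.

Lemma laurent_mulDr f g h : laurent_mul f (g + h) = laurent_mul f g + laurent_mul f h.
Proof. by rewrite !laurent_mulE -big_split; apply: eq_bigr => a _; apply: mulUD. Qed.

Lemma laurent_mul0 f : laurent_mul f 0 = 0.
Proof. by rewrite laurent_mulE /lextend big1 // => a _; rewrite /mulU lextend0. Qed.

Lemma laurent_mul0l f : laurent_mul 0 f = 0.
Proof. by rewrite laurent_mulE lextend0. Qed.

Lemma laurent_mulUU (c d : K) a b :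
  laurent_mul << c *g a >> << d *g b >> = << c * d *g a + b >>.
Proof.
rewrite laurent_mulE lextendU // /mulU lextendU // => ? ? ?.
by rewrite mulrDr malgUD.
Qed.

Lemma laurent_mul_sumr f (T : Type) (r : seq T) F :
  laurent_mul f (\sum_(t <- r) F t) = \sum_(t <- r) laurent_mul f (F t).
Proof. by apply: big_morph; [apply: laurent_mulDr | apply: laurent_mul0]. Qed.

Definition signed_sum (T : seq (bool * mon)) : laurent K I :=
  \sum_(t <- T) << (-1) ^+ t.1 *g t.2 >>.

Lemma mcoeff_signed_sum T (t : bool * mon) : uniq (unzip2 T) -> t \in T ->
  (signed_sum T)@_(t.2) = (-1) ^+ t.1.
Proof.
move=> uT tT; rewrite /signed_sum raddf_sum /= (bigD1_seq t) //=; last exact: map_uniq uT.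
rewrite mcoeffUU big1_seq ?addr0 // => s /andP[st sT]; rewrite mcoeffU.
case: eqP => // e; case/eqP: st.
have := uniqP t.2 uT (index s T) (index t T).
rewrite !inE !size_map !index_mem => /(_ sT tT).
rewrite !(nth_map t) ?index_mem // !nth_index // => /(_ e) ei.
by rewrite -(nth_index t sT) ei nth_index.
Qed.

Lemma msupp_signed_sum T a : uniq (unzip2 T) ->
  (a \in msupp (signed_sum T)) = (a \in unzip2 T).
Proof.
move=> uT; rewrite -mcoeff_neq0; apply/idP/idP => [|/mapP[t tT ->]]; last first.
  by rewrite mcoeff_signed_sum // signr_eq0.
apply: contraNT => aT; rewrite raddf_sum /= big1_seq // => t /andP[_ tT].
by rewrite mcoeffU; case: eqP => // e; case/negP: aT; rewrite -e map_f.
Qed.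

Lemma malgU_opp (m : mon) : << -1 *g m >> = - << m >> :> laurent K I.
Proof. by apply/malgP => a; rewrite mcoeffN !mcoeffU mulNrn. Qed.

(** Putting the variables that fail [P] to zero removes exactly the products in which they occur;
    filtering the list of terms thus performs the substitution for nonbases. *)
Lemma signed_sum_three (A : nat -> mon) (P : pred nat) n1 n2 n3 n4 n5 n6
    (p := fun n => if P n then << A n >> else 0 : laurent K I) :
  laurent_mul (p n1) (p n2) - laurent_mul (p n3) (p n4) + laurent_mul (p n5) (p n6) =
  signed_sum [seq (t.1, A t.2.1 + A t.2.2) | t <-
    [seq t <- [:: (false, (n1, n2)); (true, (n3, n4)); (false, (n5, n6))] | P t.2.1 && P t.2.2]].
Proof.
have mulE x y : laurent_mul (p x) (p y) = if P x && P y then << A x + A y >> else 0.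
  by rewrite /p; case: (P x); case: (P y); rewrite ?laurent_mul0 ?laurent_mul0l ?laurent_mulUU ?mulr1.
rewrite !mulE /signed_sum big_map big_filter big_mkcond !big_cons big_nil /=.
rewrite expr0 expr1 malgU_opp addr0 addrA.
by congr (_ + _ + _); case: ifP => // _; rewrite oppr0.
Qed.

End LaurentPolynomials.

(** * Minimal terms under a weight *)

Section TropicalBasics.
Variables (R : realType) (K : fieldType) (v : valuation R K) (I : finType).
Local Notation mon := {ffun I -> int}.
Implicit Types (f : laurent K I) (w : weight R I) (a : mon).

Definition monval w a : R := \sum_i (a i)%:~R * w i.

Lemma monvalD w w' a : monval (w + w') a = monval w a + monval w' a.
Proof. by rewrite /monval -big_split; apply: eq_bigr => i _; rewrite ffunE mulrDr. Qed.

Lemma monvalZ (c : R) w a : monval (c *: w) a = c * monval w a.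
Proof. by rewrite /monval big_distrr; apply: eq_bigr => i _; rewrite ffunE /= mulrCA. Qed.

Lemma monval_addm w a b : monval w (a + b) = monval w a + monval w b.
Proof. by rewrite /monval -big_split; apply: eq_bigr => i _; rewrite ffunE intrD mulrDl. Qed.

Lemma trop_termE f w a : trop_term v f w a = v f@_a + monval w a.
Proof. by []. Qed.

Lemma valuation_sign (s : bool) : v ((-1) ^+ s) = 0.
Proof. by case: s; rewrite ?expr1 ?valuationN ?expr0 valuation1. Qed.

(** Signs have value 0, so the weight alone decides which terms are minimal; this makes the Dressian
    independent of the field and its valuation. *)
Lemma min_terms_signed_sum (T : seq (bool * mon)) w a : uniq (unzip2 T) ->
  min_terms v (signed_sum K T) w a <->
  a \in unzip2 T /\ forall b, b \in unzip2 T -> monval w a <= monval w b.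
Proof.
move=> uT; have tE b : b \in unzip2 T -> trop_term v (signed_sum K T) w b = monval w b.
  by case/mapP=> t tT ->; rewrite trop_termE mcoeff_signed_sum // valuation_sign add0r.
rewrite /min_terms /= msupp_signed_sum //; split=> -[aT h]; split=> // b bT.
  by have := h b; rewrite msupp_signed_sum // !tE // => /(_ bT).
by move: bT; rewrite msupp_signed_sum // => bT; rewrite !tE //; apply: h.
Qed.

Lemma min_terms_ex f w : f != 0 -> exists a, min_terms v f w a.
Proof.
move=> f0; have /fset0Pn[a0 a0f] : msupp f != fset0.
  by apply: contra_neq f0 => e; apply/malgP => k; rewrite mcoeff0 mcoeff_outdom // e in_fset0.
pose F (x : msupp f) := trop_term v f w (val x).
case: (arg_minP F (i0 := [` a0f]%fset) (P := xpredT)) => // x _ hx.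
exists (val x); split=> [|b bf]; first exact: valP.
exact: (hx [` bf]%fset).
Qed.

End TropicalBasics.

(** * Quadratic relations in numbered variables *)

Section IndexedVariables.
Variables (I : finType) (x : nat -> I) (N : nat).
Local Notation mon := {ffun I -> int}.
Local Notation term := (bool * (nat * nat))%type.
Implicit Types (T : seq term) (t : term).

Definition expo (i : nat) : mon := [ffun b => (b == x i)%:Z].

Definition term_mono t : mon := expo t.2.1 + expo t.2.2.

Definition relation_poly (K : fieldType) T : laurent K I :=
  signed_sum K [seq (t.1, term_mono t) | t <- T].

(** A condition decidable on indices that forces the monomials to be distinct: equal quadratic
    monomials would share the first variable of either. *)
Definition distinct_terms T : bool :=
  all (fun t => (t.2.1 < N)%N && (t.2.2 < N)%N) T
  && pairwise (fun t u => t.2.1 \notin [:: u.2.1; u.2.2]) T.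

Hypothesis x_inj : forall i j, (i < N)%N -> (j < N)%N -> x i = x j -> i = j.

Lemma expo_var i j : (i < N)%N -> (j < N)%N -> expo i (x j) = (i == j)%:Z.
Proof.
move=> hi hj; rewrite ffunE; congr (Posz (nat_of_bool _)).
by apply/eqP/eqP => [/(x_inj hj hi)|->].
Qed.

Lemma expo_add_mem i j k l : (i < N)%N -> (j < N)%N -> (k < N)%N -> (l < N)%N ->
  expo i + expo j = expo k + expo l -> i \in [:: k; l].
Proof.
move=> hi hj hk hl /(congr1 (fun a : mon => a (x i))).
rewrite ffunE (_ : (expo k + expo l) (x i) = expo k (x i) + expo l (x i)); last by rewrite ffunE.
rewrite !expo_var // eqxx !inE ![i == _]eq_sym.
by case: (j == i); case: (k == i); case: (l == i).
Qed.

Lemma uniq_term_monos T : distinct_terms T -> uniq (map term_mono T).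
Proof.
move=> /andP[/allP lt pw]; pose d : term := (false, (0, 0)%N).
rewrite map_inj_in_uniq => [|t u tT uT].
  apply: contraT => /(uniqPn d)[i [j [ij jT E]]].
  have := pairwiseP d pw i j (ltn_trans ij jT) jT ij.
  by rewrite E inE eqxx.
have key t1 t2 : t1 \in T -> t2 \in T -> term_mono t1 = term_mono t2 ->
    t1.2.1 \in [:: t2.2.1; t2.2.2].
  by move=> /lt/andP[h1 h2] /lt/andP[h3 h4]; apply: expo_add_mem.
case: (eqVneq t u) => [//|tu] E; exfalso.
have it : (index t T < size T)%N by rewrite index_mem.
have iu : (index u T < size T)%N by rewrite index_mem.
case: (ltngtP (index t T) (index u T)) => h.
- by have := pairwiseP d pw _ _ it iu h; rewrite !nth_index // key.
- by have := pairwiseP d pw _ _ iu it h; rewrite !nth_index // key.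
- by move/eqP: tu; apply; rewrite -(nth_index d tT) h nth_index.
Qed.

Variable R : realType.
Implicit Types (w : weight R I).

Definition coordinate w i : R := w (x i).

Definition term_value w t : R := coordinate w t.2.1 + coordinate w t.2.2.

Lemma monval_expo w i : monval w (expo i) = coordinate w i.
Proof.
rewrite /monval (bigD1 (x i)) //= ffunE eqxx mul1r big1 ?addr0 // => b /negPf bi.
by rewrite ffunE bi mul0r.
Qed.

Lemma monval_term w t : monval w (term_mono t) = term_value w t.
Proof. by rewrite /term_mono monval_addm !monval_expo. Qed.

Variables (K : fieldType) (v : valuation R K).

Lemma min_terms_relation T w a : distinct_terms T ->
  min_terms v (relation_poly K T) w a <->
  exists2 t, t \in T & a = term_mono t /\ forall t', t' \in T -> term_value w t <= term_value w t'.
Proof.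
move=> hT; have E : unzip2 [seq (t.1, term_mono t) | t <- T] = map term_mono T.
  by rewrite /unzip2 -map_comp.
rewrite min_terms_signed_sum E ?uniq_term_monos //; split=> [[/mapP[t tT ->] h]|[t tT [-> h]]].
  by exists t => //; split=> // t' t'T; rewrite -!monval_term; apply/h/map_f.
by split; [apply: map_f|move=> _ /mapP[t' t'T ->]; rewrite !monval_term; apply: h].
Qed.

Lemma relation_term_inj T t t' : distinct_terms T -> t \in T -> t' \in T ->
  term_mono t = term_mono t' -> t = t'.
Proof.
move=> hT tT t'T; have := uniq_term_monos hT => u E.
have := uniqP (term_mono t) u (index t T) (index t' T).
rewrite !inE !size_map !index_mem => /(_ tT t'T).
rewrite !(nth_map t) ?index_mem // !nth_index // => /(_ E) h.
by rewrite -(nth_index t tT) h nth_index.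
Qed.

Lemma trop_hypersurface_relation T w : distinct_terms T ->
  trop_hypersurface v (relation_poly K T) w <->
  forall t, t \in T -> (forall t', t' \in T -> term_value w t <= term_value w t') ->
    exists2 t', t' \in T & t' != t /\ term_value w t' <= term_value w t.
Proof.
move=> hT; split=> [h t tT tmin|h a /(min_terms_relation _ _ hT)[t tT [-> tmin]]].
  have /h[b bt /(min_terms_relation _ _ hT)[t' t'T [E t'min]]] :
      min_terms v (relation_poly K T) w (term_mono t).
    by apply/(min_terms_relation _ _ hT); exists t.
  by exists t' => //; split; [apply: contraNneq bt => <-; rewrite E | apply: t'min].
have [t' t'T [t't le]] := h t tT tmin; exists (term_mono t').
  by apply: contraNneq t't => /(relation_term_inj hT t'T tT) ->.
apply/(min_terms_relation _ _ hT); exists t' => //; split=> // t'' t''T.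
exact: le_trans le (tmin _ t''T).
Qed.

End IndexedVariables.

(** * Numbering of the bases and three-term relations *)

Section StarBases.
Local Open Scope nat_scope.

Definition increasing_pairs m : seq (nat * nat) :=
  [seq (x, y) | x <- iota m (10 - m), y <- iota x.+1 (9 - x)].

Lemma increasing_pairsP m p : m <= 10 ->
  (p \in increasing_pairs m) = [&& m <= p.1, p.1 < p.2 & p.2 < 10].
Proof.
move=> m10; apply/allpairsPdep/and3P => [[x [y []]]|[mx xy y10]].
  by rewrite !mem_iota => /andP[hx hx'] /andP[hy hy'] -> /=; split=> //; lia.
exists p.1, p.2; rewrite !mem_iota; split; last by case: p {mx xy y10}.
  by apply/andP; split=> //; lia.
by apply/andP; split=> //; lia.
Qed.

Definition increasing_triples : seq (seq nat) :=
  [seq [:: x; p.1; p.2] | x <- iota 0 10, p <- increasing_pairs x.+1].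

Definition star_triples : seq (seq nat) :=
  [seq t <- increasing_triples | t \notin star_nonbases].

Lemma increasing_triplesP t :
  reflect [/\ sorted ltn t, size t = 3 & all (fun x => x < 10) t] (t \in increasing_triples).
Proof.
apply: (iffP idP) => [|[]].
  have : all (fun t => [&& sorted ltn t, size t == 3 & all (fun x => x < 10) t])
    increasing_triples by vm_compute.
  by move=> /allP h /h /and3P[? /eqP ? ?].
case: t => [|x [|y [|z []]]] //= /and3P[xy yz _] _ /and4P[x10 y10 z10 _].
apply/allpairsPdep; exists x, (y, z); rewrite mem_iota increasing_pairsP //=.
by rewrite x10 xy yz z10.
Qed.

Lemma in_points s (i : 'I_10) : (i \in points s) = (val i \in s).
Proof. by rewrite inE. Qed.

Lemma points_inj s t : sorted ltn s -> sorted ltn t ->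
  all (fun x => x < 10) s -> all (fun x => x < 10) t -> points s = points t -> s = t.
Proof.
move=> ss st /allP s10 /allP t10 E; apply: (irr_sorted_eq ltn_trans ltnn) => // x.
have [x10|x10] := ltnP x 10.
  by have := in_points s (Ordinal x10); rewrite E in_points.
apply/idP/idP => [/s10|/t10]; by rewrite ltnNge x10.
Qed.

Lemma card_points t : t \in increasing_triples -> #|points t| = 3.
Proof.
case/increasing_triplesP => st t3 /allP t10.
have ut : uniq t by apply: (sorted_uniq ltn_trans ltnn).
have e : perm_eq (map val (enum (points t))) t.
  apply: uniq_perm => //; first by rewrite map_inj_uniq ?enum_uniq //; apply: val_inj.
  move=> x; apply/idP/idP => [/mapP[i]|xt].
    by rewrite mem_enum in_points => it ->.
  by apply/mapP; exists (Ordinal (t10 x xt)); rewrite ?mem_enum ?in_points.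
by rewrite cardE -(size_map val) (perm_size e).
Qed.

Lemma star_nonbases_increasing t : t \in star_nonbases -> t \in increasing_triples.
Proof. by move: t; apply/allP; vm_compute. Qed.

Lemma points_star_bases t : t \in increasing_triples ->
  (points t \in bases M_star) = (t \in star_triples).
Proof.
move=> ti; rewrite [_ \in bases _]inE card_points // eqxx andTb mem_filter ti andbT.
have [st _ t10] := increasing_triplesP _ ti.
congr (~~ _); apply/mapP/idP => [[l ln E]|tn]; last by exists t.
have [sl _ l10] := increasing_triplesP _ (star_nonbases_increasing ln).
by rewrite (points_inj st sl t10 l10 E).
Qed.

Lemma star_triples_increasing t : t \in star_triples -> t \in increasing_triples.
Proof. by rewrite mem_filter => /andP[]. Qed.

Lemma increasing_star_triples t :
  t \in increasing_triples -> t \notin star_triples -> t \in star_nonbases.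
Proof. by move=> ti; rewrite mem_filter ti andbT negbK. Qed.

Fact basis012 : points [:: 0; 1; 2] \in bases M_star.
Proof. by rewrite points_star_bases //; vm_compute. Qed.

(** Bases are numbered by the lexicographic list of increasing triples; numbers out of range fall
    back on the basis 012. *)
Definition bvar (i : nat) : basis M_star :=
  insubd (Sub (points [:: 0; 1; 2]) basis012) (points (nth [::] star_triples i)).

Lemma val_bvar i : i < size star_triples -> val (bvar i) = points (nth [::] star_triples i).
Proof.
move=> h; rewrite val_insubd.
by rewrite points_star_bases ?star_triples_increasing ?mem_nth.
Qed.

Lemma size_star_triples : size star_triples = 110.
Proof. by vm_compute. Qed.

Lemma uniq_star_triples : uniq star_triples.
Proof. by vm_compute. Qed.

Lemma bvar_inj i j : i < 110 -> j < 110 -> bvar i = bvar j -> i = j.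
Proof.
rewrite -size_star_triples => hi hj /(congr1 val); rewrite !val_bvar // => E.
have /star_triples_increasing/increasing_triplesP[si _ i10] := mem_nth [::] hi.
have /star_triples_increasing/increasing_triplesP[sj _ j10] := mem_nth [::] hj.
by apply/eqP; rewrite -(nth_uniq [::] hi hj uniq_star_triples); apply/eqP/points_inj.
Qed.

Lemma bvar_surj (b : basis M_star) : exists2 i, i < 110 & b = bvar i.
Proof.
pose t := map val (enum (val b)).
have Et : points t = val b.
  by apply/setP => i; rewrite in_points mem_map ?mem_enum //; apply: val_inj.
have ti : t \in increasing_triples.
  apply/increasing_triplesP; split.
  - have h : sorted ltn (map val (enum 'I_10)) by rewrite val_enum_ord iota_ltn_sorted.
    apply: (subseq_sorted ltn_trans) h; apply: map_subseq.
    by rewrite /enum_mem (_ : filter _ _ = filter (mem (val b)) (filter predT (Finite.enum 'I_10)));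
      [apply: filter_subseq | rewrite filter_predT].
  - by rewrite size_map -cardE; apply: (bases_card (valP b)).
  - by apply/allP => _ /mapP[i _ ->]; apply: ltn_ord.
have tb : t \in star_triples by rewrite -points_star_bases // Et; apply: (valP b).
exists (index t star_triples); first by rewrite -size_star_triples index_mem.
by apply: val_inj; rewrite val_bvar ?index_mem // nth_index.
Qed.

Opaque star_triples increasing_triples.

Opaque bvar.

Definition triple_table : seq (seq (seq nat)) := Eval vm_compute in
  [seq [seq [seq index (sort leq [:: x; y; z]) star_triples | z <- iota 0 10]
    | y <- iota 0 10] | x <- iota 0 10].

(** A table lookup, since it is called for every term of every relation. The value 110, one past the
    last basis, marks nonbases and triples with a repeated entry. *)
Definition bindex x y z := nth 110 (nth [::] (nth [::] triple_table x) y) z.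

Lemma nth_table3 (A : Type) (d : A) (f : nat -> nat -> nat -> A) n x y z :
  x < n -> y < n -> z < n ->
  nth d (nth [::] (nth [::] [seq [seq [seq f x y z | z <- iota 0 n] | y <- iota 0 n]
    | x <- iota 0 n] x) y) z = f x y z.
Proof.
move=> hx hy hz; do 3 rewrite (nth_map 0) ?size_iota //.
by rewrite !nth_iota.
Qed.

Lemma bindexE x y z : x < 10 -> y < 10 -> z < 10 ->
  bindex x y z = index (sort leq [:: x; y; z]) star_triples.
Proof.
move=> hx hy hz.
rewrite -(nth_table3 110 (fun x y z => index (sort leq [:: x; y; z]) star_triples) hx hy hz).
have <- : triple_table = [seq [seq [seq index (sort leq [:: x; y; z]) star_triples | z <- iota 0 10]
    | y <- iota 0 10] | x <- iota 0 10] by vm_compute.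
by [].
Qed.

Definition relation_terms s i j k l : seq (bool * (nat * nat)) :=
  [seq t <- [:: (false, (bindex i j s, bindex k l s)); (true, (bindex i k s, bindex j l s));
                (false, (bindex i l s, bindex j k s))]
   | (t.2.1 < 110) && (t.2.2 < 110)].

Definition star_quadruples : seq (nat * nat * (nat * nat)) :=
  [seq (p, q) | p <- increasing_pairs 0, q <- increasing_pairs p.2.+1].

Definition star_relations : seq (seq (bool * (nat * nat))) :=
  [seq relation_terms s q.1.1 q.1.2 q.2.1 q.2.2 | s <- iota 0 10,
     q <- [seq q <- star_quadruples | s \notin [:: q.1.1; q.1.2; q.2.1; q.2.2]]].

End StarBases.

Section StarRelations.
Variable K : fieldType.
Local Notation mon := {ffun basis M_star -> int}.

Local Notation expo := (expo bvar).

Lemma plucker_var_star (x y z : 'I_10) : x != y -> x != z -> y != z ->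
  plucker_var K M_star (x |: (y |: [set z]%SET))%SET =
  if (bindex x y z < 110)%N then << expo (bindex x y z) >> else 0.
Proof.
move=> xy xz yz; rewrite bindexE //; set t := sort leq _.
have tp : perm_eq t [:: val x; val y; val z] by rewrite perm_sort.
have -> : (x |: (y |: [set z]))%SET = points t.
  by apply/setP => i; rewrite in_points (perm_mem tp) !inE !val_eqE.
have ti : t \in increasing_triples.
  apply/increasing_triplesP; split; last 2 first.
  - by rewrite (perm_size tp).
  - by rewrite (perm_all _ tp) /= !ltn_ord.
  rewrite ltn_sorted_uniq_leq (perm_uniq tp) sort_sorted ?andbT; last exact: leq_total.
  by rewrite /= !inE !val_eqE negb_or xy xz yz.
rewrite -size_star_triples index_mem -points_star_bases // /plucker_var.
case: ifP => h; last by rewrite insubN // h.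
have tb : t \in star_triples by rewrite -points_star_bases.
case: insubP => [b' _ vb|]; last by rewrite h.
have -> : b' = bvar (index t star_triples); last by [].
by apply: val_inj; rewrite val_bvar ?index_mem // nth_index.
Qed.

Lemma three_term_star (s i j k l : 'I_10) :
  (i < j < k)%N -> (k < l)%N -> [/\ i != s, j != s, k != s & l != s] ->
  three_term K M_star [set s]%SET i j k l = relation_poly bvar K (relation_terms s i j k l).
Proof.
move=> /andP[ij jk] kl [si sj sk sl].
have ik := ltn_trans ij jk; have jl := ltn_trans jk kl; have il := ltn_trans ij jl.
have ne (x y : 'I_10) : (x < y)%N -> x != y by move=> h; rewrite -val_eqE neq_ltn h.
have [nij nik nil] : [/\ i != j, i != k & i != l] by split; apply: ne.
have [njk njl nkl] : [/\ j != k, j != l & k != l] by split; apply: ne.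
rewrite /three_term !plucker_var_star // /relation_poly /relation_terms.
have := @signed_sum_three K _ expo (fun n => n < 110)%N (bindex i j s) (bindex k l s)
  (bindex i k s) (bindex j l s) (bindex i l s) (bindex j k s).
by move=> /= ->.
Qed.

Lemma mem_star_quadruples p :
  (p \in star_quadruples) = [&& (p.1.1 < p.1.2)%N, (p.1.2 < p.2.1)%N, (p.2.1 < p.2.2)%N & (p.2.2 < 10)%N].
Proof.
case: p => -[i j] [k l]; apply/allpairsPdep/and4P => /= [[[p1 p2] [[q1 q2] []]]|[ij jk kl l10]].
  rewrite increasing_pairsP // => /and3P[_ p12 p2']; rewrite increasing_pairsP // => /and3P[pq q12 q2'].
  by case=> -> -> -> ->; split.
exists (i, j), (k, l); rewrite !increasing_pairsP //=; last by lia.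
by rewrite ij jk kl l10; split=> //; rewrite (ltn_trans jk) // (ltn_trans kl).
Qed.

Lemma star_relationsP T : T \in star_relations -> exists s i j k l,
  [/\ [/\ s < 10, s \notin [:: i; j; k; l] & i < j], j < k, k < l, l < 10 & T = relation_terms s i j k l]%N.
Proof.
move=> /allpairsPdep[s [[[i j] [k l]] [s10]]].
rewrite mem_filter mem_star_quadruples /= => /andP[sn /and4P[ij jk kl l10]] ->.
by rewrite mem_iota in s10; exists s, i, j, k, l.
Qed.

(** In rank 3 the set [S] is a singleton, so a relation is given by a point and an increasing
    quadruple avoiding it. *)
Lemma three_term_relations_star :
  three_term_relations K M_star = [set relation_poly bvar K T | T in [set` star_relations]].
Proof.
apply/seteqP; split=> [_ [S [i [j [k [l [cS /and3P[ij jk kl] [iS jS kS lS] ->]]]]]]|].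
  have /eqP/cards1P[s sE] : #|S| = 1%N by apply/eqP; rewrite -(eqn_add2r 2) cS.
  rewrite sE !inE in iS jS kS lS *.
  exists (relation_terms s i j k l); last by rewrite three_term_star // ij.
  apply/allpairsPdep; exists (val s), ((val i, val j), (val k, val l)).
  rewrite mem_iota ltn_ord; split=> //; rewrite mem_filter mem_star_quadruples /= ij jk kl ltn_ord.
  by rewrite !inE !negb_or -!val_eqE /= in iS jS kS lS *; rewrite ![val s == _]eq_sym iS jS kS lS.
move=> f [T /= /star_relationsP[s [i [j [k [l [[s10 sn ij] jk kl l10 ->]]]]]] <-].
have k10 := ltn_trans kl l10; have j10 := ltn_trans jk k10.
have i10 := ltn_trans ij j10; rewrite !inE !negb_or in sn; case/and4P: sn => si sj sk sl.
exists [set Ordinal (s10 : (s < 10)%N)]%SET, (Ordinal i10), (Ordinal j10), (Ordinal k10), (Ordinal l10).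
split; rewrite ?cards1 //=; first by rewrite ij jk kl.
  by rewrite !inE -!val_eqE /= ![_ == s]eq_sym si sj sk sl.
by rewrite three_term_star //= ?ij // -!val_eqE /= ![_ == s]eq_sym.
Qed.

End StarRelations.

(** * Degenerations, normalized trinomials and elimination *)

Definition degenerates (R : realType) (K : fieldType) (v : valuation R K) (I : finType)
    (G : set (laurent K I)) (w w' : weight R I) : Prop :=
  forall f, G f -> min_terms v f w `<=` min_terms v f w'.

Fixpoint zlex (g h : zvec) : bool :=
  match g, h with
  | x :: g, y :: h => Z.ltb x y || (Z.eqb x y && zlex g h)
  | _, _ => true
  end.

Definition term_vector (rows : seq zvec) (t : bool * (nat * nat)) : zvec :=
  zcomb 1 (nth [::] rows t.2.1) 1 (nth [::] rows t.2.2).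

Definition sorted_vectors rows (T : seq (bool * (nat * nat))) : seq zvec :=
  sort zlex [seq term_vector rows t | t <- T].

(** Sorting and subtracting the first vector removes the order of the terms and a common shift, so
    relations that impose the same condition on the reduced coordinates become equal lists. *)
Definition canonical_triple rows T : seq zvec :=
  [seq zsub g (head [::] (sorted_vectors rows T)) | g <- sorted_vectors rows T].

(** Two-term relations with a single unknown each form a triangular linear system; only the set of
    solved variables is recorded. *)
Fixpoint eliminated (known : seq nat) (es : seq (seq (bool * (nat * nat)))) : seq nat :=
  match es with
  | [:: t; t'] :: es' =>
    if [seq i <- [:: t.2.1; t.2.2; t'.2.1; t'.2.2] | i \notin known] is [:: i]
    then eliminated (i :: known) es' else eliminated known es'
  | _ :: es' => eliminated known es'
  | [::] => known
  end.

(** Meant for [d] the difference between a weight and its candidate parametrization, which satisfies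
    the two-term equations because both do. *)
Lemma eliminated0 (V : zmodType) (d : nat -> V) (known : seq nat)
    (es : seq (seq (bool * (nat * nat)))) :
  (forall i, i \in known -> d i = 0) ->
  (forall T t t', T \in es -> t \in T -> t' \in T -> d t.2.1 + d t.2.2 = d t'.2.1 + d t'.2.2) ->
  forall i, i \in eliminated known es -> d i = 0.
Proof.
elim: es known => [|T es IH] known d0 hes //=.
have IH' known' : (forall i, i \in known' -> d i = 0) ->
    forall i, i \in eliminated known' es -> d i = 0.
  by move=> h; apply: IH => // T' t t' T'in; apply: hes; rewrite inE T'in orbT.
case: T hes => [|t [|t' [|t'' T']]] hes; try exact: IH'.
have := hes _ t t' (mem_head _ _); rewrite !inE !eqxx orbT => /(_ isT isT).
case: t t' {hes} => [? [a b]] [? [a' b']] /= E.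
case ha: (a \in known); case hb: (b \in known); case ha': (a' \in known);
  case hb': (b' \in known); rewrite /= ; try exact: IH'.
- apply: IH' => i; rewrite inE => /orP[/eqP->|]; last exact: d0.
  by move: E; rewrite (d0 a) // (d0 b) // (d0 a') // !add0r.
- apply: IH' => i; rewrite inE => /orP[/eqP->|]; last exact: d0.
  by move: E; rewrite (d0 a) // (d0 b) // (d0 b') // !addr0.
- apply: IH' => i; rewrite inE => /orP[/eqP->|]; last exact: d0.
  by move: E; rewrite (d0 a) // (d0 a') // (d0 b') // addr0 add0r.
- apply: IH' => i; rewrite inE => /orP[/eqP->|]; last exact: d0.
  by move: E; rewrite (d0 b) // (d0 a') // (d0 b') // !addr0.
Qed.

Section VectorMinima.
Variables (R : realFieldType) (n : nat).
Implicit Types (s : seq zvec) (q : 'rV[R]_n).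

Definition minimal_in s q g : Prop :=
  g \in s /\ forall h, h \in s -> rdot g q <= rdot h q.

Definition min_twice s q : Prop :=
  forall g, minimal_in s q g -> exists2 h, h \in s & h != g /\ rdot h q <= rdot g q.

End VectorMinima.

(** * Weights as a lineality part plus reduced coordinates *)

Section RelationSystem.
Variables (I : finType) (x : nat -> I) (N : nat) (n : nat).
Local Notation term := (bool * (nat * nat))%type.
Variables (rows incs : seq zvec) (rels : seq (seq term)).
Implicit Types (T : seq term) (t : term).

Hypothesis x_inj : forall i j, (i < N)%N -> (j < N)%N -> x i = x j -> i = j.
Hypothesis x_surj : forall b, exists2 i, (i < N)%N & b = x i.

Definition relation_ok T : bool :=
  [&& size T \in [:: 2; 3]%N, distinct_terms N T,
      constant (map (term_vector incs) T) &
      if size T == 2%N then constant (map (term_vector rows) T)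
      else uniq (map (term_vector rows) T)].

Hypothesis rels_ok : all relation_ok rels.
Hypothesis size_rows : size rows = N.
Hypothesis rows_sizes : all (fun g => size g == n) rows.

Definition var_index (b : I) : nat := index b [seq x i | i <- iota 0 N].

Lemma var_index_lt b : (var_index b < N)%N.
Proof.
have [i hi ->] := x_surj b.
by rewrite -[X in (_ < X)%N](size_iota 0) -(size_map x) index_mem map_f // mem_iota.
Qed.

Lemma var_indexK b : x (var_index b) = b.
Proof.
have h := var_index_lt b.
rewrite -[LHS](_ : nth b [seq x i | i <- iota 0 N] (var_index b) = _).
  by rewrite nth_index // -index_mem size_map size_iota.
by rewrite (nth_map 0%N) ?size_iota // nth_iota.
Qed.

Lemma index_varK i : (i < N)%N -> var_index (x i) = i.
Proof. by move=> hi; apply: x_inj; rewrite ?var_indexK ?var_index_lt. Qed.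

Lemma rel_size T : T \in rels -> size T = 2%N \/ size T = 3%N.
Proof.
move=> /(allP rels_ok)/and4P[+ _ _ _].
by rewrite !inE => /orP[]/eqP->; [left | right].
Qed.

Lemma rel_distinct T : T \in rels -> distinct_terms N T.
Proof. by move=> /(allP rels_ok)/and4P[]. Qed.

Lemma constant_eq (A : eqType) (s : seq A) a b : constant s -> a \in s -> b \in s -> a = b.
Proof.
move=> /(constantP a)[c E] aS bS; rewrite E in aS bS.
by move: aS bS => /nseqP[-> _] /nseqP[-> _].
Qed.

Section Embedding.
Variable R : realType.
Local Notation rdot := (@rdot R n).
Implicit Types (w : weight R I) (u q : 'rV[R]_n).
Local Notation coordinate := (coordinate x).
Local Notation term_value := (term_value x).

Definition embed u q : weight R I :=
  [ffun b => rdot (nth [::] incs (var_index b)) u + rdot (nth [::] rows (var_index b)) q].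

Lemma coordinate_embed u q i : (i < N)%N ->
  coordinate (embed u q) i = rdot (nth [::] incs i) u + rdot (nth [::] rows i) q.
Proof. by move=> hi; rewrite /coordinate ffunE index_varK. Qed.

Lemma eq_coordinate w w' :
  (forall i, (i < N)%N -> coordinate w i = coordinate w' i) -> w = w'.
Proof.
move=> h; apply/ffunP => b; rewrite -(var_indexK b).
exact: (h _ (var_index_lt b)).
Qed.

Lemma embedD u q u' q' : embed u q + embed u' q' = embed (u + u') (q + q').
Proof. by apply/ffunP => b; rewrite !ffunE !rdotD addrACA. Qed.

Lemma embedZ (c : R) u q : c *: embed u q = embed (c *: u) (c *: q).
Proof. by apply/ffunP => b; rewrite !ffunE !rdotZ scalerDr. Qed.

Lemma term_value_embed u q t : (t.2.1 < N)%N && (t.2.2 < N)%N ->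
  term_value (embed u q) t = rdot (term_vector incs t) u + rdot (term_vector rows t) q.
Proof.
move=> /andP[h1 h2]; rewrite /term_value !coordinate_embed // !rdot_comb zreal1 !mul1r.
by rewrite addrACA.
Qed.

Lemma le_term_value T t t' u q : T \in rels -> t \in T -> t' \in T ->
  (term_value (embed u q) t <= term_value (embed u q) t') =
  (rdot (term_vector rows t) q <= rdot (term_vector rows t') q).
Proof.
move=> hT tT t'T; have /andP[/allP lt _] := rel_distinct hT.
rewrite !term_value_embed ?lt //.
have /and4P[_ _ c _] := allP rels_ok _ hT.
by rewrite (constant_eq c (map_f _ tT) (map_f _ t'T)) lerD2l.
Qed.

Lemma binomial_value T t t' u q : T \in rels -> size T = 2%N -> t \in T -> t' \in T ->
  term_value (embed u q) t = term_value (embed u q) t'.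
Proof.
move=> hT T2 tT t'T; have /andP[/allP lt _] := rel_distinct hT.
rewrite !term_value_embed ?lt //.
have /and4P[_ _ c] := allP rels_ok _ hT; rewrite T2 eqxx => d.
by rewrite (constant_eq c (map_f _ tT) (map_f _ t'T)) (constant_eq d (map_f _ tT) (map_f _ t'T)).
Qed.

Lemma incidence_value T t t' u : T \in rels -> t \in T -> t' \in T ->
  term_value (embed u 0) t = term_value (embed u 0) t'.
Proof.
by move=> hT tT t'T; apply/eqP; rewrite eq_le (le_term_value _ _ hT tT t'T) (le_term_value _ _ hT t'T tT) !rdot0 lexx.
Qed.

Lemma mem_sorted_vectors T g :
  (g \in sorted_vectors rows T) = (g \in [seq term_vector rows t | t <- T]).
Proof. by rewrite mem_sort. Qed.

Definition canonical_vector T t := zsub (term_vector rows t) (head [::] (sorted_vectors rows T)).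

Lemma mem_canonical T g : g \in canonical_triple rows T <->
  exists2 t, t \in T & g = canonical_vector T t.
Proof.
split=> [/mapP[h]|[t tT ->]].
  by rewrite mem_sorted_vectors => /mapP[t tT ->] ->; exists t.
by apply: map_f; rewrite mem_sorted_vectors map_f.
Qed.

Lemma minimal_canonical T t u q : T \in rels -> t \in T ->
  minimal_in (canonical_triple rows T) q (canonical_vector T t) <->
  forall t', t' \in T -> term_value (embed u q) t <= term_value (embed u q) t'.
Proof.
move=> hT tT; split=> [[_ h] t' t'T|h].
  rewrite (le_term_value _ _ hT) //.
  have /h : canonical_vector T t' \in canonical_triple rows T by apply/mem_canonical; exists t'.
  by rewrite !rdot_sub lerD2r.
split; first by apply/mem_canonical; exists t.
move=> _ /mem_canonical[t' t'T ->]; rewrite !rdot_sub lerD2r.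
by rewrite -(le_term_value u _ hT) // h.
Qed.

Lemma size_term_vector T t : T \in rels -> t \in T -> size (term_vector rows t) = n.
Proof.
move=> /rel_distinct/andP[/allP lt _] /lt/andP[h1 h2].
have sz i : (i < N)%N -> size (nth [::] rows i) = n.
  by move=> hi; apply/eqP/(allP rows_sizes)/mem_nth; rewrite size_rows.
rewrite /term_vector; move: (sz _ h1) (sz _ h2).
move: (nth _ _ _) (nth _ _ _) => g h; elim: n g h => [|m IH] [|a g] [|b h] //= [sg] [sh].
by rewrite IH.
Qed.

Lemma zsub_inj g g' h : size g = size h -> size g' = size h -> zsub g h = zsub g' h -> g = g'.
Proof.
rewrite /zsub; elim: h g g' => [|c h IH] [|a g] [|a' g'] //= [sg] [sg'] [E /IH->] //.
by congr (_ :: _); move/Z.add_cancel_r: E; case: a; case: a' => //= ? ? [->].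
Qed.

Lemma canonical_vector_inj T t t' : T \in rels -> size T = 3%N -> t \in T -> t' \in T ->
  canonical_vector T t = canonical_vector T t' -> t = t'.
Proof.
move=> hT T3 tT t'T E.
have hd : head [::] (sorted_vectors rows T) \in [seq term_vector rows t | t <- T].
  rewrite -mem_sorted_vectors; case: (sorted_vectors rows T) (mem_sorted_vectors T (term_vector rows t)).
    by rewrite map_f.
  by move=> *; rewrite mem_head.
have sh : size (head [::] (sorted_vectors rows T)) = n.
  by case/mapP: hd => s sT ->; apply: size_term_vector hT sT.
have {}E : term_vector rows t = term_vector rows t'.
  by apply: zsub_inj E; rewrite sh (size_term_vector hT).
have /and4P[_ _ _] := allP rels_ok _ hT; rewrite T3 /= => u.
have := uniqP (term_vector rows t) u (index t T) (index t' T).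
rewrite !inE !size_map !index_mem => /(_ tT t'T).
rewrite !(nth_map t) ?index_mem // !nth_index // => /(_ E) h.
by rewrite -(nth_index t tT) h nth_index.
Qed.

Section Valued.
Variables (K : fieldType) (v : valuation R K).
Let G : set (laurent K I) := [set relation_poly x K T | T in [set` rels]].
Definition canonical_triples := undup [seq canonical_triple rows T | T <- rels & size T == 3%N].

Lemma mem_canonical_triples s : s \in canonical_triples <->
  exists2 T, T \in rels & size T = 3%N /\ s = canonical_triple rows T.
Proof.
rewrite mem_undup; split=> [/mapP[T]|[T hT [T3 ->]]].
  by rewrite mem_filter => /andP[/eqP T3 hT] ->; exists T.
by apply: map_f; rewrite mem_filter T3.
Qed.

(** Two-term relations hold automatically, and a three-term relation is its canonical triple up to a
    common shift of the values. *)
Lemma trop_intersection_embed u q :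
  trop_intersection v G (embed u q) <-> forall s, s \in canonical_triples -> min_twice s q.
Proof.
split=> [h s /mem_canonical_triples[T hT [T3 ->]] g gmin|h _ [T /= hT <-]].
  have /(trop_hypersurface_relation x_inj v _ (rel_distinct hT)) := h _ (ex_intro2 _ _ T hT erefl).
  have [/mem_canonical[t tT gE] _] := gmin.
  move: gmin; rewrite gE => /(minimal_canonical u _ hT tT) tmin /(_ t tT tmin)[t' t'T [t't le]].
  exists (canonical_vector T t'); first by apply/mem_canonical; exists t'.
  split; first by apply: contraNneq t't => /(canonical_vector_inj hT T3 t'T tT) ->.
  by move: le; rewrite (le_term_value _ _ hT) // !rdot_sub lerD2r.
apply/(trop_hypersurface_relation x_inj v _ (rel_distinct hT)) => t tT tmin.
have [T2|T3] := rel_size hT.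
  have [t' t'T t't] : exists2 t', t' \in T & t' != t.
    have := uniq_term_monos x_inj (rel_distinct hT); move/map_uniq.
    case: T T2 tT {hT tmin} => [|a [|b [|]]] //= _; rewrite !inE andbT => /orP[/eqP->|/eqP->] ab.
      by exists b; rewrite ?inE ?eqxx ?orbT // eq_sym.
    by exists a; rewrite ?inE ?eqxx.
  by exists t' => //; split=> //; rewrite (binomial_value _ _ hT T2 t'T tT).
have /h : canonical_triple rows T \in canonical_triples by apply/mem_canonical_triples; exists T.
case/(_ _ ((minimal_canonical u _ hT tT).2 tmin)) => g /mem_canonical[t' t'T ->] [ne le].
exists t' => //; split; first by apply: contraNneq ne => ->.
by rewrite (le_term_value _ _ hT) //; move: le; rewrite !rdot_sub lerD2r.
Qed.

Lemma degenerates_embed u q u' q' :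
  degenerates v G (embed u q) (embed u' q') <->
  forall s, s \in canonical_triples -> forall g, minimal_in s q g -> minimal_in s q' g.
Proof.
split=> [h s /mem_canonical_triples[T hT [T3 ->]] g gmin|h _ [T /= hT <-] a].
  have [/mem_canonical[t tT gE] _] := gmin.
  move: gmin; rewrite gE => /(minimal_canonical u _ hT tT) tmin.
  have /(h _ (ex_intro2 _ _ T hT erefl)) : min_terms v (relation_poly x K T) (embed u q) (term_mono x t).
    by apply/(min_terms_relation x_inj _ _ _ (rel_distinct hT)); exists t.
  case/(min_terms_relation x_inj _ _ _ (rel_distinct hT)) => t' t'T [E t'min].
  rewrite (relation_term_inj x_inj (rel_distinct hT) tT t'T E).
  exact/(minimal_canonical u' _ hT t'T).
move=> /(min_terms_relation x_inj _ _ _ (rel_distinct hT))[t tT [-> tmin]].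
apply/(min_terms_relation x_inj _ _ _ (rel_distinct hT)); exists t => //; split=> // t' t'T.
have [T2|T3] := rel_size hT; first by rewrite (binomial_value _ _ hT T2 t'T tT).
have cT : canonical_triple rows T \in canonical_triples by apply/mem_canonical_triples; exists T.
have := h _ cT _ ((minimal_canonical u _ hT tT).2 tmin).
by move/(minimal_canonical u' _ hT tT); apply.
Qed.

Lemma binomial_eq T t t' w : trop_intersection v G w -> T \in rels -> size T = 2%N ->
  t \in T -> t' \in T -> term_value w t = term_value w t'.
Proof.
move=> hw hT T2; wlog le : t t' / term_value w t <= term_value w t'.
  by move=> H tT t'T; case: (leP (term_value w t) (term_value w t')) => [le|/ltW le]; [|symmetry]; apply: H.
move=> tT t'T; apply/eqP; rewrite eq_le le /=.
have /(trop_hypersurface_relation x_inj v _ (rel_distinct hT)) h := hw _ (ex_intro2 _ _ T hT erefl).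
have [->//|tt'] := eqVneq t t'.
have two s : s \in T -> s = t \/ s = t'.
  case: T T2 tT t'T {h hT} => [|a [|b [|]]] //= _; rewrite !inE.
  by move: tt' => /[swap] /orP[]/eqP-> /[swap] /orP[]/eqP->; rewrite ?eqxx // => _ /orP[]/eqP->; auto.
have [|s sT [st le']] := h t tT; first by move=> s /two[]->.
by case: (two s sT) st le' => ->; rewrite ?eqxx.
Qed.

Variables (frame free : seq nat) (columns : seq zvec) (elims : seq (seq term)).
Hypothesis size_incs : all (fun g => size g == n) incs.
Hypothesis frame_ok :
  [&& size columns == size frame, all (fun i => i < N)%N (frame ++ free),
      [seq nth [::] rows i | i <- frame] == nseq (size frame) (nseq n 0%BZ),
      [seq nth [::] rows i | i <- free] == unit_vectors n &
      [seq [seq zdot (nth [::] incs i) c | c <- columns] | i <- frame] ==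
      [seq [seq if j == k then 3%BZ else 0%BZ | k <- iota 0 (size frame)] | j <- iota 0 (size frame)]].
Hypothesis elims_ok : all (fun T => (T \in rels) && (size T == 2%N)) elims.
Hypothesis elims_all : all (fun i => i \in eliminated (frame ++ free) elims) (iota 0 N).

(** The lineality part is fitted on the frame and [q] on the free variables; the difference is zero
    on both, and the two-term relations propagate this to all variables. *)
Lemma trop_intersection_sub_embed w : trop_intersection v G w -> exists u q, w = embed u q.
Proof.
move=> hw; have /and5P[/eqP sc /allP lt /eqP rF /eqP rf /eqP cF] := frame_ok.
(* By [frame_ok] the columns are 3 times an inverse of the incidence matrix of the frame, hence the
   division. *)
pose u : 'rV[R]_n := \sum_(k < size frame)
  (coordinate w (nth 0%N frame k) / 3) *: rvec R n (nth [::] columns k).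
pose q : 'rV[R]_n := \row_j (coordinate w (nth 0%N free j) - rdot (nth [::] incs (nth 0%N free j)) u).
have sinc i : (size (nth [::] incs i) <= n)%N.
  have [h|h] := ltnP i (size incs); last by rewrite nth_default.
  by rewrite (eqP (allP size_incs _ (mem_nth _ h))).
have uF j : (j < size frame)%N -> rdot (nth [::] incs (nth 0%N frame j)) u = coordinate w (nth 0%N frame j).
  move=> hj; rewrite /u rdot_sum (bigD1 (Ordinal hj)) //= big1 ?addr0 => [|k kj].
    rewrite rdotZ rdot_rvec //.
    have := congr1 (fun s => nth 0%BZ (nth [::] s j) j) cF.
    rewrite !(nth_map 0%N) ?size_iota // !(nth_map [::]) ?sc // !nth_iota // eqxx => ->.
    by rewrite divfK // pnatr_eq0.
  rewrite rdotZ rdot_rvec //.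
  have := congr1 (fun s => nth 0%BZ (nth [::] s j) k) cF.
  rewrite !(nth_map 0%N) ?size_iota // !(nth_map [::]) ?sc // !nth_iota //.
  rewrite !add0n (_ : (j == k :> nat) = false) => [->|]; first by rewrite mulr0.
  by rewrite eq_sym; apply: negbTE kj.
have sf : size free = n by have := congr1 size rf; rewrite !size_map size_iota.
pose d i := coordinate w i - coordinate (embed u q) i.
have d0 i : i \in frame ++ free -> d i = 0.
  move=> iin; have iN := lt _ iin; rewrite /d coordinate_embed //; apply/eqP; rewrite subr_eq0.
  move: iin; rewrite mem_cat => /orP[|] /(nthP 0%N)[j hj <-].
    have -> : nth [::] rows (nth 0%N frame j) = nseq n 0%BZ.
      by rewrite -(nth_map 0%N [::] (nth [::] rows)) // rF nth_nseq hj.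
    rewrite uF // /rdot big1 ?addr0 // => k _.
    by rewrite nth_nseq ltn_ord zreal0 mul0r.
  have hj' := hj; rewrite sf in hj'.
  have -> : nth [::] rows (nth 0%N free j) = [seq if i == j then 1%BZ else 0%BZ | i <- iota 0 n].
    rewrite -(nth_map 0%N [::] (nth [::] rows)) // rf (nth_map 0%N) ?size_iota // nth_iota //.
  rewrite [X in _ + X](_ : _ = q 0 (Ordinal hj')); first by rewrite mxE addrC subrK.
  rewrite /rdot (bigD1 (Ordinal hj')) //= big1 ?addr0 => [|k kj].
    by rewrite (nth_map 0%N) ?size_iota // nth_iota // eqxx zreal1 mul1r.
  rewrite (nth_map 0%N) ?size_iota // nth_iota // add0n ifN ?zreal0 ?mul0r //.
exists u, q; apply: eq_coordinate => i hi; apply/eqP; rewrite -subr_eq0 -/(d i); apply/eqP.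
apply: (eliminated0 d0 (es := elims)); last first.
  by apply: (allP elims_all); rewrite mem_iota.
move=> T t t' /(allP elims_ok)/andP[hT /eqP T2] tT t'T.
have := binomial_eq hw hT T2 tT t'T; have := binomial_value u q hT T2 tT t'T.
by rewrite /term_value /d => e1 e2; lra.
Qed.

End Valued.
End Embedding.
End RelationSystem.

(** * Faces of a complex given by its maximal cones *)

Fixpoint subsequences (s : seq nat) : seq (seq nat) :=
  if s is x :: s' then map (cons x) (subsequences s') ++ subsequences s' else [:: [::]].

Lemma mem_subsequences s t : (t \in subsequences s) = subseq t s.
Proof.
elim: s t => [|x s IH] [|y t] //=.
  by rewrite mem_cat IH sub0seq orbT.
rewrite mem_cat IH; case: eqVneq => [->|yx]; last first.
  by rewrite (_ : _ \in _ = false) //; apply/mapP => -[z _ [/eqP]]; rewrite (negPf yx).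
rewrite mem_map ?IH => [|a b []//]; apply/orP/idP => [[//|]|->]; last by left.
by apply: subseq_trans; apply: subseq_cons.
Qed.

Definition faces_of (maximal : seq (seq nat)) : seq (seq nat) :=
  undup (flatten [seq subsequences c | c <- maximal]).

Lemma faces_ofP maximal s : reflect (exists2 c, c \in maximal & subseq s c) (s \in faces_of maximal).
Proof.
rewrite mem_undup; apply: (iffP flattenP) => [[_ /mapP[c cm ->]]|[c cm sc]].
  by rewrite mem_subsequences; exists c.
by exists (subsequences c); rewrite ?map_f // mem_subsequences.
Qed.

Lemma faces_of_filter maximal s (p : pred nat) :
  s \in faces_of maximal -> filter p s \in faces_of maximal.
Proof.
case/faces_ofP=> c cm sc; apply/faces_ofP; exists c => //.
by apply: subseq_trans sc; apply: filter_subseq.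
Qed.

(** * Minimal terms on cones *)

Section ConePatterns.
Variables (n : nat) (trs : seq (seq zvec)) (rays : seq zvec) (maximal : seq (seq nat)).
Local Notation ray i := (nth [::] rays i).
Implicit Types (s : seq zvec) (sigma tau : seq nat).

Definition ray_min s (r g : zvec) : bool := all (fun h => Z.leb (zdot g r) (zdot h r)) s.

Definition cone_min s sigma g : bool := all (fun i => ray_min s (ray i) g) sigma.

Definition pattern_pairs := flatten [seq [seq (s, g) | g <- s] | s <- trs].

Definition ray_pattern r : seq bool := [seq ray_min p.1 r p.2 | p <- pattern_pairs].

(** All tests [cone_min] for [sigma] at once, as the conjunction of the patterns of its rays; thus
    rays are tested once rather than for each face. *)
Definition cone_pattern (pats : seq (seq bool)) sigma : seq bool :=
  foldr (fun i b => [seq x.1 && x.2 | x <- zip (nth [::] pats i) b])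
    (nseq (size pattern_pairs) true) sigma.

(** Some term is minimal along all of [sigma] but not on ray [j], which keeps that ray out of the
    closed cell of [sigma]. *)
Definition separated (pats : seq (seq bool)) (b : seq bool) j : bool :=
  has (fun x => x.1 && ~~ x.2) (zip b (nth [::] pats j)).

Hypothesis trs_sizes : all (fun s => (size s == 3%N) && uniq s && all (fun g => size g == n) s) trs.
Hypothesis maximal_ok : all (fun c => sorted ltn c && all (fun i => i < size rays)%N c
  && all (fun s => 1 < count (cone_min s c) s)%N trs) maximal.
Hypothesis patterns_ok : let pats := [seq ray_pattern r | r <- rays] in
  all (fun sigma => let b := cone_pattern pats sigma in
    all (fun j => (j \in sigma) || separated pats b j) (iota 0 (size rays))) (faces_of maximal).

Local Notation Delta := (faces_of maximal).

Lemma Delta_sortedP sigma : sigma \in Delta -> sorted ltn sigma.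
Proof.
case/faces_ofP=> c /(allP maximal_ok)/andP[/andP[sc _] _].
by move=> sub; apply: (subseq_sorted ltn_trans) sc.
Qed.

Lemma Delta_lt sigma i : sigma \in Delta -> i \in sigma -> (i < size rays)%N.
Proof.
case/faces_ofP=> c /(allP maximal_ok)/andP[/andP[_ /allP h] _] sub.
by move/(mem_subseq sub)/h.
Qed.

(** On a face more terms can be minimal on all rays but none is lost, so the check on maximal cones
    carries over. *)
Lemma cone_min_two sigma s : sigma \in Delta -> s \in trs ->
  exists g h, [/\ g \in s, h \in s, g != h, cone_min s sigma g & cone_min s sigma h].
Proof.
case/faces_ofP=> c /(allP maximal_ok)/andP[_ /allP h] sub st.
have /andP[/andP[_ us] _] := allP trs_sizes _ st.
have := h _ st; rewrite -size_filter; have := filter_uniq (cone_min s c) us.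
have mono g : g \in filter (cone_min s c) s -> g \in s /\ cone_min s sigma g.
  rewrite mem_filter => /andP[/allP gc ->]; split=> //.
  by apply/allP => i /(mem_subseq sub)/gc.
case: (filter _ _) mono => [|a [|b t]] // mono; rewrite /= inE negb_or => /andP[/andP[ab _] _] _.
have [as_ ac] := mono a (mem_head _ _).
have [bs bc] : b \in s /\ cone_min s sigma b by apply: mono; rewrite !inE eqxx orbT.
by exists a, b.
Qed.

Lemma separatedP sigma j : sigma \in Delta -> (j < size rays)%N -> j \notin sigma ->
  exists s g, [/\ s \in trs, g \in s, cone_min s sigma g & ~~ ray_min s (ray j) g].
Proof.
move=> sD jr js; have := allP (allP patterns_ok _ sD) j.
rewrite mem_iota jr => /(_ isT); rewrite (negPf js) /= /separated.
set pats := map _ rays; pose d : seq zvec * zvec := ([::], [::]).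
have psz i : (i < size rays)%N -> nth [::] pats i = ray_pattern (ray i).
  by move=> ir; rewrite (nth_map [::]).
have csz tau : {in tau, forall i, (i < size rays)%N} ->
    size (cone_pattern pats tau) = size pattern_pairs /\
    forall k, (k < size pattern_pairs)%N -> nth false (cone_pattern pats tau) k =
      cone_min (nth d pattern_pairs k).1 tau (nth d pattern_pairs k).2.
  elim: tau => [|i tau IH] h; first by split=> [|k hk]; rewrite ?size_nseq ?nth_nseq ?hk.
  have [|IH1 IH2] := IH; first by move=> m mt; apply: h; rewrite inE mt orbT.
  have ir : (i < size rays)%N by apply: h; rewrite mem_head.
  have sp : size (nth [::] pats i) = size pattern_pairs by rewrite psz // size_map.
  split=> [|k hk] /=; first by rewrite size_map size_zip sp IH1 minnn.
  rewrite (nth_map (false, false)) ?size_zip ?sp ?IH1 ?minnn // nth_zip ?sp ?IH1 //= IH2 //.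
  by rewrite psz // (nth_map d).
have [c1 c2] := csz sigma (fun i => @Delta_lt sigma i sD).
have sj : size (nth [::] pats j) = size pattern_pairs by rewrite psz // size_map.
case/(has_nthP (false, false)) => k; rewrite size_zip c1 sj minnn => hk.
rewrite nth_zip ?c1 ?sj //= c2 // psz // (nth_map d) // => /andP[h1 h2].
have /flattenP[_ /mapP[s st ->] /mapP[g gs E]] := mem_nth d hk.
by exists s, g; rewrite E in h1 h2.
Qed.

Variable R : realFieldType.
Local Notation rvec := (rvec R n).
Local Notation rdot := (@rdot R n).

Definition ray_sum sigma (lam : nat -> R) : 'rV[R]_n := \sum_(i <- sigma) lam i *: rvec (ray i).

Lemma rdot_ray s g i : s \in trs -> g \in s -> rdot g (rvec (ray i)) = zreal R (zdot g (ray i)).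
Proof.
move=> st gs; rewrite rdot_rvec //.
by have /andP[_ /allP/(_ _ gs)/eqP->] := allP trs_sizes _ st.
Qed.

Lemma zreal_le a b : (zreal R a <= zreal R b) = Z.leb a b.
Proof.
rewrite -subr_ge0 -zrealN -zrealD zreal_ge0.
by apply/Z.leb_spec0/Z.leb_spec0; lia.
Qed.

(** Some term is minimal on every ray of [sigma]; the excess of [g] over it is a sum of nonnegative
    contributions with positive weights, and vanishes only if [g] is minimal on each ray. *)
Lemma minimal_ray_sum s g sigma lam : sigma \in Delta -> s \in trs -> g \in s ->
  (forall i, i \in sigma -> 0 < lam i) ->
  minimal_in s (ray_sum sigma lam) g <-> cone_min s sigma g.
Proof.
move=> sD st gs lam0.
have dE h : h \in s -> rdot h (ray_sum sigma lam) = \sum_(i <- sigma) lam i * zreal R (zdot h (ray i)).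
  by move=> hs; rewrite rdot_sum; apply: eq_bigr => i _; rewrite rdotZ (rdot_ray _ st hs).
split=> [[_ gmin]|/allP gmin]; last first.
  split=> // h hs; rewrite !dE // big_seq [leRHS]big_seq; apply: ler_sum => i si.
  by rewrite ler_pM2l ?lam0 // zreal_le; apply: (allP (gmin i si)).
have [a [_ [as_ _ _ /allP ac _]]] := cone_min_two sD st.
have := gmin a as_; rewrite !dE // -subr_le0 -sumrB big_seq.
have ge0 i : i \in sigma -> 0 <= lam i * zreal R (zdot g (ray i)) - lam i * zreal R (zdot a (ray i)).
  by move=> si; rewrite subr_ge0 ler_pM2l ?lam0 // zreal_le (allP (ac i si)).
move=> le0; have /eqP : \sum_(i <- sigma | i \in sigma)
    (lam i * zreal R (zdot g (ray i)) - lam i * zreal R (zdot a (ray i))) = 0.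
  by apply/eqP; rewrite eq_le le0 sumr_ge0.
rewrite psumr_eq0 // => /allP E; apply/allP => i si; apply/allP => h hs.
have := E i si; rewrite si /= subr_eq0 (inj_eq (mulfI (lt0r_neq0 (lam0 i si)))) => /eqP e.
by rewrite -zreal_le e zreal_le; apply: (allP (ac i si)).
Qed.

Lemma min_twice_ray_sum s sigma lam : sigma \in Delta -> s \in trs ->
  (forall i, i \in sigma -> 0 < lam i) -> min_twice s (ray_sum sigma lam).
Proof.
move=> sD st lam0 g [gs gmin].
have [a [b [as_ bs ab ac bc]]] := cone_min_two sD st.
have ma := (minimal_ray_sum sD st as_ lam0).2 ac; have mb := (minimal_ray_sum sD st bs lam0).2 bc.
have [E|ne] := eqVneq a g; last by exists a => //; split=> //; apply: ma.2.
by exists b => //; split; [rewrite -E eq_sym | apply: mb.2].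
Qed.

(* The cone containing a point in its relative interior is determined by which
   terms of the canonical triples are minimal. *)
Lemma ray_sum_degenerates sigma tau lam mu : sigma \in Delta -> tau \in Delta ->
  (forall i, i \in sigma -> 0 < lam i) -> (forall i, i \in tau -> 0 < mu i) ->
  (forall s, s \in trs -> forall g, minimal_in s (ray_sum sigma lam) g ->
     minimal_in s (ray_sum tau mu) g) <-> {subset tau <= sigma}.
Proof.
move=> sD tD lam0 mu0; split=> [h j jt|sub s st g gmin].
  apply: contraT => js.
  have [s [g [st gs gc]]] := separatedP sD (Delta_lt tD jt) js.
  have /(h s st) := (minimal_ray_sum sD st gs lam0).2 gc.
  by move/(minimal_ray_sum tD st gs mu0)/allP/(_ j jt) ->.
have gs := gmin.1; move/(minimal_ray_sum sD st gs lam0)/allP: gmin => gmin.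
by apply/(minimal_ray_sum tD st gs mu0)/allP => i /sub/gmin.
Qed.

End ConePatterns.

(** * Cells of a common refinement *)

Section CommonRefinement.
Variables (R : realType) (K : fieldType) (v : valuation R K) (I : finType).
Variable G : set (laurent K I).
Implicit Types (w : weight R I) (f : laurent K I).
Local Notation degenerates := (degenerates v G).

Lemma degenerates_refl w : degenerates w w.
Proof. by move=> f _ a. Qed.

Lemma degenerates_trans w1 w2 w3 : degenerates w1 w2 -> degenerates w2 w3 -> degenerates w1 w3.
Proof. by move=> h1 h2 f Gf a /(h1 f Gf)/(h2 f Gf). Qed.

Lemma trop_term_midpoint f w w' a :
  trop_term v f (2^-1 *: (w + w')) a = 2^-1 * (trop_term v f w a + trop_term v f w' a).
Proof. by rewrite !trop_termE monvalZ monvalD; field. Qed.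

Lemma min_terms_midpoint f w w' a :
  min_terms v f w a -> min_terms v f w' a -> min_terms v f (2^-1 *: (w + w')) a.
Proof.
move=> [af h] [_ h']; split=> // b bf; rewrite !trop_term_midpoint.
by rewrite ler_pM2l ?invr_gt0 ?ltr0n // lerD ?h ?h'.
Qed.

(** Let [b] be minimal at both points. A term minimal at the midpoint cannot exceed [b] at [w],
    since it would have to fall below [b] at [w'] to compensate. *)
Lemma degenerates_midpoint w w' :
  (forall f, G f -> f != 0 -> min_terms v f w `&` min_terms v f w' !=set0) ->
  degenerates (2^-1 *: (w + w')) w /\ degenerates (2^-1 *: (w + w')) w'.
Proof.
move=> h; suff H w1 w2 : (forall f, G f -> f != 0 -> min_terms v f w1 `&` min_terms v f w2 !=set0) ->
    degenerates (2^-1 *: (w1 + w2)) w1.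
  split; first exact: H.
  by rewrite addrC; apply: H => f Gf f0; have [b [b1 b2]] := h f Gf f0; exists b.
move=> h12 f Gf a [af amin]; have f0 : f != 0 by apply: contraTneq af => ->; rewrite msupp0 in_fset0.
have [b [[bf b1] [_ b2]]] := h12 f Gf f0; split=> // c cf.
apply: le_trans (b1 c cf); have := amin b bf; rewrite !trop_term_midpoint.
rewrite ler_pM2l ?invr_gt0 ?ltr0n // => le.
by rewrite -(lerD2r (trop_term v f w2 a)); apply: le_trans le _; rewrite lerD2l b2.
Qed.

Variables (L : {vspace weight R I}) (ray : nat -> weight R I) (Delta : seq (seq nat)).
Hypothesis Delta_sorted : forall sigma, sigma \in Delta -> sorted ltn sigma.
Hypothesis Delta_filter : forall sigma (p : pred nat),
  sigma \in Delta -> filter p sigma \in Delta.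
Hypothesis trop_relint : forall w, trop_intersection v G w <->
  exists2 sigma, sigma \in Delta & ray_relint L ray sigma w.
Hypothesis degenerates_relint : forall sigma tau w w', sigma \in Delta -> tau \in Delta ->
  ray_relint L ray sigma w -> ray_relint L ray tau w' ->
  degenerates w w' <-> {subset tau <= sigma}.

Lemma relint_unique sigma tau w : sigma \in Delta -> tau \in Delta ->
  ray_relint L ray sigma w -> ray_relint L ray tau w -> sigma = tau.
Proof.
move=> sD tD hs ht; apply: (irr_sorted_eq ltn_trans ltnn); rewrite ?Delta_sorted // => i.
have st := (degenerates_relint tD sD ht hs).1 (@degenerates_refl w).
have ts := (degenerates_relint sD tD hs ht).1 (@degenerates_refl w).
by apply/idP/idP; [apply: st | apply: ts].
Qed.

Lemma degenerates_trop w w' :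
  trop_intersection v G w -> degenerates w w' -> trop_intersection v G w'.
Proof.
move=> hw h f Gf a amin'; have f0 : f != 0.
  by apply: contraTneq amin'.1 => ->; rewrite msupp0 in_fset0.
have [c cmin] := min_terms_ex v w f0; have [d dc dmin] := hw f Gf c cmin.
have [E|ne] := eqVneq c a; last by exists c => //; apply: (h f Gf).
by exists d; rewrite -?E //; apply: (h f Gf).
Qed.

(** By [degenerates_trop] a degeneration of [w] stays in the intersection, hence in the interior of
    some cone, which [degenerates_relint] identifies as a face of [sigma]. *)
Lemma degenerates_ray_cone sigma w : sigma \in Delta -> ray_relint L ray sigma w ->
  [set w' | degenerates w w'] = ray_cone L ray sigma.
Proof.
move=> sD hs; apply/seteqP; split=> w' /=.
  move=> h; have hw : trop_intersection v G w by apply/trop_relint; exists sigma.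
  have /trop_relint[tau tD ht] := degenerates_trop hw h.
  have ts := (degenerates_relint sD tD hs ht).1 h.
  apply: (@ray_cone_filter _ _ _ _ _ (fun i => i \in tau)).
  rewrite (_ : filter _ _ = tau); first exact: ray_relint_cone.
  apply: (irr_sorted_eq ltn_trans ltnn); rewrite ?Delta_sorted ?Delta_filter // => i.
  by rewrite mem_filter; case: (boolP (i \in tau)) => // /ts ->.
case/ray_cone_relint => p hp; apply/(degenerates_relint sD (Delta_filter p sD) hs hp).
by move=> i; rewrite mem_filter => /andP[].
Qed.

(* A nonempty intersection of cells is the closed cell of any of its points
   lying on a cone of maximal dimension. *)
Lemma common_refinement_ray_fan : common_refinement v G = ray_fan L ray Delta.
Proof.
apply/seteqP; split=> [C [[w0 Cw0] [c hc CE]]|_ [sigma sD <-]]; last first.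
  pose w := combi ray sigma (fun=> 1).
  have hs : ray_relint L ray sigma w by exists 0, (fun=> 1); rewrite mem0v add0r.
  have hw : trop_intersection v G w by apply/trop_relint; exists sigma.
  rewrite -(degenerates_ray_cone sD hs); split; first by exists w; apply: degenerates_refl.
  exists (fun f => trop_cell v f w) => [f Gf|]; first by exists w => //; apply: hw.
  by apply/seteqP; split=> w' h f Gf; apply: h.
have cw f : G f -> exists2 w, trop_hypersurface v f w & c f = trop_cell v f w.
  by move=> Gf; have [w hw <-] := hc f Gf; exists w.
have Cup w w' : C w -> degenerates w w' -> C w'.
  rewrite CE => Cw h f Gf; have [wf _ E] := cw f Gf.
  by have := Cw f Gf; rewrite E => /subset_trans; apply; apply: h.
have Ctrop w : C w -> trop_intersection v G w.
  rewrite CE => Cw f Gf a amin; have [wf hwf E] := cw f Gf.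
  have f0 : f != 0 by apply: contraTneq amin.1 => ->; rewrite msupp0 in_fset0.
  have [b bmin] := min_terms_ex v wf f0; have [d db dmin] := hwf b bmin.
  have sub : min_terms v f wf `<=` min_terms v f w by have := Cw f Gf; rewrite E.
  have [e|ne] := eqVneq b a; last by exists b => //; apply: sub.
  by exists d; rewrite -?e //; apply: sub.
have Cmid w w' : C w -> C w' -> C (2^-1 *: (w + w')).
  rewrite CE => Cw Cw' f Gf; have [wf _ E] := cw f Gf; have := Cw f Gf; have := Cw' f Gf.
  by rewrite E => h' h a am; apply: min_terms_midpoint; [apply: h | apply: h'].
have Cmeet w w' : C w -> C w' ->
    forall f, G f -> f != 0 -> min_terms v f w `&` min_terms v f w' !=set0.
  rewrite CE => Cw Cw' f Gf f0; have [wf _ E] := cw f Gf; have := Cw f Gf; have := Cw' f Gf.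
  have [b bmin] := min_terms_ex v wf f0.
  by rewrite E => h' h; exists b; split; [apply: h | apply: h'].
have [w Cw [sigma sD [hs smax]]] : exists2 w, C w & exists2 sigma, sigma \in Delta &
    ray_relint L ray sigma w /\ forall w' tau, C w' -> tau \in Delta ->
      ray_relint L ray tau w' -> (size tau <= size sigma)%N.
  have [m [mub mex]] : exists m, (forall w' tau, C w' -> tau \in Delta ->
        ray_relint L ray tau w' -> (size tau <= m)%N) /\
      exists w sigma, [/\ C w, sigma \in Delta, ray_relint L ray sigma w & size sigma = m].
    pose P k := `[< exists w sigma, [/\ C w, sigma \in Delta, ray_relint L ray sigma w & size sigma = k] >].
    have [k Pk] : exists k, P k.
      have /trop_relint[sigma sD hs] := Ctrop _ Cw0.
      by exists (size sigma); apply/asboolP; exists w0, sigma.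
    have ub j : P j -> (j <= \max_(sigma <- Delta) size sigma)%N.
      by move=> /asboolP[w [sigma [_ sD _ <-]]]; apply: leq_bigmax_seq.
    have [m Pm mmax] := ex_maxnP (ex_intro _ k Pk) ub.
    exists m; split; last by apply/asboolP.
    by move=> w' tau Cw' tD ht; apply: mmax; apply/asboolP; exists w', tau.
  have [w [sigma [Cw sD hs sm]]] := mex; exists w => //; exists sigma => //.
  by split=> // w' tau Cw' tD ht; rewrite sm; apply: mub ht.
exists sigma => //; rewrite -(degenerates_ray_cone sD hs); apply/seteqP; split=> w' /=.
  exact: Cup.
move=> Cw'; have [mw mw'] := degenerates_midpoint (Cmeet _ _ Cw Cw').
have Cm := Cmid _ _ Cw Cw'; have /trop_relint[tau tD ht] := Ctrop _ Cm.
apply: degenerates_trans mw'; apply/(degenerates_relint sD tD hs ht).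
have sub := (degenerates_relint tD sD ht hs).1 mw.
have us := sorted_uniq ltn_trans ltnn (Delta_sorted sD).
by have [_ E] := uniq_min_size us sub (smax _ _ Cm tD ht); move=> i; rewrite E.
Qed.

End CommonRefinement.

Lemma min_twice_vanishes (R : realFieldType) n (a b c : zvec) (q : 'rV[R]_n) :
  min_twice [:: a; b; c] q -> vanishes (a, b, c) q.
Proof.
have in3 g : g \in [:: a; b; c] -> [\/ g = a, g = b | g = c].
  by rewrite !inE => /or3P[]/eqP->; [apply: Or31 | apply: Or32 | apply: Or33].
have [ma mb mc] : [/\ a \in [:: a; b; c], b \in [:: a; b; c] & c \in [:: a; b; c]].
  by rewrite !inE !eqxx !orbT.
have all3 g : rdot g q <= rdot a q -> rdot g q <= rdot b q -> rdot g q <= rdot c q ->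
    forall h, h \in [:: a; b; c] -> rdot g q <= rdot h q by move=> ? ? ? h /in3[]->.
move=> h; rewrite /vanishes.
have [ab|ba] := orP (le_total (rdot a q) (rdot b q)).
  have [ac|ca] := orP (le_total (rdot a q) (rdot c q)).
    have [|g /in3[]-> [ne le]] := h a; first by split=> //; apply: all3.
    - by rewrite eqxx in ne.
    - by apply: Or33; split; lra.
    - by apply: Or32; split; lra.
  have [|g /in3[]-> [ne le]] := h c; first by split=> //; apply: all3 => //; lra.
  - by apply: Or32; split; lra.
  - by apply: Or31; split; lra.
  - by rewrite eqxx in ne.
have [bc|cb] := orP (le_total (rdot b q) (rdot c q)).
  have [|g /in3[]-> [ne le]] := h b; first by split=> //; apply: all3.
  - by apply: Or33; split; lra.
  - by rewrite eqxx in ne.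
  - by apply: Or31; split; lra.
have [|g /in3[]-> [ne le]] := h c; first by split=> //; apply: all3 => //; lra.
- by apply: Or32; split; lra.
- by apply: Or31; split; lra.
- by rewrite eqxx in ne.
Qed.

(** * The refinement fan of a system of relations *)

Section RelationFan.
Variables (I : finType) (x : nat -> I) (N n : nat).
Variables (rows incs rays : seq zvec) (rels : seq (seq (bool * (nat * nat)))).
Variable maximal : seq (seq nat).
Hypothesis x_inj : forall i j, (i < N)%N -> (j < N)%N -> x i = x j -> i = j.
Hypothesis x_surj : forall b, exists2 i, (i < N)%N & b = x i.
Hypothesis rels_ok : all (relation_ok N rows incs) rels.
Hypothesis size_rows : size rows = N.
Hypothesis rows_sizes : all (fun g => size g == n) rows.
Let trs := canonical_triples rows rels.
Hypothesis trs_sizes : all (fun s => (size s == 3%N) && uniq s && all (fun g => size g == n) s) trs.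
Hypothesis maximal_ok : all (fun c => sorted ltn c && all (fun i => i < size rays)%N c
  && all (fun s => 1 < count (cone_min rays s c) s)%N trs) maximal.
Hypothesis patterns_ok : let pats := [seq ray_pattern trs r | r <- rays] in
  all (fun sigma => let b := cone_pattern trs pats sigma in
    all (fun j => (j \in sigma) || separated pats b j) (iota 0 (size rays))) (faces_of maximal).
Hypothesis nil_face : [::] \in faces_of maximal.

Variable R : realType.
Implicit Types (u q : 'rV[R]_n) (w : weight R I).
Local Notation embed := (embed x N rows incs).
Local Notation Delta := (faces_of maximal).

Definition embed_span : {vspace weight R I} :=
  <<[seq embed (delta_mx 0 i) 0 | i <- enum 'I_n]%R>>%VS.

Definition embed_ray i : weight R I := embed 0 (rvec R n (nth [::] rays i)).

Lemma embed00 : embed (0 : 'rV[R]_n) (0 : 'rV[R]_n) = 0.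
Proof. by apply/ffunP => b; rewrite !ffunE !rdot0 addr0. Qed.

Lemma embed_suml (J : Type) (r : seq J) (F : J -> 'rV[R]_n) :
  embed (\sum_(j <- r) F j) 0 = \sum_(j <- r) embed (F j) 0.
Proof.
elim: r => [|j r IH]; first by rewrite !big_nil embed00.
by rewrite !big_cons -IH embedD addr0.
Qed.

Lemma embed_sumr (J : Type) (r : seq J) (F : J -> 'rV[R]_n) :
  embed 0 (\sum_(j <- r) F j) = \sum_(j <- r) embed 0 (F j).
Proof.
elim: r => [|j r IH]; first by rewrite !big_nil embed00.
by rewrite !big_cons -IH embedD addr0.
Qed.

Lemma embed_spanP w : w \in embed_span <-> exists u, w = embed u 0.
Proof.
split=> [/(coord_span (X := in_tuple _)) ->|[u ->]].
  set X := in_tuple _.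
  suff H j : exists u, coord X j w *: X`_j = embed u 0.
    have [U hU] := choice H; exists (\sum_j U j).
    by rewrite embed_suml; apply: eq_bigr.
  have /mapP[i _ ->] : X`_j \in [seq embed (delta_mx 0 i) 0 | i <- enum 'I_n] by apply: mem_nth.
  by exists (coord X j w *: delta_mx 0 i); rewrite embedZ scaler0.
have -> : embed u 0 = \sum_(i <- enum 'I_n) u 0 i *: embed (delta_mx 0 i) 0.
  rewrite {1}[u]row_sum_delta -big_enum embed_suml.
  by apply: eq_bigr => i _; rewrite embedZ scaler0.
rewrite big_seq; apply: memv_suml => i ii; rewrite memvZ // memv_span //.
exact: (map_f (fun i => embed (delta_mx 0 i) 0)).
Qed.

Lemma combi_embed_ray sigma lam :
  combi embed_ray sigma lam = embed 0 (ray_sum n rays sigma lam).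
Proof.
rewrite /combi /ray_sum embed_sumr.
by apply: eq_bigr => i _; rewrite embedZ scaler0.
Qed.

Lemma ray_relint_embed sigma w : ray_relint embed_span embed_ray sigma w <->
  exists u lam, (forall i, i \in sigma -> 0 < lam i) /\ w = embed u (ray_sum n rays sigma lam).
Proof.
split=> [[_ [lam [/embed_spanP[u ->] lam0 ->]]]|[u [lam [lam0 ->]]]].
  by exists u, lam; rewrite combi_embed_ray embedD addr0 add0r.
exists (embed u 0), lam; rewrite combi_embed_ray embedD addr0 add0r; split=> //.
by apply/embed_spanP; exists u.
Qed.

Variables (K : fieldType) (v : valuation R K).
Let G : set (laurent K I) := [set relation_poly x K T | T in [set` rels]].
Hypothesis trop_embed : forall w, trop_intersection v G w -> exists u q, w = embed u q.
Hypothesis cones_cover : forall q, (forall s, s \in trs -> min_twice s q) ->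
  exists2 c, c \in maximal & in_cone rays c q.

(** By the covering a solution lies in a maximal cone, and then in the interior of the face spanned
    by the rays with positive coefficients; conversely, at an interior point two terms of each
    triple are minimal. *)
Lemma trop_intersection_relint w : trop_intersection v G w <->
  exists2 sigma, sigma \in Delta & ray_relint embed_span embed_ray sigma w.
Proof.
split=> [hw|[sigma sD /ray_relint_embed[u [lam [lam0 ->]]]]]; last first.
  apply/(trop_intersection_embed x_inj x_surj rels_ok size_rows rows_sizes) => s st.
  exact: (min_twice_ray_sum trs_sizes maximal_ok).
have [u [q wE]] := trop_embed hw; rewrite wE in hw *.
have := cones_cover ((trop_intersection_embed x_inj x_surj rels_ok size_rows rows_sizes _ _ _).1 hw).
case=> c cm [lam lam0 qE].
have cD : c \in Delta by apply/faces_ofP; exists c.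
have /ray_cone_relint[p hp] : ray_cone embed_span embed_ray c (embed u q).
  exists (embed u 0), lam; split=> //; first by apply/embed_spanP; exists u.
  by rewrite combi_embed_ray embedD addr0 add0r qE.
by exists (filter p c) => //; apply: faces_of_filter.
Qed.

Lemma degenerates_relint_embed sigma tau w w' : sigma \in Delta -> tau \in Delta ->
  ray_relint embed_span embed_ray sigma w -> ray_relint embed_span embed_ray tau w' ->
  degenerates v G w w' <-> {subset tau <= sigma}.
Proof.
move=> sD tD /ray_relint_embed[u [lam [lam0 ->]]] /ray_relint_embed[u' [mu [mu0 ->]]].
have E1 := degenerates_embed x_inj x_surj rels_ok v u (ray_sum n rays sigma lam) u'
  (ray_sum n rays tau mu).
have E2 := ray_sum_degenerates trs_sizes maximal_ok patterns_ok sD tD lam0 mu0.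
by split=> [/E1/E2|/E2/E1].
Qed.

Lemma relation_fanE : common_refinement v G = ray_fan embed_span embed_ray Delta.
Proof.
apply: common_refinement_ray_fan.
- exact: Delta_sortedP maximal_ok.
- exact: faces_of_filter.
- exact: trop_intersection_relint.
- exact: degenerates_relint_embed.
Qed.

Lemma relint_embed_unique sigma tau w : sigma \in Delta -> tau \in Delta ->
  ray_relint embed_span embed_ray sigma w -> ray_relint embed_span embed_ray tau w -> sigma = tau.
Proof.
move=> sD tD hs ht; apply: (relint_unique (v := v) (G := G)) sD tD hs ht.
- exact: Delta_sortedP maximal_ok.
- exact: degenerates_relint_embed.
Qed.

(* At a point whose opposite is also in the support, all three terms of every
   canonical triple agree, as for the points of the lineality space. *)
Lemma relint_embed_pointed sigma tau w : sigma \in Delta -> tau \in Delta ->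
  ray_relint embed_span embed_ray sigma w -> ray_relint embed_span embed_ray tau (- w) ->
  w \in embed_span.
Proof.
move=> sD tD hs ht.
have hw : trop_intersection v G w by apply/trop_intersection_relint; exists sigma.
have hwN : trop_intersection v G (- w) by apply/trop_intersection_relint; exists tau.
have /ray_relint_embed[u [lam [lam0 wE]]] := hs.
set q := ray_sum _ _ _ _ in wE.
have wNE : - w = embed (- u) (- q).
  by rewrite wE -scaleN1r embedZ !scaleN1r.
rewrite wE in hw; rewrite wNE in hwN.
move/(trop_intersection_embed x_inj x_surj rels_ok size_rows rows_sizes): hw => hw.
move/(trop_intersection_embed x_inj x_surj rels_ok size_rows rows_sizes): hwN => hwN.
have rdotN g : rdot g (- q) = - rdot g q by rewrite -scaleN1r rdotZ mulN1r.
have all_min s g : s \in trs -> g \in s -> minimal_in s q g.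
  move=> st gs; have /andP[/andP[/eqP s3 us] _] := allP trs_sizes _ st.
  have h1 := hw _ st; have h2 := hwN _ st.
  case: s s3 us gs h1 h2 {st} => [|a [|b [|c []]]] //= _ us gs h1 h2.
  have := min_twice_vanishes h1; have := min_twice_vanishes h2; rewrite /vanishes !rdotN => e2 e1.
  have [eb ec] : rdot b q = rdot a q /\ rdot c q = rdot a q.
    by case: e1 => -[? ?]; case: e2 => -[? ?]; split; lra.
  have H h : h \in [:: a; b; c] -> rdot h q = rdot a q by rewrite !inE => /or3P[]/eqP->.
  by split=> // h hin; rewrite (H _ hin) (H _ gs).
have sub : {subset sigma <= [::]}.
  have h0 : ray_sum n rays [::] lam = 0 :> 'rV[R]_n by rewrite /ray_sum big_nil.
  apply/(ray_sum_degenerates trs_sizes maximal_ok patterns_ok (lam := lam) nil_face sD _ lam0) => //.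
  by move=> s st g [gs _]; apply: all_min.
have s0 : sigma = [::] by case: (sigma) sub => // i s /(_ i (mem_head _ _)).
by apply/embed_spanP; exists u; rewrite wE /q s0 /ray_sum big_nil.
Qed.

End RelationFan.

(** * Numerical data for the Dressian *)

Section StarData.
Local Open Scope nat_scope.

(* Adding an element of the lineality space makes the values on the bases of
   star_frame zero; the two-term relations in star_elimination then express the
   values on all bases through those on the bases of star_free. *)
Definition star_frame : seq nat := [:: 23; 94; 92; 81; 31; 40; 46; 4; 67; 51].
Definition star_free : seq nat := [:: 95; 50; 35; 76; 3; 27; 30; 17; 72; 32].

Definition star_elimination : seq (nat * ((nat * nat) * (nat * nat))) := [::
  (4, ((0, 5), (7, 9))); (4, ((0, 3), (7, 9))); (7, ((0, 3), (4, 9))); (7, ((0, 4), (5, 9)));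
  (3, ((1, 4), (7, 9))); (9, ((0, 1), (3, 4))); (1, ((3, 4), (7, 9))); (4, ((0, 1), (7, 9)));
  (4, ((1, 3), (5, 7))); (1, ((0, 3), (6, 9))); (1, ((0, 4), (6, 9))); (1, ((0, 6), (7, 9)));
  (3, ((1, 4), (6, 7))); (4, ((1, 3), (5, 6))); (4, ((0, 6), (7, 9))); (7, ((0, 4), (6, 9)));
  (6, ((0, 1), (4, 9))); (6, ((1, 3), (4, 9))); (1, ((3, 4), (5, 7))); (1, ((4, 5), (6, 7)));
  (1, ((4, 5), (7, 9))); (7, ((1, 3), (4, 5))); (6, ((0, 1), (5, 9))); (4, ((0, 2), (7, 9)));
  (9, ((0, 2), (4, 7))); (7, ((1, 2), (4, 5))); (7, ((2, 3), (4, 5))); (1, ((2, 3), (4, 7)));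
  (1, ((2, 3), (4, 5))); (2, ((1, 3), (5, 7))); (2, ((1, 4), (5, 7))); (2, ((1, 5), (7, 9)));
  (1, ((2, 4), (5, 8))); (5, ((1, 2), (4, 8))); (4, ((1, 2), (7, 8))); (4, ((1, 2), (8, 9)));
  (7, ((0, 4), (8, 9))); (2, ((1, 4), (8, 9))); (2, ((4, 5), (8, 9))); (2, ((4, 7), (8, 9)));
  (5, ((1, 2), (7, 8))); (1, ((0, 2), (4, 5))); (5, ((0, 1), (2, 4))); (5, ((0, 1), (2, 8)));
  (5, ((0, 1), (7, 8))); (2, ((0, 1), (5, 7))); (0, ((1, 2), (6, 7))); (0, ((2, 5), (6, 7)));
  (0, ((2, 6), (7, 9))); (5, ((0, 1), (6, 8))); (9, ((0, 1), (2, 3))); (0, ((1, 5), (7, 8)));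
  (0, ((2, 5), (7, 8))); (0, ((4, 5), (7, 8))); (0, ((5, 6), (7, 8))); (2, ((0, 1), (4, 8)));
  (0, ((2, 4), (6, 8))); (0, ((1, 3), (7, 9))); (0, ((2, 3), (7, 9))); (0, ((3, 4), (7, 9)));
  (0, ((3, 6), (7, 9))); (7, ((0, 1), (2, 3))); (6, ((0, 1), (3, 8))); (6, ((0, 3), (5, 8)));
  (6, ((0, 3), (7, 8))); (6, ((0, 3), (8, 9))); (1, ((0, 6), (8, 9))); (2, ((0, 1), (6, 8)));
  (2, ((0, 3), (6, 8))); (2, ((0, 4), (6, 8))); (2, ((0, 5), (6, 8))); (2, ((0, 6), (7, 8)));
  (2, ((0, 6), (8, 9))); (8, ((0, 2), (4, 6))); (1, ((0, 2), (6, 9))); (6, ((2, 3), (4, 8)));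
  (5, ((0, 2), (6, 7))); (0, ((1, 3), (8, 9))); (0, ((1, 5), (8, 9))); (0, ((3, 5), (8, 9)));
  (8, ((0, 1), (5, 9))); (8, ((0, 3), (5, 9))); (9, ((0, 1), (3, 8))); (9, ((0, 3), (5, 8)));
  (3, ((0, 1), (6, 8))); (3, ((0, 2), (6, 8))); (3, ((0, 4), (6, 8))); (3, ((0, 6), (7, 8)));
  (1, ((0, 3), (7, 8))); (2, ((0, 3), (4, 8)))].

Local Open Scope Z_scope.

(* The columns of three times the inverse of the incidence matrix of star_frame. *)
Definition frame_inverse : seq zvec := [::
  [:: 2; -1; -1; -1; 2; -1; -1; -1; 2; -1]; [:: -1; 2; -1; -1; -1; 2; -1; -1; -4; 2];
  [:: 1; -2; 1; 1; 1; 1; 1; 1; 1; -2]; [:: -2; -2; -2; 1; 1; -2; 4; 1; 4; 1];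
  [:: 1; 1; 1; 1; -2; 1; -2; 1; -2; 1]; [:: 2; 2; 2; 2; -1; 2; -4; -1; -4; -1];
  [:: -2; 1; -2; -2; 1; -2; 1; 1; 1; 1]; [:: 0; 0; 0; 0; 0; 0; 3; 0; 0; 0];
  [:: 0; 0; 3; 0; 0; 0; 0; 0; 0; 0]; [:: 0; 0; 0; 0; 0; 0; 0; 0; 3; 0]].

Definition star_rays : seq zvec := [::
  [:: -1; 0; 0; 0; 0; -1; 0; 0; -1; 0]; [:: -1; 0; 1; -1; 1; -1; -1; 0; -1; -1];
  [:: -1; 1; 1; 0; 1; 0; 0; 1; -1; -1]; [:: -1; 1; 2; -1; 1; -1; -2; 0; -1; -2];
  [:: -1; 1; 2; 0; 1; 0; -1; 1; 0; -2]; [:: 0; -1; -2; 0; -1; 0; 0; 0; -1; 0];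
  [:: 0; -1; -2; 1; -2; -1; 1; -1; 0; 1]; [:: 0; -1; -1; 0; -1; 0; 0; 1; 0; 0];
  [:: 0; -1; -1; 0; -1; 0; 1; 0; 1; 1]; [:: 0; -1; -1; 0; -1; 0; 1; 1; 1; 1];
  [:: 0; 0; -1; 0; 0; 1; 0; 0; -1; 0]; [:: 0; 0; 0; -1; 1; 0; -1; 0; -1; -1];
  [:: 0; 0; 0; 0; -1; -1; -1; -1; 0; 0]; [:: 0; 0; 0; 0; 0; 0; 0; 0; 0; 1];
  [:: 0; 0; 0; 0; 0; 0; 0; 0; 1; 0]; [:: 0; 0; 0; 0; 0; 0; 1; 1; 1; 1];
  [:: 0; 0; 0; 0; 1; 1; 0; 0; 0; 0]; [:: 0; 0; 0; 1; 0; 1; 1; 0; 2; 0];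
  [:: 0; 0; 1; -1; 2; 0; -1; 0; -1; -1]; [:: 0; 0; 1; 0; 0; 0; -1; 1; 0; -1];
  [:: 0; 1; 1; -1; 1; 0; -1; 0; -1; -1]; [:: 0; 1; 1; 0; 1; 0; 1; 1; 0; 0];
  [:: 1; -1; -2; 1; -2; 1; 2; -1; 2; 2]; [:: 1; -1; -2; 2; -2; 0; 3; -1; 2; 2];
  [:: 1; -1; -2; 2; -2; 1; 3; -1; 3; 2]; [:: 1; 0; -1; 0; -1; 1; 0; -1; 0; 1];
  [:: 1; 0; 0; 0; -1; 0; -1; -1; 0; 1]; [:: 1; 0; 0; 1; 0; 0; 2; 0; 1; 1];
  [:: 1; 0; 1; 0; 0; 0; -1; 0; 0; 0]; [:: 1; 0; 1; 0; 1; 0; 0; 0; 0; 0]].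

(* The maximal cones: each ray comes with the linear form that gives its coefficient. *)
Definition star_leaves : seq (seq (nat * zvec)) := [::
  [:: (0%N, [:: -1; 0; 0; 1; 0; 0; 0; 0; 0; 0]); (1%N, [:: 0; -1; 0; -1; 0; 0; 0; 0; 0; 0]); (3%N, [:: 0; 1; 0; 0; 0; 0; 0; 0; 0; 0])];
  [:: (0%N, [:: 0; 0; 0; 1; 0; -1; 0; 0; 0; 0]); (2%N, [:: 0; 0; 0; 0; 0; 0; 0; 1; 0; 0]); (3%N, [:: 0; 0; 0; -1; 0; 0; 0; 0; 0; 0])];
  [:: (0%N, [:: -1; -1; 0; 0; 0; 0; 0; 0; 0; 0]); (3%N, [:: 0; 1; 0; 0; 0; 0; 0; 0; 0; 0]); (12%N, [:: 0; 0; 0; 0; 0; 0; 0; -1; 0; 0])];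
  [:: (0%N, [:: -1; 0; 0; 0; 0; 0; 0; 0; 0; 0]); (6%N, [:: 0; -1; 0; 0; 0; 0; 0; 0; 0; 0]); (12%N, [:: 0; -1; 0; 0; 0; 0; -1; 0; 0; 0])];
  [:: (0%N, [:: -1; 0; 0; 0; 0; 0; 0; 0; 0; 0]); (12%N, [:: 0; 0; 0; 0; -1; 0; 0; 0; 0; 0]); (13%N, [:: 0; 0; 0; 0; 0; 0; 0; 0; 0; 1])];
  [:: (2%N, [:: 0; 0; 0; 1; 0; 0; 0; 0; -1; 0]); (3%N, [:: 0; 0; 0; -1; 0; 0; 0; 0; 0; 0]); (4%N, [:: -1; 0; 0; 0; 0; 0; 0; 0; 1; 0])];
  [:: (2%N, [:: 0; 0; 0; 0; 0; 0; 0; 1; 0; 0]); (3%N, [:: 0; 0; 0; 0; 0; -1; 0; 0; 0; 0]); (20%N, [:: 0; 0; 0; -1; 0; 1; 0; 0; 0; 0])];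
  [:: (2%N, [:: -1; 0; 0; 0; 0; 0; 0; 0; 0; 0]); (10%N, [:: 0; 0; 0; 0; 0; 1; 0; 0; 0; 0]); (20%N, [:: 0; 0; 0; -1; 0; 0; 0; 0; 0; 0])];
  [:: (2%N, [:: -1; 0; 0; 0; 0; 0; 0; 0; 0; 0]); (20%N, [:: 0; 0; 0; -1; 0; 0; 0; 0; 0; 0]); (21%N, [:: 0; 0; 0; -1; 0; 0; 1; 0; 0; 0])];
  [:: (5%N, [:: 0; -1; 0; 0; 0; 0; 0; 0; 0; 0]); (10%N, [:: 0; 0; 0; 0; 0; 1; 0; 0; 0; 0]); (11%N, [:: 0; 0; 0; -1; 0; 0; 0; 0; 0; 0])];
  [:: (10%N, [:: 0; 0; -1; 0; 0; 0; 0; 0; 0; 0]); (11%N, [:: 0; 0; 0; -1; 0; 0; 0; 0; 0; 0]); (16%N, [:: 0; 0; 0; 1; 1; 0; 0; 0; 0; 0])];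
  [:: (10%N, [:: 0; 0; 0; 0; 0; 1; 0; 0; 0; 0]); (11%N, [:: 0; -1; 0; -1; 0; 0; 0; 0; 0; 0]); (20%N, [:: 0; 1; 0; 0; 0; 0; 0; 0; 0; 0])];
  [:: (10%N, [:: -1; 0; 0; 0; 0; 1; 0; 0; 0; 0]); (20%N, [:: 0; 1; 0; 0; 0; 0; 0; 0; 0; 0]); (25%N, [:: 1; 0; 0; 0; 0; 0; 0; 0; 0; 0])];
  [:: (11%N, [:: 0; 0; 0; -1; 0; 0; 0; 0; 0; 0]); (14%N, [:: 0; 0; 0; -1; 0; 0; 0; 0; 1; 0]); (16%N, [:: 0; 0; 0; 0; 0; 1; 0; 0; 0; 0])];
  [:: (11%N, [:: 0; 0; -1; -1; 0; 0; 0; 0; 0; 0]); (16%N, [:: 0; 0; 0; 0; 0; 1; 0; 0; 0; 0]); (18%N, [:: 0; 0; 1; 0; 0; 0; 0; 0; 0; 0])];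
  [:: (12%N, [:: 0; 0; 0; 0; -1; 0; 0; 0; 0; 0]); (13%N, [:: 0; 0; 0; 0; 0; 0; 0; 0; 0; 1]); (14%N, [:: 0; 0; 0; 0; 0; 0; 0; 0; 1; 0])];
  [:: (12%N, [:: 0; 0; 0; 0; 0; -1; 0; 0; 0; 0]); (13%N, [:: -1; 0; 0; 0; 0; 0; 0; 0; 0; 1]); (26%N, [:: 1; 0; 0; 0; 0; 0; 0; 0; 0; 0])];
  [:: (13%N, [:: 0; 0; 0; 0; 0; 0; -1; 0; 0; 1]); (14%N, [:: 0; 0; 0; 0; 0; 0; -1; 0; 1; 0]); (15%N, [:: 0; 0; 0; 0; 0; 0; 1; 0; 0; 0])];
  [:: (13%N, [:: 0; 0; 0; 0; 0; 0; 0; 0; 0; 1]); (14%N, [:: 0; 0; 0; 0; 0; 0; 0; 0; 1; 0]); (16%N, [:: 0; 0; 0; 0; 1; 0; 0; 0; 0; 0])];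
  [:: (14%N, [:: 0; 0; 0; -2; 0; 0; 0; 0; 1; 0]); (16%N, [:: 0; 0; 0; 0; 1; 0; 0; 0; 0; 0]); (17%N, [:: 0; 0; 0; 1; 0; 0; 0; 0; 0; 0])];
  [:: (1%N, [:: -1; 0; 0; 0; 0; 0; 0; 0; 0; 0]); (8%N, [:: 0; -1; 0; 0; 0; 0; 0; 0; 0; 0])];
  [:: (1%N, [:: -1; 0; 0; 0; 0; 0; 0; 0; 0; 0]); (18%N, [:: 1; 0; 1; 0; 0; 0; 0; 0; 0; 0])];
  [:: (4%N, [:: -1; 0; 0; 0; 0; 0; 0; 0; 0; 0]); (17%N, [:: 0; 0; 0; 1; 0; 0; 0; 0; 0; 0])];
  [:: (4%N, [:: -1; 0; 0; 0; 0; 0; 0; 0; 0; 0]); (19%N, [:: 1; 0; 0; 0; 0; 0; -1; 0; 0; 0])];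
  [:: (5%N, [:: 0; 0; 0; 0; 0; 0; 0; 0; -1; 0]); (6%N, [:: 0; 0; 0; 1; 0; 0; 0; 0; 0; 0])];
  [:: (5%N, [:: 0; 0; 0; 0; 0; 0; 0; 0; -1; 0]); (7%N, [:: 0; 0; 0; 0; 0; 0; 0; 1; 0; 0])];
  [:: (6%N, [:: 0; 0; 0; 0; 0; -1; 0; 0; 0; 0]); (23%N, [:: 1; 0; 0; 0; 0; 0; 0; 0; 0; 0])];
  [:: (7%N, [:: 0; -1; 0; 0; 0; 0; -1; 0; 0; 0]); (9%N, [:: 0; 0; 0; 0; 0; 0; 1; 0; 0; 0])];
  [:: (7%N, [:: 0; -1; 0; 0; 0; 0; 0; 0; 0; 0]); (19%N, [:: 0; 0; 0; 0; 0; 0; -1; 0; 0; 0])];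
  [:: (8%N, [:: 0; -1; 0; 0; 0; 0; 0; -1; 0; 0]); (9%N, [:: 0; 0; 0; 0; 0; 0; 0; 1; 0; 0])];
  [:: (8%N, [:: -1; -1; 0; 0; 0; 0; 0; 0; 0; 0]); (22%N, [:: 1; 0; 0; 0; 0; 0; 0; 0; 0; 0])];
  [:: (9%N, [:: 0; -1; 0; 0; 0; 0; 0; 0; 0; 0]); (15%N, [:: 0; 1; 0; 0; 0; 0; 1; 0; 0; 0])];
  [:: (15%N, [:: 0; 0; 0; 0; 0; 0; 0; 0; 1; 0]); (21%N, [:: 0; 1; 0; 0; 0; 0; 0; 0; 0; 0])];
  [:: (17%N, [:: -1; 0; 0; 0; 0; 1; 0; 0; 0; 0]); (24%N, [:: 1; 0; 0; 0; 0; 0; 0; 0; 0; 0])];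
  [:: (18%N, [:: 0; 0; 0; -1; 0; 0; 0; 0; 0; 0]); (29%N, [:: 1; 0; 0; 0; 0; 0; 0; 0; 0; 0])];
  [:: (19%N, [:: 0; 0; 0; 0; 0; 0; 0; 1; 0; 0]); (28%N, [:: 1; 0; 0; 0; 0; 0; 0; 0; 0; 0])];
  [:: (21%N, [:: 0; 1; 0; 0; 0; 0; 0; 0; 0; 0]); (27%N, [:: 1; 0; 0; 0; 0; 0; 0; 0; 0; 0])];
  [:: (22%N, [:: 2; 0; 0; -1; 0; 0; 0; 0; 0; 0]); (24%N, [:: -1; 0; 0; 1; 0; 0; 0; 0; 0; 0])];
  [:: (22%N, [:: 0; -1; 0; 0; 0; 0; 0; 0; 0; 0]); (25%N, [:: 1; 1; 0; 0; 0; 0; 0; 0; 0; 0])];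
  [:: (23%N, [:: 1; 0; 0; 0; 0; -1; 0; 0; 0; 0]); (24%N, [:: 0; 0; 0; 0; 0; 1; 0; 0; 0; 0])];
  [:: (23%N, [:: 0; -1; 0; 0; 0; 0; 0; 0; 0; 0]); (27%N, [:: 1; 1; 0; 0; 0; 0; 0; 0; 0; 0])];
  [:: (25%N, [:: 0; 0; -1; 0; 0; 0; 0; 0; 0; 0]); (26%N, [:: 0; 0; 0; 0; 0; 0; -1; 0; 0; 0])];
  [:: (26%N, [:: 0; 0; 0; 0; -1; 0; 0; 0; 0; 0]); (28%N, [:: 0; 0; 1; 0; 0; 0; 0; 0; 0; 0])];
  [:: (27%N, [:: 0; 0; 0; 1; 0; 0; 0; 0; 0; 0]); (29%N, [:: 0; 0; 1; 0; 0; 0; 0; 0; 0; 0])];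
  [:: (28%N, [:: 0; 0; 0; 0; 0; 0; -1; 0; 0; 0]); (29%N, [:: 0; 0; 0; 0; 1; 0; 0; 0; 0; 0])]].

Local Open Scope nat_scope.

(** In the encoding of [explore], with 50 trinomials: an entry below 50 branches on that trinomial,
    and 50 + j closes the node with leaf j. *)
Definition star_codes : seq nat := [::
  0; 1; 3; 4; 5; 37; 10; 9; 2; 51; 51; 51; 24; 10; 26; 20; 24; 59; 59; 59; 5; 22; 13; 2; 69;
  28; 12; 2; 69; 12; 2; 69; 5; 19; 10; 50; 24; 7; 26; 4; 5; 33; 14; 2; 51; 51; 51; 30; 28; 7;
  17; 11; 59; 5; 12; 11; 31; 69; 11; 13; 2; 7; 54; 54; 65; 69; 63; 2; 7; 54; 54; 65; 63; 63; 2;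
  7; 54; 54; 65; 63; 63; 12; 11; 2; 69; 5; 23; 10; 50; 30; 11; 12; 11; 4; 5; 39; 37; 2; 2; 51;
  55; 51; 24; 19; 20; 13; 11; 59; 5; 22; 13; 2; 72; 13; 29; 2; 69; 16; 15; 11; 69; 5; 2; 10;
  14; 50; 13; 6; 55; 85; 13; 24; 43; 12; 85; 2; 21; 21; 6; 94; 21; 3; 4; 5; 49; 28; 19; 62; 7;
  62; 7; 62; 13; 57; 57; 57; 19; 61; 61; 61; 36; 10; 59; 11; 7; 24; 57; 57; 57; 24; 57; 57; 57;
  31; 24; 60; 60; 60; 24; 60; 60; 60; 24; 60; 60; 60; 7; 57; 57; 59; 7; 62; 57; 59; 14; 59; 20;
  10; 11; 7; 57; 57; 59; 8; 59; 59; 59; 7; 62; 57; 59; 7; 5; 12; 7; 14; 2; 69; 19; 59; 59; 59;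
  7; 11; 12; 2; 2; 60; 69; 60; 2; 59; 14; 59; 12; 14; 2; 69; 59; 5; 10; 29; 2; 50; 19; 59; 59;
  59; 2; 7; 7; 8; 25; 25; 11; 2; 60; 60; 60; 59; 14; 59; 10; 14; 59; 4; 5; 10; 14; 29; 59; 7;
  2; 51; 51; 51; 8; 25; 29; 2; 2; 11; 16; 60; 60; 60; 11; 60; 14; 60; 7; 20; 34; 7; 2; 59; 5;
  12; 14; 2; 69; 11; 59; 59; 59; 2; 11; 16; 68; 68; 68; 11; 69; 14; 13; 63; 63; 63; 7; 12; 14;
  2; 69; 11; 59; 59; 59; 5; 10; 43; 14; 50; 59; 8; 25; 25; 2; 11; 16; 60; 60; 60; 11; 60; 14;
  60; 7; 10; 14; 29; 59; 4; 5; 12; 14; 59; 9; 2; 51; 51; 51; 20; 2; 11; 2; 60; 60; 60; 59; 59;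
  7; 20; 34; 7; 2; 59; 2; 5; 12; 14; 2; 69; 59; 2; 14; 2; 12; 2; 2; 60; 69; 60; 2; 7; 14; 12;
  25; 69; 59; 5; 10; 16; 2; 71; 64; 64; 59; 14; 59; 6; 9; 25; 25; 45; 59; 2; 64; 64; 64; 14;
  59; 9; 2; 2; 28; 2; 2; 2; 64; 84; 64; 3; 4; 5; 33; 14; 2; 51; 51; 51; 33; 11; 2; 29; 59; 59;
  26; 11; 83; 59; 5; 15; 11; 12; 69; 31; 2; 69; 15; 22; 18; 83; 5; 33; 10; 2; 50; 33; 11; 28;
  18; 10; 83; 4; 5; 33; 14; 18; 51; 51; 51; 33; 18; 12; 27; 6; 21; 6; 17; 59; 6; 5; 12; 11; 2;
  69; 6; 11; 18; 2; 7; 54; 54; 65; 63; 63; 2; 7; 54; 54; 65; 69; 63; 2; 7; 54; 54; 65; 63; 63;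
  12; 11; 2; 69; 6; 5; 33; 10; 2; 6; 50; 50; 50; 33; 18; 11; 11; 18; 6; 10; 10; 4; 5; 40; 37;
  6; 2; 51; 51; 51; 29; 2; 21; 25; 7; 59; 5; 31; 11; 2; 69; 31; 2; 69; 29; 21; 2; 69; 5; 33;
  10; 2; 50; 2; 33; 11; 2; 6; 2; 2; 25; 16; 93; 1; 3; 4; 5; 9; 12; 7; 70; 58; 15; 58; 58; 12;
  24; 7; 70; 58; 9; 49; 7; 80; 7; 58; 59; 49; 7; 58; 59; 7; 58; 59; 5; 30; 9; 12; 7; 70; 58; 7;
  30; 12; 79; 30; 58; 30; 30; 12; 7; 70; 58; 5; 23; 32; 21; 70; 58; 23; 32; 12; 70; 7; 58; 42;
  9; 7; 70; 58; 4; 5; 33; 15; 58; 58; 58; 14; 25; 58; 58; 58; 58; 7; 58; 13; 17; 11; 59; 58; 5;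
  16; 58; 2; 11; 58; 58; 2; 25; 7; 67; 67; 67; 63; 11; 63; 15; 32; 67; 25; 67; 25; 81; 10; 11;
  63; 63; 7; 67; 82; 67; 16; 58; 31; 58; 58; 58; 58; 5; 19; 23; 10; 50; 58; 25; 14; 58; 58; 58;
  58; 58; 21; 58; 58; 58; 4; 5; 39; 58; 6; 2; 75; 58; 2; 51; 55; 58; 58; 58; 12; 11; 2; 75; 44;
  58; 17; 48; 11; 75; 58; 5; 30; 2; 20; 55; 75; 44; 58; 2; 12; 12; 10; 77; 12; 58; 17; 48; 11;
  75; 58; 5; 15; 2; 55; 10; 2; 50; 42; 2; 55; 58; 2; 6; 78; 73; 85; 14; 10; 2; 58; 58; 12; 2;
  6; 75; 85; 58; 21; 58; 58; 2; 11; 6; 75; 85; 58; 3; 4; 5; 11; 24; 7; 8; 7; 62; 58; 56; 58;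
  19; 56; 56; 58; 11; 24; 7; 20; 7; 7; 62; 8; 58; 58; 58; 13; 24; 20; 8; 59; 59; 59; 8; 7; 88;
  58; 58; 58; 5; 13; 2; 8; 58; 58; 19; 58; 13; 24; 8; 58; 58; 58; 33; 58; 47; 58; 58; 5; 21; 2;
  10; 50; 8; 58; 58; 19; 58; 58; 58; 39; 58; 58; 32; 58; 37; 47; 58; 58; 58; 4; 5; 15; 7; 58;
  28; 7; 58; 13; 11; 17; 59; 58; 5; 12; 14; 17; 58; 2; 11; 7; 54; 54; 65; 11; 63; 32; 7; 58;
  13; 63; 63; 63; 24; 17; 58; 5; 15; 10; 50; 58; 30; 11; 12; 58; 21; 58; 58; 58; 4; 5; 28; 11;
  58; 32; 58; 17; 11; 59; 58; 5; 38; 15; 58; 32; 58; 17; 6; 58; 5; 19; 10; 50; 2; 58; 38; 45;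
  15; 58; 19; 6; 2; 58; 3; 4; 5; 7; 10; 15; 58; 43; 10; 58; 29; 7; 58; 59; 7; 58; 59; 49; 7;
  87; 7; 58; 59; 5; 47; 58; 47; 58; 29; 58; 58; 17; 47; 7; 83; 58; 5; 17; 10; 50; 58; 33; 15;
  58; 58; 58; 8; 17; 47; 7; 83; 58; 58; 58; 4; 5; 15; 7; 20; 51; 51; 58; 28; 38; 58; 49; 6; 6;
  7; 47; 58; 59; 5; 12; 11; 2; 7; 58; 7; 11; 54; 48; 2; 10; 54; 54; 54; 58; 11; 2; 65; 63; 63;
  12; 14; 17; 7; 58; 5; 15; 2; 10; 6; 50; 50; 50; 58; 15; 7; 12; 47; 58; 7; 47; 11; 28; 58; 4;
  5; 35; 15; 58; 10; 58; 17; 11; 59; 7; 58; 5; 47; 58; 47; 58; 36; 44; 58; 5; 23; 10; 50; 47;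
  58; 22; 44; 58; 6; 58; 58; 17; 47; 86; 1; 3; 4; 5; 9; 10; 11; 7; 51; 7; 24; 10; 7; 66; 26;
  27; 8; 59; 59; 59; 5; 38; 18; 2; 50; 50; 50; 10; 42; 7; 66; 12; 2; 5; 19; 20; 50; 24; 7; 66;
  10; 4; 5; 14; 33; 51; 7; 30; 31; 7; 66; 34; 11; 59; 5; 38; 36; 2; 50; 50; 50; 2; 2; 35; 10;
  2; 7; 54; 54; 65; 63; 63; 7; 66; 54; 2; 65; 63; 63; 2; 7; 54; 54; 65; 63; 63; 12; 11; 2; 5;
  19; 20; 14; 50; 29; 24; 66; 20; 4; 5; 6; 12; 39; 50; 55; 20; 50; 12; 24; 39; 7; 66; 17; 47;
  11; 59; 5; 38; 47; 2; 50; 55; 50; 24; 30; 7; 66; 17; 12; 5; 15; 2; 55; 26; 2; 50; 55; 50; 2;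
  17; 26; 6; 55; 85; 24; 14; 12; 92; 21; 14; 2; 85; 3; 4; 5; 18; 14; 51; 7; 51; 19; 8; 7; 56;
  56; 56; 10; 56; 56; 56; 7; 56; 56; 56; 7; 62; 56; 56; 7; 56; 56; 56; 14; 10; 10; 18; 10; 91;
  14; 26; 59; 26; 59; 26; 11; 59; 62; 5; 18; 27; 7; 50; 7; 50; 7; 50; 27; 24; 7; 66; 12; 14; 5;
  21; 10; 19; 50; 50; 50; 39; 24; 7; 66; 10; 11; 4; 5; 15; 7; 51; 7; 30; 31; 7; 66; 18; 11; 17;
  59; 5; 12; 50; 29; 38; 19; 50; 2; 50; 42; 18; 2; 7; 54; 54; 65; 63; 63; 2; 7; 54; 54; 65; 63;
  63; 7; 66; 54; 2; 65; 63; 63; 12; 14; 17; 5; 19; 20; 14; 50; 29; 7; 66; 21; 4; 5; 9; 7; 11;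
  7; 51; 18; 49; 7; 66; 17; 11; 18; 59; 5; 18; 38; 2; 50; 50; 50; 24; 7; 66; 33; 2; 5; 19; 20;
  50; 2; 14; 30; 7; 66; 21; 2; 3; 4; 5; 8; 10; 11; 7; 51; 7; 43; 10; 7; 6; 66; 66; 66; 10; 59;
  26; 7; 83; 59; 59; 5; 18; 38; 17; 50; 50; 50; 18; 7; 6; 66; 66; 66; 28; 22; 10; 83; 5; 20;
  26; 50; 7; 10; 6; 66; 66; 66; 28; 8; 10; 89; 4; 5; 14; 15; 18; 51; 51; 51; 6; 7; 6; 31; 7; 6;
  66; 66; 66; 18; 50; 50; 50; 27; 7; 6; 21; 50; 7; 50; 7; 53; 53; 74; 7; 6; 5; 6; 7; 10; 52;
  20; 52; 2; 35; 17; 52; 52; 52; 20; 2; 12; 52; 52; 52; 12; 50; 50; 50; 12; 50; 50; 50; 2; 2;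
  10; 50; 2; 7; 52; 52; 52; 7; 7; 14; 50; 2; 15; 35; 17; 65; 65; 65; 34; 10; 54; 54; 54; 34; 6;
  66; 66; 66; 35; 7; 6; 66; 66; 66; 17; 63; 63; 63; 35; 7; 6; 66; 66; 66; 17; 63; 63; 63; 6; 7;
  10; 52; 20; 52; 2; 35; 17; 52; 52; 52; 10; 50; 2; 7; 52; 52; 52; 7; 7; 14; 50; 41; 50; 2; 7;
  53; 53; 53; 7; 7; 14; 50; 5; 20; 14; 6; 50; 50; 50; 6; 31; 14; 18; 50; 50; 50; 6; 66; 66; 66;
  6; 20; 7; 50; 20; 50; 16; 7; 76; 53; 53; 7; 7; 4; 5; 6; 7; 11; 7; 51; 7; 10; 7; 6; 66; 66;
  66; 17; 11; 18; 59; 6; 5; 18; 38; 17; 50; 50; 50; 10; 7; 6; 66; 66; 66; 33; 6; 5; 23; 20; 50;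
  7; 18; 6; 22; 35; 7; 6; 66; 66; 66; 6; 7; 7; 33; 16; 90].

End StarData.

(** * Checks of the data by computation *)

Definition code_relation (c : nat * ((nat * nat) * (nat * nat))) :=
  relation_terms c.1 c.2.1.1 c.2.1.2 c.2.2.1 c.2.2.2.

(** An empty row marks a coordinate not yet expressed; a two-term relation containing one such
    coordinate gives its row from the other three. *)
Definition elimination_step (rows : seq zvec) c : seq zvec :=
  let r k := nth [::] rows k in
  let solve x a b y := set_nth [::] rows x (zcomb 1 (zcomb 1 (r a) 1 (r b)) (-1) (r y)) in
  if code_relation c is [:: (_, (x1, x2)); (_, (y1, y2))] then
    if nilp (r x1) then solve x1 y1 y2 x2 else
    if nilp (r x2) then solve x2 y1 y2 x1 else
    if nilp (r y1) then solve y1 x1 x2 y2 else solve y2 x1 x2 y1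
  else rows.

Definition star_rows : seq zvec := Eval vm_compute in
  foldl elimination_step
    [seq if b \in star_frame then nseq 10 0%BZ
         else if b \in star_free then [seq if i == index b star_free then 1%BZ else 0%BZ | i <- iota 0 10]
         else [::] | b <- iota 0 110]
    star_elimination.

Definition star_incidence : seq zvec := Eval vm_compute in
  [seq [seq if i \in t then 1%BZ else 0%BZ | i <- iota 0 10] | t <- star_triples].

Definition star_canonical : seq (seq zvec) := Eval vm_compute in
  canonical_triples star_rows star_relations.

Definition as_triple (s : seq zvec) := (nth [::] s 0, nth [::] s 1, nth [::] s 2).

Fact star_canonicalE :
  star_canonical = canonical_triples star_rows star_relations.
Proof. by vm_compute. Qed.

(** The fuel 100 bounds the depth of the search tree, and the answer [Some [::]] says that the codes
    are used up exactly. *)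
Fact star_explore :
  explore [seq as_triple s | s <- star_canonical] star_rays star_leaves 100
    (unit_vectors 10, [::]) star_codes = Some [::].
Proof. by vm_compute. Qed.

Definition star_maximal : seq (seq nat) := [seq unzip1 c | c <- star_leaves].

Fact star_relations_ok : all (relation_ok 110 star_rows star_incidence) star_relations.
Proof. by vm_compute. Qed.

Fact star_rows_sizes :
  [/\ size star_rows = 110%N, all (fun g => size g == 10%N) star_rows
    & all (fun g => size g == 10%N) star_incidence].
Proof. by vm_compute. Qed.

Fact star_canonical_sizes :
  all (fun s => (size s == 3%N) && uniq s && all (fun g => size g == 10%N) s) star_canonical.
Proof. by vm_compute. Qed.

Fact star_maximal_ok : all (fun c => sorted ltn c && all (fun i => i < size star_rays)%N c
  && all (fun s => 1 < count (cone_min star_rays s c) s)%N star_canonical) star_maximal.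
Proof. by vm_compute. Qed.

Fact star_patterns_ok : let pats := [seq ray_pattern star_canonical r | r <- star_rays] in
  all (fun sigma => let b := cone_pattern star_canonical pats sigma in
    all (fun j => (j \in sigma) || separated pats b j) (iota 0 (size star_rays)))
    (faces_of star_maximal).
Proof. by vm_compute. Qed.

Fact star_frame_ok :
  [&& size frame_inverse == size star_frame, all (fun i => i < 110)%N (star_frame ++ star_free),
      [seq nth [::] star_rows i | i <- star_frame] == nseq (size star_frame) (nseq 10 0%BZ),
      [seq nth [::] star_rows i | i <- star_free] == unit_vectors 10 &
      [seq [seq zdot (nth [::] star_incidence i) c | c <- frame_inverse] | i <- star_frame] ==
      [seq [seq if j == k then 3%BZ else 0%BZ | k <- iota 0 (size star_frame)]
        | j <- iota 0 (size star_frame)]].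
Proof. by vm_compute. Qed.

Definition star_eliminations := [seq code_relation c | c <- star_elimination].

Fact star_eliminated :
  all (fun i => i \in eliminated (star_frame ++ star_free) star_eliminations) (iota 0 110).
Proof. by vm_compute. Qed.

Definition code_valid (c : nat * ((nat * nat) * (nat * nat))) : bool :=
  [&& (c.1 < 10)%N, c.1 \notin [:: c.2.1.1; c.2.1.2; c.2.2.1; c.2.2.2]
    & [&& c.2.1.1 < c.2.1.2, c.2.1.2 < c.2.2.1, c.2.2.1 < c.2.2.2 & c.2.2.2 < 10]%N].

Lemma code_relation_mem c : code_valid c -> code_relation c \in star_relations.
Proof.
move=> /and3P[c10 cn cq]; apply/allpairsPdep; exists c.1, c.2.
split; [by rewrite mem_iota | | by []].
by rewrite mem_filter cn mem_star_quadruples.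
Qed.

Fact star_eliminations_ok :
  all (fun T => (T \in star_relations) && (size T == 2%N)) star_eliminations.
Proof.
have h : all (fun c => code_valid c && (size (code_relation c) == 2%N)) star_elimination by vm_compute.
by apply/allP => _ /mapP[c /(allP h)/andP[cv c2] ->]; rewrite c2 code_relation_mem.
Qed.

Fact star_faces_count : [/\ count (fun s => size s == 1%N) (faces_of star_maximal) = 30%N,
  count (fun s => size s == 2%N) (faces_of star_maximal) = 65%N,
  count (fun s => size s == 3%N) (faces_of star_maximal) = 20%N,
  all (fun s => size s <= 3)%N (faces_of star_maximal) &
  [::] \in faces_of star_maximal].
Proof. by vm_compute. Qed.

(** * The Dressian *)

Section StarDressian.
Variable R : realType.
Local Notation Delta := (faces_of star_maximal).

Definition star_lineality : {vspace weight R (basis M_star)} :=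
  embed_span bvar 110 10 star_rows star_incidence R.

Definition star_ray : nat -> weight R (basis M_star) :=
  embed_ray bvar 110 10 star_rows star_incidence star_rays R.

Lemma star_sizes : all (fun s => (size s == 3%N) && uniq s && all (fun g => size g == 10%N) s)
  (canonical_triples star_rows star_relations).
Proof. by rewrite -star_canonicalE star_canonical_sizes. Qed.

Lemma star_maximals : all (fun c => sorted ltn c && all (fun i => i < size star_rays)%N c
  && all (fun s => 1 < count (cone_min star_rays s c) s)%N
       (canonical_triples star_rows star_relations)) star_maximal.
Proof. by rewrite -star_canonicalE star_maximal_ok. Qed.

Lemma star_patterns : let pats := [seq ray_pattern (canonical_triples star_rows star_relations) r
    | r <- star_rays] in
  all (fun sigma => let b := cone_pattern (canonical_triples star_rows star_relations) pats sigma in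
    all (fun j => (j \in sigma) || separated pats b j) (iota 0 (size star_rays)))
    (faces_of star_maximal).
Proof. by rewrite -star_canonicalE star_patterns_ok. Qed.

Lemma star_nil : [::] \in Delta.
Proof. by have [] := star_faces_count. Qed.

Lemma star_cones_cover (q : 'rV[R]_10) :
  (forall s, s \in canonical_triples star_rows star_relations -> min_twice s q) ->
  exists2 c, c \in star_maximal & in_cone star_rays c q.
Proof.
rewrite -star_canonicalE => h.
have sz : all (fun t : zvec * zvec * zvec =>
    let: (a, b, c) := t in [&& size a == 10%N, size b == 10%N & size c == 10%N])
    [seq as_triple s | s <- star_canonical] by vm_compute.
have [|c hc] := explore_covers sz star_explore (q := q).
  move=> _ /mapP[s sc ->]; have /andP[/andP[/eqP s3 _] _] := allP star_canonical_sizes _ sc.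
  move: (h s sc); case: s s3 {sc} => [|a [|b [|c []]]] //= _.
  exact: min_twice_vanishes.
have [c45|c45] := ltnP c (size star_leaves).
  by exists (unzip1 (nth [::] star_leaves c)) => //; apply: map_f; apply: mem_nth.
(* An index beyond the leaves denotes the cone without rays, so [q] is zero and lies in the first
   leaf as well. *)
move: hc; rewrite nth_default //= => -[lam _ ->]; exists (unzip1 (nth [::] star_leaves 0)).
  exact: (map_f _ (mem_nth [::] (isT : (0 < size star_leaves)%N))).
by exists (fun=> 0) => //; rewrite big_nil big1 // => i _; rewrite scale0r.
Qed.

Variables (K : fieldType) (v : valuation R K).

Lemma star_trop_embed w : trop_intersection v [set relation_poly bvar K T | T in [set` star_relations]] w ->
  exists u q : 'rV[R]_10, w = embed bvar 110 star_rows star_incidence u q.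
Proof.
have [h1 h2 h3] := star_rows_sizes.
apply: (trop_intersection_sub_embed bvar_inj bvar_surj star_relations_ok h3 star_frame_ok
  star_eliminations_ok star_eliminated).
Qed.

Lemma star_relint w : dressian v M_star w <->
  exists2 sigma, sigma \in Delta & ray_relint star_lineality star_ray sigma w.
Proof.
have [h1 h2 h3] := star_rows_sizes; rewrite /dressian three_term_relations_star.
have H := (trop_intersection_relint bvar_inj bvar_surj star_relations_ok h1 h2 star_sizes star_maximals
  star_patterns (@star_trop_embed) (@star_cones_cover)).
exact: H.
Qed.

Lemma star_fanE : dressian_fan v M_star = ray_fan star_lineality star_ray Delta.
Proof.
have [h1 h2 h3] := star_rows_sizes; rewrite /dressian_fan three_term_relations_star.
exact: (relation_fanE bvar_inj bvar_surj star_relations_ok h1 h2 star_sizes star_maximals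
  star_patterns (@star_trop_embed) (@star_cones_cover)).
Qed.

Lemma star_relint_inj sigma tau w : sigma \in Delta -> tau \in Delta ->
  ray_relint star_lineality star_ray sigma w -> ray_relint star_lineality star_ray tau w -> sigma = tau.
Proof.
exact: (relint_embed_unique bvar_inj bvar_surj star_relations_ok star_sizes star_maximals star_patterns v).
Qed.

Lemma star_relint_pointed sigma tau w : sigma \in Delta -> tau \in Delta ->
  ray_relint star_lineality star_ray sigma w -> ray_relint star_lineality star_ray tau (- w) ->
  w \in star_lineality.
Proof.
have [h1 h2 h3] := star_rows_sizes.
exact: (relint_embed_pointed bvar_inj bvar_surj star_relations_ok h1 h2 star_sizes star_maximals
  star_patterns star_nil (@star_trop_embed) (@star_cones_cover)).
Qed.

End StarDressian.

Section StarDressianFan.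
Variables (R : realType) (K : fieldType) (v : valuation R K).
Local Notation Delta := (faces_of star_maximal).
Local Open Scope card_scope.

Lemma star_faces_sorted sigma : sigma \in Delta -> sorted ltn sigma.
Proof. exact: Delta_sortedP star_maximal_ok _. Qed.

Lemma dressian_fan_star : let F := dressian_fan v M_star in
  [/\ polyhedral_fan F, fan_support F = dressian v M_star & complex_dim F 2] /\
  [/\ cells F 0 #= `I_30, cells F 1 #= `I_65 & cells F 2 #= `I_20] /\
  (forall C, cells F 1 C -> vertices_of F C #= `I_2) /\
  (forall C, cells F 2 C -> vertices_of F C #= `I_3).
Proof.
have uD : uniq Delta by apply: undup_uniq.
have fD sigma p : sigma \in Delta -> filter p sigma \in Delta by apply: faces_of_filter.
have iD := @star_relint_inj R K v; have pD := @star_relint_pointed R K v.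
have [c1 c2 c3 c4 nD] := star_faces_count.
move=> F; rewrite /F star_fanE; split; [split|split; [|split]].
- exact: ray_fanP star_faces_sorted fD iD.
- apply/seteqP; split=> w.
    by move/(fan_support_relint _ _ fD)/star_relint.
  by move/star_relint/(fan_support_relint _ _ fD).
- apply: (complex_dim_ray_fan star_faces_sorted fD iD pD nD); last exact: c4.
  by rewrite has_count c3.
- split.
  + by have := card_cells_ray_fan uD star_faces_sorted fD iD pD nD 0; rewrite c1.
  + by have := card_cells_ray_fan uD star_faces_sorted fD iD pD nD 1; rewrite c2.
  + by have := card_cells_ray_fan uD star_faces_sorted fD iD pD nD 2; rewrite c3.
- by move=> C; apply: (card_vertices_of star_faces_sorted fD iD pD nD).
- by move=> C; apply: (card_vertices_of star_faces_sorted fD iD pD nD).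
Qed.

End StarDressianFan.

(** * Computing modulo an ideal of Laurent polynomials *)

Section LaurentIdeals.
Variables (K : fieldType) (I : finType) (G : set (laurent K I)).
Local Notation mon := {ffun I -> int}.
Implicit Types (f g h : laurent K I) (a b : mon).
Local Notation J := (laurent_ideal G).

Lemma laurent_ind (P : laurent K I -> Prop) :
  P 0 -> (forall c a, P << c *g a >>) -> (forall f g, P f -> P g -> P (f + g)) -> forall f, P f.
Proof. by move=> P0 PU PD f; rewrite (monalgE f); apply: big_ind => // a _; apply: PU. Qed.

Lemma laurent_mulUA (c : K) a f g :
  laurent_mul << c *g a >> (laurent_mul f g) = laurent_mul (laurent_mul << c *g a >> f) g.
Proof.
elim/laurent_ind: f => [|d b|f f' IH IH']; first by rewrite laurent_mul0l !laurent_mul0 laurent_mul0l.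
  elim/laurent_ind: g => [|e m|g g' IH IH']; first by rewrite !laurent_mul0.
    by rewrite !laurent_mulUU mulrA addrA.
  by rewrite !laurent_mulDr IH IH'.
by rewrite laurent_mulDl !laurent_mulDr laurent_mulDl IH IH'.
Qed.

Lemma laurent_mulU0 f : laurent_mul << 0 >> f = f.
Proof.
elim/laurent_ind: f => [|d b|f f' IH IH']; first by rewrite laurent_mul0.
  by rewrite laurent_mulUU mul1r add0r.
by rewrite laurent_mulDr IH IH'.
Qed.

Lemma malgUN (c : K) a : << - c *g a >> = - << c *g a >> :> laurent K I.
Proof. by apply/malgP => b; rewrite mcoeffN !mcoeffU mulNrn. Qed.

Lemma laurent_mulN1 f : laurent_mul << -1 *g 0 >> f = - f.
Proof.
elim/laurent_ind: f => [|d b|f f' IH IH']; first by rewrite laurent_mul0 oppr0.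
  by rewrite laurent_mulUU mulN1r add0r malgUN.
by rewrite laurent_mulDr IH IH' opprD.
Qed.

Lemma laurent_ideal0 : J 0.
Proof. by exists [::]; rewrite ?big_nil. Qed.

Lemma laurent_idealD f g : J f -> J g -> J (f + g).
Proof.
move=> [s sG ->] [t tG ->]; exists (s ++ t); last by rewrite big_cat.
by move=> hg; rewrite mem_cat => /orP[/sG|/tG].
Qed.

Lemma laurent_ideal_mul (c : K) a f : J f -> J (laurent_mul << c *g a >> f).
Proof.
move=> [s sG ->]; exists [seq (laurent_mul << c *g a >> hg.1, hg.2) | hg <- s].
  by move=> _ /mapP[hg /sG hG ->].
by rewrite laurent_mul_sumr big_map; apply: eq_bigr => hg _; rewrite laurent_mulUA.
Qed.

Lemma laurent_ideal_gen f : G f -> J f.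
Proof.
move=> Gf; exists [:: (<< 0 >>, f)]; last by rewrite big_seq1 laurent_mulU0.
by move=> hg; rewrite inE => /eqP->.
Qed.

Lemma laurent_idealN f : J f -> J (- f).
Proof.
by move/(laurent_ideal_mul (-1) 0); rewrite laurent_mulN1.
Qed.

(* The pairs (a, s) with p^a = (-1)^s modulo the ideal form a group. *)
Definition sign_modulo a (s : bool) : Prop := J (<< a >> - << (-1) ^+ s *g 0 >>).

Lemma laurent_mulUB (c : K) a f g :
  laurent_mul << c *g a >> (f - g) = laurent_mul << c *g a >> f - laurent_mul << c *g a >> g.
Proof.
by rewrite laurent_mulDr -laurent_mulN1 laurent_mulUA laurent_mulUU addr0 mulrN1 malgUN
  -[X in laurent_mul X g]laurent_mulN1 -laurent_mulUA laurent_mulN1.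
Qed.

Lemma sign_moduloD a b s t : sign_modulo a s -> sign_modulo b t -> sign_modulo (a + b) (s (+) t).
Proof.
move=> /(laurent_ideal_mul 1 b) h1 /(laurent_ideal_mul ((-1) ^+ s) 0) h2.
have := laurent_idealD h1 h2; rewrite /sign_modulo !laurent_mulUB !laurent_mulUU.
by rewrite !mul1r !addr0 !add0r mulr1 signr_addb (addrC b a) addrA subrK.
Qed.

Lemma sign_moduloN a s : sign_modulo a s -> sign_modulo (- a) s.
Proof.
move=> /(laurent_ideal_mul ((-1) ^+ s) (- a)) /laurent_idealN.
rewrite /sign_modulo laurent_mulUB !laurent_mulUU addNr addr0 mulr1 opprB.
by rewrite -signr_addb addbb.
Qed.

Lemma sign_modulo0 : sign_modulo 0 false.
Proof. by rewrite /sign_modulo expr0 subrr; apply: laurent_ideal0. Qed.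

Lemma sign_moduloB a b s t : sign_modulo a s -> sign_modulo b t -> sign_modulo (a - b) (s (+) t).
Proof. by move=> ha /sign_moduloN; apply: sign_moduloD. Qed.

Lemma sign_modulo_sub a b s (c : K) : sign_modulo (a - b) s ->
  J (<< c *g a >> - << c * (-1) ^+ s *g b >>).
Proof.
move/(laurent_ideal_mul c b); rewrite laurent_mulUB !laurent_mulUU.
by rewrite mulr1 addr0 (addrC b) subrK.
Qed.

(** Allows each term of an element of the ideal to be replaced by its normal form. *)
Lemma laurent_ideal_sumB (T : eqType) (r : seq T) (F H : T -> laurent K I) :
  (forall t, t \in r -> J (F t - H t)) -> J (\sum_(t <- r) F t) -> J (\sum_(t <- r) H t).
Proof.
move=> h hF; have -> : \sum_(t <- r) H t = \sum_(t <- r) F t - \sum_(t <- r) (F t - H t).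
  by rewrite sumrB opprB addrC subrK.
apply: laurent_idealD => //; apply: laurent_idealN.
elim: r h {hF} => [|t r IH] h; first by rewrite big_nil; apply: laurent_ideal0.
rewrite big_cons; apply: laurent_idealD; first by apply: h; rewrite mem_head.
by apply: IH => s sr; apply: h; rewrite inE sr orbT.
Qed.

End LaurentIdeals.

Lemma addr_solve (V : zmodType) (a b c d x y z : V) :
  a + b - (c + d) + (c - y + (d - z) - (b - x)) = a - (y + z - x).
Proof.
rewrite [c - y + _]addrACA -opprD addrA addrA subrK !opprB.
by rewrite [x - b]addrC addrACA addrK [- _ + x]addrC.
Qed.

Lemma addr_normal (V : zmodType) (a b c x y : V) :
  c + (a + b) - (c + (x + y)) = a - x + (b - y).
Proof. by rewrite opprD addrACA subrr add0r opprD addrACA. Qed.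

(** * Normal forms of monomials modulo the two-term relations *)

Section NormalForms.
Local Notation term := (bool * (nat * nat))%type.
Local Notation entry := (bool * zvec)%type.

Fixpoint nf_lookup (tbl : seq (nat * entry)) (i : nat) : option entry :=
  if tbl is (j, e) :: tbl' then if i == j then Some e else nf_lookup tbl' i else None.

(** Solves a relation between two products for one variable. Bringing a product to the other side
    reverses its sign, whence the negation of [s], the combined sign of the two products. *)
Definition nf_solve (s : bool) (e1 e2 e3 : entry) : entry :=
  (~~ s (+) (e1.1 (+) e2.1 (+) e3.1), zcomb 1 (zcomb 1 e1.2 1 e2.2) (-1) e3.2).

Definition nf_step (tbl : seq (nat * entry)) (T : seq term) : seq (nat * entry) :=
  if T is [:: (s1, (a, b)); (s2, (c, d))] then
    match nf_lookup tbl a, nf_lookup tbl b, nf_lookup tbl c, nf_lookup tbl d with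
    | None, Some eb, Some ec, Some ed => (a, nf_solve (s1 (+) s2) ec ed eb) :: tbl
    | Some ea, None, Some ec, Some ed => (b, nf_solve (s1 (+) s2) ec ed ea) :: tbl
    | Some ea, Some eb, None, Some ed => (c, nf_solve (s1 (+) s2) ea eb ed) :: tbl
    | Some ea, Some eb, Some ec, None => (d, nf_solve (s1 (+) s2) ea eb ec) :: tbl
    | _, _, _, _ => tbl
    end
  else tbl.

(** Each seed is its own normal form; scanning the relations writes every variable reached as a sign
    times a Laurent monomial in the seeds. *)
Definition nf_table (seeds : seq nat) (es : seq (seq term)) : seq (nat * entry) :=
  foldl nf_step [seq (nth 0%N seeds k, (false, nth [::] (unit_vectors (size seeds)) k))
                | k <- iota 0 (size seeds)] es.

Definition nf_term (tbl : seq (nat * entry)) (c : entry) (t : term) : option entry :=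
  if nf_lookup tbl t.2.1 is Some e1 then
    if nf_lookup tbl t.2.2 is Some e2 then
      Some (c.1 (+) t.1 (+) (e1.1 (+) e2.1), zcomb 1 c.2 1 (zcomb 1 e1.2 1 e2.2))
    else None
  else None.

Variables (I : finType) (x : nat -> I) (rels : seq (seq term)) (seeds : seq nat).
Variable K : fieldType.
Let G : set (laurent K I) := [set relation_poly x K T | T in [set` rels]].
Local Notation J := (laurent_ideal G).
Local Notation expo := (expo x).

Definition zmono (e : zvec) : {ffun I -> int} :=
  \sum_(k < size seeds) expo (nth 0%N seeds k) *~ int_of_Z (nth 0%BZ e k).

Lemma zmono_comb a g b h : zmono (zcomb a g b h) = zmono g *~ int_of_Z a + zmono h *~ int_of_Z b.
Proof.
rewrite /zmono !mulrz_suml -big_split; apply: eq_bigr => k _ /=.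
rewrite nth_zcomb -!mulrzA -mulrzDr.
by rewrite (rmorphD int_of_Z) !(rmorphM int_of_Z) ![int_of_Z (nth _ _ _) * _]mulrC.
Qed.

Lemma zmono_unit k : (k < size seeds)%N ->
  zmono (nth [::] (unit_vectors (size seeds)) k) = expo (nth 0%N seeds k).
Proof.
move=> hk; rewrite /zmono (bigD1 (Ordinal hk)) //= big1 ?addr0 => [|j jk].
  by rewrite (nth_map 0%N) ?size_iota // nth_iota // (nth_map 0%N) ?size_iota // nth_iota // eqxx mulr1z.
rewrite (nth_map 0%N) ?size_iota // nth_iota // (nth_map 0%N) ?size_iota // nth_iota //.
by rewrite !add0n ifN ?mulr0z.
Qed.

Lemma zmono_nseq0 m : zmono (nseq m 0%BZ) = 0.
Proof. by rewrite /zmono big1 // => k _; rewrite nth_nseq if_same. Qed.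

Definition nf_valid (tbl : seq (nat * entry)) : Prop :=
  forall i e, nf_lookup tbl i = Some e -> sign_modulo G (expo i - zmono e.2) e.1.

(** Multiplying the relation by the inverse of its second product leaves the quotient of the
    products and a constant sign. *)
Lemma binomial_sign_modulo s1 a b s2 c d : [:: (s1, (a, b)); (s2, (c, d))] \in rels ->
  sign_modulo G (expo a + expo b - (expo c + expo d)) (~~ (s1 (+) s2)).
Proof.
move=> hT; have /laurent_ideal_gen : G (relation_poly x K [:: (s1, (a, b)); (s2, (c, d))]).
  by exists [:: (s1, (a, b)); (s2, (c, d))].
move/(laurent_ideal_mul ((-1) ^+ s1) (- (expo c + expo d))).
rewrite /relation_poly /signed_sum !big_cons big_nil addr0 laurent_mulDr !laurent_mulUU /=.
rewrite /term_mono /= -!signr_addb addbb addNr [- _ + _]addrC expr0.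
by rewrite /sign_modulo signrN malgUN opprK.
Qed.

Lemma zmono_solve s e1 e2 e3 : zmono (nf_solve s e1 e2 e3).2 = zmono e1.2 + zmono e2.2 - zmono e3.2.
Proof. by rewrite !zmono_comb !mulr1z mulrN1z. Qed.

Lemma nf_solve_valid s a b c d eb ec ed :
  sign_modulo G (expo a + expo b - (expo c + expo d)) (~~ s) ->
  sign_modulo G (expo b - zmono eb.2) eb.1 -> sign_modulo G (expo c - zmono ec.2) ec.1 ->
  sign_modulo G (expo d - zmono ed.2) ed.1 ->
  sign_modulo G (expo a - zmono (nf_solve s ec ed eb).2) (nf_solve s ec ed eb).1.
Proof.
move=> h hb hc hd; have := sign_moduloD h (sign_moduloB (sign_moduloD hc hd) hb).
rewrite zmono_solve addr_solve => hs; exact: hs.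
Qed.

Lemma sign_modulo_opp a b s : sign_modulo G (a - b) s -> sign_modulo G (b - a) s.
Proof. by move/sign_moduloN; rewrite opprB. Qed.

Lemma nf_step_valid tbl T : T \in rels -> nf_valid tbl -> nf_valid (nf_step tbl T).
Proof.
move=> hT hv; case: T hT => [|[s1 [a b]] [|[s2 [c d]] []]] // /binomial_sign_modulo h /=.
have cons_valid i e : sign_modulo G (expo i - zmono e.2) e.1 -> nf_valid ((i, e) :: tbl).
  by move=> he j e' /=; case: eqP => [-> [<-]|_ /hv].
case ha: (nf_lookup tbl a) => [ea|]; case hb: (nf_lookup tbl b) => [eb|];
  case hc: (nf_lookup tbl c) => [ec|]; case hd: (nf_lookup tbl d) => [ed|];
  try exact: hv; apply: cons_valid.
- have h' : sign_modulo G (expo d + expo c - (expo a + expo b)) (~~ (s1 (+) s2)).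
    by rewrite (addrC (expo d)); apply: sign_modulo_opp.
  exact: (@nf_solve_valid (s1 (+) s2) d c a b ec ea eb h' (hv _ _ hc) (hv _ _ ha) (hv _ _ hb)).
- have h' : sign_modulo G (expo c + expo d - (expo a + expo b)) (~~ (s1 (+) s2)).
    exact: sign_modulo_opp.
  exact: (@nf_solve_valid (s1 (+) s2) c d a b ed ea eb h' (hv _ _ hd) (hv _ _ ha) (hv _ _ hb)).
- have h' : sign_modulo G (expo b + expo a - (expo c + expo d)) (~~ (s1 (+) s2)).
    by rewrite (addrC (expo b)).
  exact: (@nf_solve_valid (s1 (+) s2) b a c d ea ec ed h' (hv _ _ ha) (hv _ _ hc) (hv _ _ hd)).
- exact: (@nf_solve_valid (s1 (+) s2) a b c d eb ec ed h (hv _ _ hb) (hv _ _ hc) (hv _ _ hd)).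
Qed.

Lemma nf_table_valid es : {subset es <= rels} -> nf_valid (nf_table seeds es).
Proof.
move=> sub; rewrite /nf_table.
have : nf_valid [seq (nth 0%N seeds k, (false, nth [::] (unit_vectors (size seeds)) k))
                | k <- iota 0 (size seeds)].
  have : {subset iota 0 (size seeds) <= iota 0 (size seeds)} by [].
  elim: {1 3}(iota 0 (size seeds)) => [|k r IH] //= ks i e /=.
  case: eqP => [-> [<-]|_ /IH]; last by apply=> j jr; apply: ks; rewrite inE jr orbT.
  have := ks k (mem_head _ _); rewrite mem_iota => hk.
  by rewrite zmono_unit // subrr; apply: sign_modulo0.
move: [seq _ | k <- _]; elim: es sub => [|T es IH] sub tbl hv //=.
apply: IH => [T' hT'|]; first by apply: sub; rewrite inE hT' orbT.
by apply: nf_step_valid hv; apply: sub; rewrite mem_head.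
Qed.

(* A certificate is a list of signed monomials times relations whose normal
   forms add up to the target after cancelling pairs of opposite terms. *)
Lemma certificate_mem es (cert : seq (entry * seq term)) (target cancelled : seq entry) :
  {subset es <= rels} -> all (fun c => c.2 \in rels) cert ->
  perm_eq (flatten [seq pmap (nf_term (nf_table seeds es) c.1) c.2 | c <- cert])
    (target ++ [seq (false, e.2) | e <- cancelled] ++ [seq (true, e.2) | e <- cancelled]) ->
  all (fun c => all (fun t => nf_term (nf_table seeds es) c.1 t != None) c.2) cert ->
  J (\sum_(t <- target) << (-1) ^+ t.1 *g zmono t.2 >>).
Proof.
move=> sub crels pe def.
pose F (e : entry) : laurent K I := << (-1) ^+ e.1 *g zmono e.2 >>.
have tv := nf_table_valid sub.
suff : J (\sum_(t <- flatten [seq pmap (nf_term (nf_table seeds es) c.1) c.2 | c <- cert]) F t).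
  rewrite (perm_big _ pe) big_cat /= [X in _ + X](_ : _ = 0) ?addr0 //.
  rewrite big_cat /= !big_map; apply/eqP; rewrite addr_eq0 -sumrN; apply/eqP/eq_bigr => e _.
  by rewrite /F /= expr0 expr1 malgUN opprK.
elim: cert crels def {pe} => [|[c T] cert IH] /=; first by rewrite big_nil; move=> _ _; apply: laurent_ideal0.
move=> /andP[hT crels] /andP[defT def]; rewrite big_cat /=.
apply: laurent_idealD; last exact: IH.
have hJ : J (laurent_mul << (-1) ^+ c.1 *g zmono c.2 >> (relation_poly x K T)).
  by apply/laurent_ideal_mul/laurent_ideal_gen; exists T.
move: hJ; rewrite /relation_poly /signed_sum laurent_mul_sumr big_map => hJ.
pose H t := odflt 0 (omap F (nf_term (nf_table seeds es) c t)).
have -> : \sum_(e <- pmap (nf_term (nf_table seeds es) c) T) F e = \sum_(t <- T) H t.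
  elim: T {hT hJ} defT => [|t T IHT] /=; first by rewrite !big_nil.
  case/andP => dt /IHT E; rewrite big_cons -E /H.
  by case: (nf_term _ _ t) dt => [e|] //= _; rewrite big_cons.
apply: laurent_ideal_sumB hJ => t tT; have := allP defT t tT.
rewrite /H /nf_term laurent_mulUU; case h1: nf_lookup => [e1|] //; case h2: nf_lookup => [e2|] // _ /=.
have hs := sign_moduloD (tv _ _ h1) (tv _ _ h2).
move: hs; rewrite /F /= zmono_comb zmono_comb !mulr1z.
rewrite /term_mono.
move: (zmono c.2) (zmono e1.2) (zmono e2.2) (expo t.2.1) (expo t.2.2) => C X Y A B hs.
have hs' : sign_modulo G (C + (A + B) - (C + (X + Y))) (e1.1 (+) e2.1).
  by rewrite addr_normal; exact: hs.
have := sign_modulo_sub ((-1) ^+ c.1 * (-1) ^+ t.1) hs'.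
by rewrite -!signr_addb.
Qed.

End NormalForms.

(** * A dominating constant term, and values of integers *)

Section UniqueMinimum.
Variables (R : realType) (K : fieldType) (v : valuation R K) (I : finType).

(** The constant has value 0 and all other terms are positive at [w]. If [a] and [b] coincide the
    monomials cancel, which leaves the constant alone. *)
Lemma unique_min_binomial (a b : {ffun I -> int}) (w : weight R I) :
  (2 : K) != 0 -> v 2 = 0 -> 0 < monval w a -> 0 < monval w b ->
  ~ trop_hypersurface v (<< 2 *g 0 >> + << a >> - << b >>) w.
Proof.
move=> n2 v2 wa wb h; set f := _ - _ in h.
have w0 : monval w 0 = 0 by rewrite /monval big1 // => i _; rewrite ffunE mul0r.
have fE c : f@_c = 2 *+ (0 == c) + 1 *+ (a == c) - 1 *+ (b == c).
  by rewrite /f mcoeffB mcoeffD !mcoeffU.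
have a0 : (a == 0) = false by apply: contraTF wa => /eqP->; rewrite w0 ltxx.
have b0 : (b == 0) = false by apply: contraTF wb => /eqP->; rewrite w0 ltxx.
have f0 : f@_0 = 2 by rewrite fE eqxx a0 b0 subr0 addr0.
have t0 : trop_term v f w 0 = 0 by rewrite trop_termE f0 v2 w0 addr0.
have tpos c : c \in msupp f -> c != 0 -> 0 < trop_term v f w c.
  rewrite -mcoeff_neq0 trop_termE fE [0 == c]eq_sym => + /negPf c0; rewrite c0 add0r.
  case: (eqVneq a c) => [<-|ac]; case: (eqVneq b _) => [bc|bc] //=; rewrite ?subrr ?eqxx //.
  - by rewrite subr0 valuation1 add0r.
  - by rewrite sub0r valuationN valuation1 add0r -bc.
have m0 : min_terms v f w 0.
  split=> [|c cf]; first by rewrite -mcoeff_neq0 f0.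
  by have [->//|c0] := eqVneq c 0; rewrite t0 ltW // tpos.
have [c c0 [cf cmin]] := h 0 m0.
by have := cmin 0 m0.1; rewrite t0 leNgt tpos.
Qed.

Lemma sum_target (A : Type) (phi : A -> {ffun I -> int}) (z a b : A) :
  \sum_(t <- [:: (false, z); (false, z); (false, a); (true, b)]) << (-1) ^+ t.1 *g phi t.2 >> =
  << 2 *g phi z >> + << phi a >> - << phi b >> :> laurent K I.
Proof.
have <- : << phi z >> + << phi z >> = << 2 *g phi z >> :> laurent K I.
  by apply/malgP => k; rewrite mcoeffD !mcoeffU -mulrnDl.
by rewrite unlock /= expr0 expr1 malgUN addr0 !addrA.
Qed.

(** Being nonzero in the residue field puts [p] outside the maximal ideal, so its value is at most
    0; integers lie in the valuation ring, so it is at least 0. *)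
Lemma residue_char0_prime p : residue_char0 v -> prime p -> p%:R != 0 :> K /\ v p%:R = 0.
Proof.
move=> rc pp; have : p \notin [pchar {ideal_quot (@maxideal R K v)}] by rewrite rc.
rewrite inE pp /=; pose x : valring v := p%:R.
have piD m : (m%:R : {ideal_quot (@maxideal R K v)}) =
    \pi_({ideal_quot (@maxideal R K v)})%qT (m%:R : valring v).
  by rewrite rmorph_nat.
have xE : val x = p%:R by rewrite rmorph_nat.
have -> : (p%:R == 0 :> {ideal_quot (@maxideal R K v)}) = (x \in @maxideal R K v).
  by rewrite -[x]subr0 Quotient.idealrBE piD -(rmorph0 \pi_({ideal_quot (@maxideal R K v)})%qT).
rewrite unfold_in xE negb_or => /andP[p0]; rewrite -leNgt => vp.
split=> //; apply/eqP; rewrite eq_le vp /=.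
have : val x \in valring_pred v := valP x.
by rewrite xE unfold_in (negPf p0).
Qed.

Lemma residue_char0_nat (n : nat) : residue_char0 v -> (0 < n)%N ->
  n%:R != 0 :> K /\ v n%:R = 0.
Proof.
move=> rc; elim/ltn_ind: n => n IH n0; have [n1|n1] := leqP n 1.
  by have -> : n = 1%N by [apply/eqP; rewrite eqn_leq n1]; rewrite oner_eq0 valuation1.
have pp := pdiv_prime n1; have pn := pdiv_dvd n.
have [p0 vp] := residue_char0_prime rc pp.
have qn : (n %/ pdiv n < n)%N by rewrite ltn_Pdiv // prime_gt1.
have [|q0 vq] := IH _ qn; first by rewrite divn_gt0 ?prime_gt0 // dvdn_leq.
rewrite -(divnK pn) natrM; split; first by rewrite mulf_neq0.
by rewrite valuationM // vp vq addr0.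
Qed.

Lemma residue_char0_int (z : int) : residue_char0 v -> z != 0 -> z%:~R != 0 :> K /\ v z%:~R = 0.
Proof.
move=> rc; case: z => n n0; first by apply: residue_char0_nat rc _; rewrite lt0n.
have [h1 h2] := residue_char0_nat rc (ltn0Sn n).
by rewrite NegzE mulrNz oppr_eq0 valuationN.
Qed.

End UniqueMinimum.

(** * The certificate excluding the triangles and ten edges *)

Section StarCertificate.
Local Open Scope Z_scope.

(** Four three-term relations with signed monomial multipliers, whose exponents refer to the seeds.
    Of their twelve normal forms eight cancel in pairs, leaving 1 + 1 + p^a - p^b. *)
Definition star_certificate_codes :
  seq ((bool * zvec) * (nat * ((nat * nat) * (nat * nat)))) := [::
  ((true, [:: 0; -1; 0; 0; 0; 0; -1; 0; 1; 0; 0; 2; -2; 0; 0; -1; -1; 0; 1; 0]), (0, ((1, 4), (5, 7)))%N);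
  ((false, [:: 0; 0; 0; 0; 0; 0; -1; -1; 0; 0; 0; 1; -1; 0; 0; 0; 0; 0; 0; 0]), (1, ((0, 2), (4, 6)))%N);
  ((true, [:: 0; -1; 0; 2; -1; -2; 1; 1; 1; 1; -1; 1; -1; -1; -1; 0; 0; -1; 0; 0]), (0, ((2, 3), (5, 7)))%N);
  ((true, [:: 0; -1; 1; 1; 0; -2; 1; 0; 0; 0; -1; 0; 0; 0; 0; 0; 0; -1; 0; 0]), (3, ((0, 1), (4, 6)))%N)].

Definition star_exponent_a : zvec := [:: 1; -2; 1; 0; 0; 0; -1; 0; 1; 0; 0; 2; -2; 0; 1; -1; -1; 0; 1; 0].
Definition star_exponent_b : zvec := [:: 0; -2; 2; 2; -2; -2; 1; 1; 0; -1; -1; 1; -1; 1; 1; 0; -1; 0; 0; 1].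

Definition star_cancelled : seq (bool * zvec) := [seq (false, e) | e <- [::
  [:: 0; -1; 1; 0; 0; 0; 0; 0; 0; -1; 0; 1; -2; 1; 2; -1; -1; 0; 1; 0];
  [:: 0; -1; 1; 1; -1; -1; 0; 1; 0; -1; 0; 1; -1; 1; 1; -1; 0; 0; 0; 0];
  [:: 0; -1; 1; 2; -1; -2; 1; 1; 0; 0; -1; 0; 0; 0; 0; 0; 0; 0; 0; 0];
  [:: 0; 0; 0; -1; 0; 0; 0; 0; 1; 0; 0; 1; -2; 0; 1; -1; -1; 1; 1; 0]]].

End StarCertificate.

Definition star_certificate : seq ((bool * zvec) * seq (bool * (nat * nat))) :=
  [seq (c.1, code_relation c.2) | c <- star_certificate_codes].

Definition star_seeds := star_frame ++ star_free.

Definition star_target : seq (bool * zvec) :=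
  [:: (false, nseq 20 0%BZ); (false, nseq 20 0%BZ); (false, star_exponent_a);
      (true, star_exponent_b)].

(* The edges in the boundary of three triangles, and the triangles. *)
Definition star_removed : seq (seq nat) := [::
  [:: 0; 3]; [:: 0; 12]; [:: 2; 3]; [:: 2; 20]; [:: 10; 11]; [:: 10; 20]; [:: 11; 16];
  [:: 12; 13]; [:: 13; 14]; [:: 14; 16]; [:: 0; 1; 3]; [:: 0; 2; 3]; [:: 0; 3; 12];
  [:: 0; 6; 12]; [:: 0; 12; 13]; [:: 2; 3; 4]; [:: 2; 3; 20]; [:: 2; 10; 20]; [:: 2; 20; 21];
  [:: 5; 10; 11]; [:: 10; 11; 16]; [:: 10; 11; 20]; [:: 10; 20; 25]; [:: 11; 14; 16];
  [:: 11; 16; 18]; [:: 12; 13; 14]; [:: 12; 13; 26]; [:: 13; 14; 15]; [:: 13; 14; 16];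
  [:: 14; 16; 17]].

(** The linear form by which a monomial in the seeds acts on weights: with [star_incidence] for the
    lineality part, with [star_rows] for the reduced coordinates. *)
Definition exponent_vector (rows : seq zvec) (seeds : seq nat) (e : zvec) : zvec :=
  foldr (fun k h => zcomb (nth 0%BZ e k) (nth [::] rows (nth 0%N seeds k)) 1 h) [::]
    (iota 0 (size seeds)).

Fact star_certificate_ok :
  let tbl := nf_table star_seeds star_eliminations in
  perm_eq (flatten [seq pmap (nf_term tbl c.1) c.2 | c <- star_certificate])
    (star_target ++ [seq (false, e.2) | e <- star_cancelled]
       ++ [seq (true, e.2) | e <- star_cancelled])
  && all (fun c => all (fun t => nf_term tbl c.1 t != None) c.2) star_certificate.
Proof. by vm_compute. Qed.

(** Both exponents are blind to the lineality space; on a removed cone they are nonnegative on all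
    rays and positive on one, hence positive in the relative interior. *)
Fact star_exponents_ok : all (fun e =>
  znull (exponent_vector star_incidence star_seeds e) &&
  all (fun sigma =>
    let ds := [seq zdot (exponent_vector star_rows star_seeds e) (nth [::] star_rays i) | i <- sigma] in
    all (Z.leb 0) ds && has (Z.ltb 0) ds) star_removed) [:: star_exponent_a; star_exponent_b].
Proof. by vm_compute. Qed.

Fact star_certificate_codes_ok : all (fun c => code_valid c.2) star_certificate_codes.
Proof. by vm_compute. Qed.

Fact star_exponent_sizes : all (fun e => size (exponent_vector star_rows star_seeds e) <= 10)%N
  [:: star_exponent_a; star_exponent_b].
Proof. by vm_compute. Qed.

Section ExponentVectors.
Variables (I : finType) (x : nat -> I) (N n : nat) (rows incs : seq zvec) (seeds : seq nat).
Hypothesis x_inj : forall i j, (i < N)%N -> (j < N)%N -> x i = x j -> i = j.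
Hypothesis x_surj : forall b, exists2 i, (i < N)%N & b = x i.
Hypothesis seeds_lt : all (fun i => i < N)%N seeds.
Variable R : realType.
Implicit Types (w : weight R I) (u q : 'rV[R]_n).

Lemma monval0 w : monval w 0 = 0.
Proof. by rewrite /monval big1 // => i _; rewrite ffunE mul0r. Qed.

Lemma monval_sum w (J : Type) (r : seq J) (F : J -> {ffun I -> int}) :
  monval w (\sum_(j <- r) F j) = \sum_(j <- r) monval w (F j).
Proof. by apply: big_morph; [apply: monval_addm | apply: monval0]. Qed.

Lemma monvalMz w a (z : int) : monval w (a *~ z) = z%:~R * monval w a.
Proof.
rewrite /monval big_distrr; apply: eq_bigr => i _ /=.
by rewrite ffunMzE mulrzz intrM [_ * z%:~R]mulrC mulrA.
Qed.

Lemma monval_zmono u q e : monval (embed x N rows incs u q) (zmono x seeds e) =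
  rdot (exponent_vector incs seeds e) u + rdot (exponent_vector rows seeds e) q.
Proof.
have rE m (ms : seq zvec) (p : 'rV[R]_m) : rdot (exponent_vector ms seeds e) p =
    \sum_(k <- iota 0 (size seeds)) zreal R (nth 0%BZ e k) * rdot (nth [::] ms (nth 0%N seeds k)) p.
  rewrite /exponent_vector; elim: (iota _ _) => [|k r IH] /=.
    by rewrite big_nil /rdot big1 // => i _; rewrite nth_nil mul0r.
  by rewrite rdot_comb IH big_cons zreal1 mul1r.
rewrite !rE -big_split /zmono monval_sum -(big_mkord xpredT (fun k =>
  monval _ (expo x (nth 0%N seeds k) *~ int_of_Z (nth 0%BZ e k)))) /index_iota subn0.
rewrite big_seq [RHS]big_seq; apply: eq_bigr => k; rewrite mem_iota /= => hk.
rewrite monvalMz monval_expo coordinate_embed ?mulrDr //.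
by apply: (allP seeds_lt); apply: mem_nth.
Qed.

Lemma rdot_ray_sum_gt0 (p : zvec) rays sigma (lam : nat -> R) : (size p <= n)%N ->
  (forall i, i \in sigma -> 0 < lam i) ->
  let ds := [seq zdot p (nth [::] rays i) | i <- sigma] in
  all (Z.leb 0) ds && has (Z.ltb 0) ds -> 0 < rdot p (ray_sum n rays sigma lam).
Proof.
move=> sp lam0 ds /andP[/allP ge /hasP[d /mapP[i si ->] dpos]].
rewrite rdot_sum (big_rem i si) /= rdotZ rdot_rvec // ltr_pwDl //.
  by rewrite mulr_gt0 ?lam0 ?zreal_gt0.
rewrite big_seq sumr_ge0 // => j /mem_rem sj.
by rewrite rdotZ rdot_rvec // mulr_ge0 ?(ltW (lam0 _ sj)) // zreal_ge0; apply/ge/map_f.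
Qed.

End ExponentVectors.

Section StarRemoved.
Variables (R : realType) (K : fieldType) (v : valuation R K).

Lemma star_target_mem : laurent_ideal (three_term_relations K M_star)
  (<< 2 *g 0 >> + << zmono bvar star_seeds star_exponent_a >>
     - << zmono bvar star_seeds star_exponent_b >>).
Proof.
have /andP[pe def] := star_certificate_ok; rewrite three_term_relations_star.
have sub : {subset star_eliminations <= star_relations}.
  by move=> T /(allP star_eliminations_ok)/andP[].
have crels : all (fun c => c.2 \in star_relations) star_certificate.
  by apply/allP => _ /mapP[c /(allP star_certificate_codes_ok)/code_relation_mem cc ->].
have := @certificate_mem _ bvar star_relations star_seeds K _ _ _ _ sub crels pe def.
rewrite /star_target sum_target; cbv beta; rewrite zmono_nseq0 => h; exact: h.
Qed.

Lemma star_removed_grassmannian sigma w : residue_char0 v -> sigma \in star_removed ->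
  ray_relint (star_lineality R) (star_ray R) sigma w -> ~ grassmannian v M_star w.
Proof.
move=> rc sr /ray_relint_embed[u [lam [lam0 ->]]] /(_ _ star_target_mem).
have [n2 v2] := residue_char0_nat rc (isT : (0 < 2)%N).
have pos e : e \in [:: star_exponent_a; star_exponent_b] ->
    0 < monval (embed bvar 110 star_rows star_incidence u (ray_sum 10 star_rays sigma lam))
          (zmono bvar star_seeds e).
  move=> ein; have /andP[/(rvec_null R 10) e0 /allP/(_ _ sr) ge] :=
    allP star_exponents_ok _ ein.
  rewrite (monval_zmono _ _ bvar_inj bvar_surj); last by vm_compute.
  set p := exponent_vector star_rows _ _ in ge *.
  have -> : rdot (exponent_vector star_incidence star_seeds e) u = 0.
    rewrite /rdot big1 // => i _; have := congr1 (fun q : 'rV_10 => q 0 i) e0.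
    by rewrite !mxE => ->; rewrite mul0r.
  have sp : (size p <= 10)%N by apply: (allP star_exponent_sizes e ein).
  by rewrite add0r; apply: rdot_ray_sum_gt0.
apply: (unique_min_binomial n2 v2); apply: pos; by rewrite !inE eqxx ?orbT.
Qed.

End StarRemoved.

(* A decreasing filtration [value_ge] by values, and elements of exact value;
   these stand for a valuation where none is at hand. *)
Record filtration (R : realType) (A : comNzRingType) := Filtration {
  value_ge : R -> A -> Prop;
  value_eq : R -> A -> Prop;
  value_ge0 : forall m, value_ge m 0;
  value_geB : forall m x y, value_ge m x -> value_ge m y -> value_ge m (x - y);
  value_geM : forall m n x y, value_ge m x -> value_ge n y -> value_ge (m + n) (x * y);
  value_ge_le : forall m n x, n <= m -> value_ge m x -> value_ge n x;
  value_eq_ge : forall m x, value_eq m x -> value_ge m x;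
  value_eq1 : value_eq 0 1;
  value_eqN : forall m x, value_eq m x -> value_eq m (- x);
  value_eqM : forall m n x y, value_eq m x -> value_eq n y -> value_eq (m + n) (x * y);
  value_eqD : forall m n x y, value_eq m x -> m < n -> value_ge n y -> value_eq m (x + y);
  value_eq_neq0 : forall m, ~ value_eq m 0
}.

Arguments value_ge : simpl never.
Arguments value_eq : simpl never.

(** * Calculus with values in filtered rings *)

Section FiltrationTheory.
Variables (R : realType) (A : comNzRingType) (F : filtration R A).
Local Notation vge := (value_ge F).
Local Notation veq := (value_eq F).
Implicit Types (x y : A) (m n : R).

Lemma value_geN m x : vge m x -> vge m (- x).
Proof. by move=> h; rewrite -sub0r; apply: value_geB => //; apply: value_ge0. Qed.

Lemma value_geD m x y : vge m x -> vge m y -> vge m (x + y).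
Proof. by move=> hx /value_geN hy; rewrite -[y]opprK; apply: value_geB. Qed.

Lemma value_ge1 : vge 0 1.
Proof. exact/value_eq_ge/value_eq1. Qed.

Lemma value_ge_sum m (T : eqType) (r : seq T) (P : pred T) (E : T -> A) :
  (forall t, t \in r -> P t -> vge m (E t)) -> vge m (\sum_(t <- r | P t) E t).
Proof.
move=> h; rewrite big_seq_cond; apply: (@big_ind _ (vge m)); first exact: value_ge0.
  exact: value_geD.
by move=> t /andP[]; apply: h.
Qed.

Lemma value_ge_int m x (z : int) : vge m x -> vge m (z%:~R * x).
Proof.
rewrite mulrzl => h; have hn (n : nat) : vge m (x *+ n).
  by rewrite -[n]card_ord -sumr_const; apply: value_ge_sum.
by case: z => n; rewrite ?NegzE ?mulrNz; [|apply: value_geN]; apply: hn.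
Qed.

Lemma value_geX m x k : vge m x -> vge (k%:R * m) (x ^+ k).
Proof.
move=> h; elim: k => [|k IH]; first by rewrite mul0r; apply: value_ge1.
by rewrite exprS -natr1 mulrDl mul1r addrC; apply: value_geM.
Qed.

Lemma value_eqX m x k : veq m x -> veq (k%:R * m) (x ^+ k).
Proof.
move=> h; elim: k => [|k IH]; first by rewrite mul0r; apply: value_eq1.
by rewrite exprS -natr1 mulrDl mul1r addrC; apply: value_eqM.
Qed.

Lemma value_eq_prod (T : Type) (r : seq T) (w : T -> R) (E : T -> A) :
  (forall t, veq (w t) (E t)) -> veq (\sum_(t <- r) w t) (\prod_(t <- r) E t).
Proof.
move=> h; elim: r => [|t r IH]; first by rewrite !big_nil; apply: value_eq1.
by rewrite !big_cons; apply: value_eqM.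
Qed.

Lemma value_eq_sum m x (T : eqType) (r : seq T) (E : T -> A) : veq m x ->
  (forall t, t \in r -> exists2 n, m < n & vge n (E t)) -> veq m (x + \sum_(t <- r) E t).
Proof.
move=> hx; elim: r => [|t r IH] h; first by rewrite big_nil addr0.
rewrite big_cons addrCA addrC; have [n mn hn] := h t (mem_head _ _).
apply: value_eqD hn => //; apply: IH => s sr; apply: h; rewrite inE sr orbT //.
Qed.

(** Otherwise 0, as [x] minus itself, would have the exact value [m]. This is the contradiction to
    which approximate zeros lead. *)
Lemma value_eq_lt m n x : veq m x -> m < n -> ~ vge n x.
Proof.
move=> hx mn /value_geN hn; apply: (@value_eq_neq0 _ _ F m).
by rewrite -(subrr x); apply: value_eqD hn.
Qed.

End FiltrationTheory.

(** * The filtration of a valuation *)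

Section ValuationFiltration.
Variables (R : realType) (K : fieldType) (v : valuation R K).

Let vge m (x : K) := x = 0 \/ m <= v x.
Let veq m (x : K) := x != 0 /\ v x = m.

Let vgeN m x : vge m x -> vge m (- x).
Proof. by case=> [->|h]; [left; rewrite oppr0|right; rewrite valuationN]. Qed.

Let vgeD m x y : vge m x -> vge m y -> vge m (x + y).
Proof.
move=> [->|hx] hy; first by rewrite add0r.
case: hy => [->|hy]; first by rewrite addr0; right.
have [->|x0] := eqVneq x 0; first by rewrite add0r; right.
have [->|y0] := eqVneq y 0; first by rewrite addr0; right.
have [->|xy] := eqVneq (x + y) 0; first by left.
by right; apply: le_trans (valuationD v x0 y0 xy); rewrite le_min hx.
Qed.

Let vgeM m n x y : vge m x -> vge n y -> vge (m + n) (x * y).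
Proof.
have [->|x0] := eqVneq x 0; first by left; rewrite mul0r.
have [->|y0] := eqVneq y 0; first by left; rewrite mulr0.
case=> [/eqP|hx]; first by rewrite (negPf x0).
case=> [/eqP|hy]; first by rewrite (negPf y0).
by right; rewrite valuationM // lerD.
Qed.

Let veqD m n x y : veq m x -> m < n -> vge n y -> veq m (x + y).
Proof.
move=> [x0 vx] mn hy; have [y0|y0] := eqVneq y 0; first by rewrite y0 addr0; split.
case: hy => [/eqP|vy]; first by rewrite (negPf y0).
have lt : v x < v y by rewrite vx (lt_le_trans mn).
have xy : x + y != 0.
  apply: contraTneq lt => /eqP; rewrite addrC addr_eq0 => /eqP->.
  by rewrite valuationN ltxx.
split=> //; apply/eqP; rewrite eq_le; apply/andP; split; last first.
  by apply: le_trans (valuationD v x0 y0 xy); rewrite le_min -vx lexx ltW.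
(* If [x + y] had larger value than [x], then [x] would be a sum of two elements of larger value. *)
have E : x = (x + y) - y by rewrite addrK.
rewrite leNgt -vx; apply/negP => lt2.
have h : (x + y) - y != 0 by rewrite -E.
have := valuationD v xy (_ : - y != 0) h; rewrite oppr_eq0 => /(_ y0).
by rewrite -E valuationN leNgt lt_min lt lt2.
Qed.

Definition valuation_filtration : filtration R K.
Proof.
apply: (@Filtration R K vge veq) => //.
- by left.
- by move=> m x y hx /vgeN; apply: vgeD.
- by move=> m n x nm [->|h]; [left|right; apply: le_trans nm h].
- by move=> m x [_ <-]; right.
- by split; [apply: oner_neq0|apply: valuation1].
- by move=> m x [x0 <-]; split; [rewrite oppr_eq0|rewrite valuationN].
- by move=> m n x y [x0 <-] [y0 <-]; split; [rewrite mulf_neq0|rewrite valuationM].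
- by move=> m [/eqP].
Defined.

End ValuationFiltration.

(** * The weighted Gauss filtration on polynomials *)

Section PolynomialFiltration.
Variables (R : realType) (A : comNzRingType) (F : filtration R A) (beta : R).
Local Notation vge := (value_ge F).
Local Notation veq := (value_eq F).

Let pge m (p : {poly A}) := forall j, vge (m - j%:R * beta) p`_j.
(** Exactness asks for one dominant coefficient, the others being larger by a fixed gap [e]. This is
    stronger than a minimum attained somewhere and passes to products: the two dominant coefficients
    give the only smallest contribution, so nothing can cancel it. *)
Let peq m (p : {poly A}) := exists j, veq (m - j%:R * beta) p`_j /\
  exists2 e : R, 0 < e & forall k : nat, k != j -> vge (m + e - k%:R * beta) p`_k.

Let split_value m n (i : nat) (k : 'I_i.+1) :
  m + n - i%:R * beta = (m - k%:R * beta) + (n - (i - k)%:R * beta).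
Proof. by rewrite natrB -1?ltnS // mulrBl opprB !addrA; lra. Qed.

Let peq_ge m p : peq m p -> pge m p.
Proof.
move=> [j [hj [e e0 hk]]] k; have [->|/hk] := eqVneq k j; first exact: value_eq_ge.
by apply: value_ge_le; rewrite lerB // lerDl ltW.
Qed.

Definition poly_filtration : filtration R {poly A}.
Proof.
apply: (@Filtration R {poly A} pge peq).
- by move=> m j; rewrite coef0; apply: value_ge0.
- by move=> m p q hp hq j; rewrite coefB; apply: value_geB.
- move=> m n p q hp hq i; rewrite coefM; apply: value_ge_sum => k _ _.
  by rewrite (split_value m n k); apply: value_geM.
- by move=> m n p nm hp j; apply: value_ge_le (hp j); rewrite lerB.
- exact: peq_ge.
- exists 0%N; split; first by rewrite coef1 mul0r subr0; apply: value_eq1.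
  by exists 1 => // k /negPf k0; rewrite coef1 k0; apply: value_ge0.
- move=> m p [j [hj [e e0 he]]]; exists j; split; first by rewrite coefN; apply: value_eqN.
  by exists e => // k /he hk; rewrite coefN; apply: value_geN.
- move=> m n p q eqp eqq; have hp := peq_ge eqp; have hq := peq_ge eqq.
  case: eqp eqq => [j [hj [e e0 he]]] [l [hl [d d0 hd]]].
  (* Every contribution except dominant times dominant gains at least the smaller of the two
     gaps. *)
  have small i (k : 'I_i.+1) : (k != j :> nat) || (i - k != l)%N ->
      vge (m + n + Num.min e d - i%:R * beta) (p`_k * q`_(i - k)).
    case/orP => [/he h1|/hd h2].
      apply: value_ge_le (value_geM h1 (hq _)).
      have : Num.min e d <= e by rewrite ge_min lexx.
      have := split_value m n k; lra.
    apply: value_ge_le (value_geM (hp _) h2).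
    have : Num.min e d <= d by rewrite ge_min lexx orbT.
    have := split_value m n k; lra.
  exists (j + l)%N; split; last first.
    exists (Num.min e d) => [|i ijl]; first by rewrite lt_min e0.
    rewrite coefM; apply: value_ge_sum => k _ _; apply: small.
    rewrite -negb_and; apply: contraNN ijl => /andP[/eqP <- /eqP <-].
    by rewrite subnKC // -ltnS.
  have jl : (j < (j + l).+1)%N by rewrite ltnS leq_addr.
  rewrite coefM (bigD1 (Ordinal jl)) //= addKn.
  have -> : m + n - (j + l)%:R * beta = (m - j%:R * beta) + (n - l%:R * beta).
    by rewrite (split_value m n (Ordinal jl)) /= addKn.
  apply: (@value_eqD _ _ F _ (m + n + Num.min e d - (j + l)%:R * beta)).
  + exact: value_eqM.
  + rewrite [X in _ < X]addrAC (split_value m n (Ordinal jl)) /= addKn ltrDl.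
    by rewrite lt_min e0.
  + apply: value_ge_sum => k _ kj; apply: small; apply/orP; left.
    exact: kj.
- move=> m n p q [j [hj [e e0 he]]] mn hq; exists j; split.
    by rewrite coefD; apply: value_eqD hj _ (hq j); rewrite ltrD2r.
  exists (Num.min e (n - m)) => [|k kj]; first by rewrite lt_min e0 subr_gt0.
  rewrite coefD; apply: value_geD.
    by apply: value_ge_le (he _ kj); rewrite lerB // lerD2l ge_min lexx.
  apply: value_ge_le (hq k); have : Num.min e (n - m) <= n - m by rewrite ge_min lexx orbT.
  lra.
- by move=> m [j []]; rewrite coef0 => /value_eq_neq0.
Defined.

Lemma value_eq_polyC m x : veq m x -> value_eq poly_filtration m x%:P.
Proof.
move=> h; exists 0%N; split; first by rewrite coefC mul0r subr0.
by exists 1 => // k /negPf k0; rewrite coefC k0; apply: value_ge0.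
Qed.

Lemma value_eq_polyX : value_eq poly_filtration beta 'X.
Proof.
exists 1%N; split; first by rewrite coefX mul1r subrr; apply: value_eq1.
by exists 1 => // k /negPf k1; rewrite coefX k1; apply: value_ge0.
Qed.

End PolynomialFiltration.

(** * From approximate zeros to tropical points *)

Section ApproximatePoints.
Variables (R : realType) (K : fieldType) (v : valuation R K) (I : finType).
Variables (A : comNzRingType) (F : filtration R A) (iota : {rmorphism K -> A}).
Local Notation mon := {ffun I -> int}.
Local Notation vge := (value_ge F).
Local Notation veq := (value_eq F).
Hypothesis iota_eq : forall c, c != 0 -> veq (v c) (iota c).
Variables (x : nat -> I) (rels : seq (seq (bool * (nat * nat)))).
Variables (omega lambda : weight R I).
(** The weight [omega] is realized by values of ring elements; the lineality shift [lambda] is not,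
    and enters as a grading for which the relations are homogeneous, so that an element of the ideal
    can be evaluated piece by piece. *)
Hypothesis lambda_homogeneous : forall T t t', T \in rels -> t \in T -> t' \in T ->
  term_value x lambda t = term_value x lambda t'.
Local Notation J := (laurent_ideal [set relation_poly x K T | T in [set` rels]]).
Implicit Types (f g : laurent K I) (a b : mon) (p : I -> A) (N : nat).

Definition approximate_zero (M : R) p : Prop := (forall i, veq (omega i) (p i)) /\
  forall T, T \in rels -> vge M (\sum_(t <- T) (-1) ^+ t.1 * (p (x t.2.1) * p (x t.2.2))).

(** The variables take values in a ring where they need not be invertible; the common factor of
    [N]-th powers clears negative exponents and adds [N%:R * total] to the value. *)
Definition shifted_eval N p a : A := \prod_i p i ^+ absz (a i + N%:Z).

(* The terms on which lambda takes the value d, at p and multiplied by the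
   N-th powers of all variables. *)
Definition slice_eval d N p f : A := lextend
  (fun c a => if monval lambda a == d then iota c * shifted_eval N p a else 0) f.

Let total : R := \sum_i omega i.

Let sliceD d N p c c' a :
  (if monval lambda a == d then iota (c + c') * shifted_eval N p a else 0) =
  (if monval lambda a == d then iota c * shifted_eval N p a else 0) +
  (if monval lambda a == d then iota c' * shifted_eval N p a else 0).
Proof. by case: eqP => _; rewrite ?addr0 // rmorphD mulrDl. Qed.

Let exponent_bound a : nat := \sum_i `|a i|%N.

Let exponent_boundP a N i : (exponent_bound a <= N)%N -> 0 <= a i + N%:Z.
Proof.
move=> h; have : (`|a i| <= N)%N by apply: leq_trans h; rewrite /exponent_bound (bigD1 i) //= leq_addr.
lia.
Qed.

Let shifted_eval_eq N p a M : approximate_zero M p -> (exponent_bound a <= N)%N ->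
  veq (monval omega a + N%:R * total) (shifted_eval N p a).
Proof.
move=> [hp _] aN.
have -> : monval omega a + N%:R * total = \sum_i (absz (a i + N%:Z))%:R * omega i.
  rewrite /total mulr_sumr -big_split; apply: eq_bigr => i _ /=.
  rewrite -mulrDl; congr (_ * _).
  rewrite -[RHS]/(((absz (a i + N%:Z))%:Z)%:~R) gez0_abs ?intrD //.
  exact: exponent_boundP.
by apply: value_eq_prod => i; apply: value_eqX.
Qed.

Let shifted_evalD N p a b : (exponent_bound a <= N)%N -> (forall i, 0 <= b i) ->
  shifted_eval N p (a + b) = shifted_eval N p a * \prod_i p i ^+ `|b i|%N.
Proof.
move=> aN b0; rewrite /shifted_eval -big_split; apply: eq_bigr => i _ /=.
rewrite -exprD; congr (_ ^+ _); rewrite ffunE.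
have := exponent_boundP i aN; have := b0 i.
move: (a i) (b i) => y z z0 yN. lia.
Qed.

Let eval_expo2 p i j : \prod_k p k ^+ absz ((expo x i + expo x j) k) = p (x i) * p (x j).
Proof.
have E l : \prod_k p k ^+ `|expo x l k|%N = p (x l).
  rewrite (bigD1 (x l)) //= ffunE eqxx expr1 big1 ?mulr1 // => k /negPf kl.
  by rewrite ffunE kl expr0.
rewrite -!E -big_split; apply: eq_bigr => k _ /=; rewrite -exprD; congr (_ ^+ _).
by rewrite ffunE !ffunE; case: (k == _); case: (k == _).
Qed.

Let slice_eval_relation d N p c b T : T \in rels -> (exponent_bound b <= N)%N ->
  slice_eval d N p (laurent_mul << c *g b >> (relation_poly x K T)) =
  iota c * shifted_eval N p b *
    \sum_(t <- T) (if monval lambda (b + term_mono x t) == d then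
                     (-1) ^+ t.1 * (p (x t.2.1) * p (x t.2.2)) else 0).
Proof.
move=> hT bN; rewrite /slice_eval /relation_poly /signed_sum big_map laurent_mul_sumr lextend_sum //.
rewrite big_distrr; apply: eq_bigr => t _ /=; rewrite laurent_mulUU lextendU //.
case: eqP => _; last by rewrite mulr0.
rewrite shifted_evalD // => [|i]; last by rewrite !ffunE; case: (_ == _); case: (_ == _).
by rewrite eval_expo2 rmorphM rmorph_sign mulrACA.
Qed.

Let slice_eval_gen d f T : T \in rels -> exists C N0, forall N M p,
  (N0 <= N)%N -> approximate_zero M p ->
  vge (C + N%:R * total + M) (slice_eval d N p (laurent_mul f (relation_poly x K T))).
Proof.
move=> hT; elim/laurent_ind: f => [|c b|f g [C [N0 h]] [C' [N0' h']]].
- by exists 0, 0%N => N M p _ _; rewrite laurent_mul0l /slice_eval lextend0; apply: value_ge0.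
- exists (v c + monval omega b), (exponent_bound b) => N M p bN hp.
  have [->|c0] := eqVneq c 0.
    by rewrite slice_eval_relation // rmorph0 !mul0r; apply: value_ge0.
  rewrite slice_eval_relation //; apply: value_geM; last first.
    case: T hT => [|t T] hT; first by rewrite big_nil; apply: value_ge0.
    have lamE s : s \in t :: T -> monval lambda (b + term_mono x s) = monval lambda (b + term_mono x t).
      move=> sT; rewrite [LHS]monval_addm [RHS]monval_addm ![monval _ (term_mono _ _)]monval_term.
      by rewrite (lambda_homogeneous hT (mem_head t T) sT).
    have -> : \sum_(s <- t :: T) (if monval lambda (b + term_mono x s) == d then
        (-1) ^+ s.1 * (p (x s.2.1) * p (x s.2.2)) else 0) =
      if monval lambda (b + term_mono x t) == d then
        \sum_(s <- t :: T) (-1) ^+ s.1 * (p (x s.2.1) * p (x s.2.2)) else 0.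
      case: ifP => E; rewrite big_seq; last by rewrite big1 // => s /lamE->; rewrite E.
      by rewrite [RHS]big_seq; apply: eq_bigr => s /lamE->; rewrite E.
    by case: ifP => _; [apply: hp.2|apply: value_ge0].
  rewrite -addrA; apply: value_geM; first exact/value_eq_ge/iota_eq.
  exact: (value_eq_ge (shifted_eval_eq hp bN)).
- exists (Num.min C C'), (maxn N0 N0') => N M p; rewrite geq_max => /andP[n1 n2] hp.
  rewrite laurent_mulDl /slice_eval lextendD //; apply: value_geD.
    by apply: value_ge_le (h _ _ _ n1 hp); rewrite !lerD2r ge_min lexx.
  by apply: value_ge_le (h' _ _ _ n2 hp); rewrite !lerD2r ge_min lexx orbT.
Qed.

Let slice_eval_ideal d f : J f -> exists C N0, forall N M p,
  (N0 <= N)%N -> approximate_zero M p ->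
  vge (C + N%:R * total + M) (slice_eval d N p f).
Proof.
move=> [s hs ->]; elim: s hs => [|hg s IH] hs.
  by exists 0, 0%N => N M p _ _; rewrite big_nil /slice_eval lextend0; apply: value_ge0.
have [|C [N0 h]] := IH; first by move=> hg' hin; apply: hs; rewrite inE hin orbT.
have [T hT ET] := hs _ (mem_head hg s).
have [C' [N0' h']] := slice_eval_gen d hg.1 hT.
exists (Num.min C C'), (maxn N0 N0') => N M p; rewrite geq_max => /andP[n1 n2] hp.
rewrite big_cons /slice_eval lextendD //; apply: value_geD.
  by rewrite -ET; apply: value_ge_le (h' _ _ _ n2 hp); rewrite !lerD2r ge_min lexx orbT.
by apply: value_ge_le (h _ _ _ n1 hp); rewrite !lerD2r ge_min lexx.
Qed.

(* At an approximate zero an element of the ideal takes a large value, whereas a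
   term attaining the minimum alone would determine the value. *)
Lemma approximate_zeros_trop : (forall M, exists p, approximate_zero M p) ->
  trop_intersection v J (omega + lambda).
Proof.
move=> zeros f hf a [af amin]; apply: contrapT => alone.
have strict b : b \in msupp f -> b != a ->
    trop_term v f (omega + lambda) a < trop_term v f (omega + lambda) b.
  move=> bf ba; rewrite lt_neqAle amin // andbT; apply/eqP => E; apply: alone.
  by exists b => //; split=> // c cf; rewrite -E; apply: amin.
have [C [N0 hC]] := slice_eval_ideal (monval lambda a) hf.
pose N := (N0 + \sum_(b <- msupp f) exponent_bound b)%N.
have bN b : b \in msupp f -> (exponent_bound b <= N)%N.
  move=> bf; apply: leq_trans (leq_addl _ _); rewrite (big_rem b bf) /=; exact: leq_addr.
(* Chosen so that the bound in [hC] is one unit above the value of the term [a]. *)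
pose M := v f@_a + monval omega a - C + 1.
have [p hp] := zeros M.
have := hC N M p (leq_addr _ _) hp; rewrite /slice_eval /lextend (big_rem a af) /= eqxx.
apply: (@value_eq_lt _ _ F (v f@_a + (monval omega a + N%:R * total))); last first.
  by rewrite /M; lra.
apply: value_eq_sum => [|b].
  by apply: value_eqM; [apply: iota_eq; rewrite mcoeff_neq0|apply: shifted_eval_eq hp (bN _ af)].
rewrite rem_filter ?fset_uniq // mem_filter => /andP[/= ba bf].
case: eqP => [lam|_]; last first.
  by exists (v f@_a + (monval omega a + N%:R * total) + 1); [rewrite ltrDl|apply: value_ge0].
exists (v f@_b + (monval omega b + N%:R * total)).
  have := strict b bf ba; rewrite !trop_termE !monvalD lam; lra.
apply: value_geM; first by apply/value_eq_ge/iota_eq; rewrite mcoeff_neq0.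
exact: (value_eq_ge (shifted_eval_eq hp (bN _ bf))).
Qed.

End ApproximatePoints.

(** * Closedness of tropical intersections *)

Section TropicalClosure.
Variables (R : realType) (K : fieldType) (v : valuation R K) (I : finType).
Implicit Types (f : laurent K I) (w z : weight R I).

(** A term that is the only minimal one at [w] remains so nearby, since it has finitely many
    competitors. *)
Lemma trop_intersection_limit (G : set (laurent K I)) w z :
  (forall e, 0 < e -> trop_intersection v G (w + e *: z)) -> trop_intersection v G w.
Proof.
move=> h f Gf a [af amin]; apply: contrapT => alone.
have strict b : b \in msupp f -> b != a -> trop_term v f w a < trop_term v f w b.
  move=> bf ba; rewrite lt_neqAle amin // andbT; apply/eqP => E; apply: alone.
  by exists b => //; split=> // c cf; rewrite -E; apply: amin.
have [e e0 he] : exists2 e, 0 < e & forall b, b \in msupp f -> b != a ->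
    trop_term v f (w + e *: z) a < trop_term v f (w + e *: z) b.
  have {strict} : forall b, b \in (msupp f : seq _) -> b != a -> trop_term v f w a < trop_term v f w b.
    by [].
  suff : forall s : seq {ffun I -> int},
      (forall b, b \in s -> b != a -> trop_term v f w a < trop_term v f w b) ->
      exists2 e, 0 < e & forall d, 0 < d -> d <= e -> forall b, b \in s -> b != a ->
        trop_term v f (w + d *: z) a < trop_term v f (w + d *: z) b.
    by move=> H /H[e e0 he]; exists e => //; apply: he.
  elim=> [|b s IH] hs; first by exists 1.
  have [|e e0 he] := IH; first by move=> c cs; apply: hs; rewrite inE cs orbT.
  have [->|ba] := eqVneq b a.
    by exists e => // d d0 de c; rewrite inE => /orP[/eqP->|cs]; [rewrite eqxx|apply: he].
  have gap := hs b (mem_head _ _) ba.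
  (* The gap to [b] closes at a rate below [D]; the summand 1 keeps [D] positive and the final
     inequality strict. *)
  pose D := `|monval z b - monval z a| + 1; have D0 : 0 < D by rewrite ltr_wpDl.
  exists (Num.min e ((trop_term v f w b - trop_term v f w a) / D)).
    by rewrite lt_min e0 divr_gt0 // subr_gt0.
  move=> d d0; rewrite le_min => /andP[de dgap] c; rewrite inE => /orP[/eqP-> _|cs]; last exact: he.
  move: dgap; rewrite ler_pdivlMr // !trop_termE !monvalD !monvalZ /D => dgap.
  have : d * (monval z a - monval z b) <= d * `|monval z b - monval z a|.
    by rewrite ler_pM2l // -normrN opprB ler_norm.
  lra.
have amin' : min_terms v f (w + e *: z) a.
  by split=> // b bf; have [->//|ba] := eqVneq b a; apply/ltW/he.
have [b ba [bf bmin]] := h e e0 f Gf a amin'.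
by have := bmin a af; rewrite leNgt he.
Qed.

End TropicalClosure.

(** * Sparse polynomials in s, t and e *)

Section SparsePolynomials.
Local Notation term := (nat * nat * nat * Z)%type.
Local Notation spoly := (seq term).
Implicit Types (p q : spoly) (u : term).

(** A term holds the exponents of s, t, e and a coefficient. Like terms are merged, and dropped when
    they cancel, so that a polynomial identity becomes an empty list. *)
Fixpoint sinsert u p : spoly :=
  if p is u' :: p' then
    if u.1 == u'.1 then
      if u.2 + u'.2 == 0 then p' else (u.1, u.2 + u'.2) :: p'
    else u' :: sinsert u p'
  else [:: u].

Definition sterm_mul u u' : term :=
  ((u.1.1.1 + u'.1.1.1, u.1.1.2 + u'.1.1.2, u.1.2 + u'.1.2)%N, u.2 * u'.2).

Definition saddmul p q r : spoly :=
  foldr (fun u => foldr (fun u' => sinsert (sterm_mul u u')) ^~ q) r p.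

Definition sopp p : spoly := [seq (u.1, - u.2) | u <- p].

Definition sdet2 p q p' q' : spoly := saddmul p q' (saddmul (sopp q) p' [::]).

Definition sdet3 (c d e : seq spoly) : spoly :=
  let m i j := sdet2 (nth [::] d i) (nth [::] d j) (nth [::] e i) (nth [::] e j) in
  saddmul (nth [::] c 0) (m 1 2)
    (saddmul (nth [::] c 1) (m 2 0) (saddmul (nth [::] c 2) (m 0 1) [::])).

(* The terms other than s^i t^j have larger values as soon as s, t and e have
   positive values. *)
Definition leads_at i j p u : bool :=
  [&& u.1 == (i, j, 0%N), u.2 != 0 & all (fun u' =>
    [&& i <= u'.1.1.1, j <= u'.1.1.2 & i + j < u'.1.1.1 + u'.1.1.2 + u'.1.2]%N) (rem u p)].

Definition leads i j p : bool := has (leads_at i j p) p.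

(** The situation of Hensel's lemma at e = 0: a nonzero integer times e, and terms that contain s or
    t or are at least quadratic in e. *)
Definition newton_start p u : bool :=
  [&& u.1 == (0, 0, 1)%N, u.2 != 0 & all (fun u' =>
    (0 < u'.1.1.1 + u'.1.1.2)%N || (1 < u'.1.2)%N) (rem u p)].

Definition lead_exponent p : nat * nat :=
  nth (0, 0)%N [seq u.1.1 | u <- p & leads_at u.1.1.1 u.1.1.2 p u] 0.

End SparsePolynomials.

(** * Three by three determinants *)

Section Determinants.
Variable A : comNzRingType.
Implicit Types c d e : nat -> A.

Definition det2 (a b c d : A) : A := a * d - b * c.

Definition det3 c d e : A :=
  c 0%N * det2 (d 1%N) (d 2%N) (e 1%N) (e 2%N) +
  (c 1%N * det2 (d 2%N) (d 0%N) (e 2%N) (e 0%N) +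
   c 2%N * det2 (d 0%N) (d 1%N) (e 0%N) (e 1%N)).

Lemma det3_plucker c d e f g :
  det3 c d e * det3 f g e - det3 c f e * det3 d g e + det3 c g e * det3 d f e = 0.
Proof. rewrite /det3 /det2; ring. Qed.

Lemma det3_sign (c d e : nat -> A) (a b : bool) :
  det3 (fun i => (-1) ^+ a * c i) (fun i => (-1) ^+ b * d i) e = (-1) ^+ (a (+) b) * det3 c d e.
Proof. by rewrite signr_addb /det3 /det2; ring. Qed.

End Determinants.

(** * Leading values and Newton iteration *)

Section SparseEvaluation.
Variables (R : realType) (A : comNzRingType) (F : filtration R A).
Variables (s t : A) (alpha beta : R).
Local Notation vge := (value_ge F).
Local Notation veq := (value_eq F).
Local Notation term := (nat * nat * nat * Z)%type.
Local Notation spoly := (seq term).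
Implicit Types (p q : spoly) (u : term) (e : A).

Definition term_eval e u : A :=
  (int_of_Z u.2)%:~R * (s ^+ u.1.1.1 * t ^+ u.1.1.2 * e ^+ u.1.2).

Definition seval e p : A := \sum_(u <- p) term_eval e u.

Lemma term_eval_mul e u u' : term_eval e (sterm_mul u u') = term_eval e u * term_eval e u'.
Proof.
rewrite /term_eval /= !exprD (rmorphM int_of_Z) intrM [RHS]mulrACA; congr (_ * _).
by rewrite [RHS]mulrACA; congr (_ * _); rewrite [RHS]mulrACA.
Qed.

Lemma seval_nil e : seval e [::] = 0.
Proof. exact: big_nil. Qed.

Lemma seval_insert e u p : seval e (sinsert u p) = term_eval e u + seval e p.
Proof.
rewrite /seval; elim: p => [|u' p IH] /=; first by rewrite big_seq1 big_nil addr0.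
case: eqP => [E|_]; last by rewrite !big_cons IH addrCA.
rewrite big_cons addrA.
have -> : term_eval e u + term_eval e u' = term_eval e (u.1, (u.2 + u'.2)%R).
  by rewrite /term_eval /= E (rmorphD int_of_Z) intrD mulrDl.
by case: eqP => [->|_]; [rewrite /term_eval /= mul0r add0r | rewrite big_cons].
Qed.

Lemma seval_addmul e p q r : seval e (saddmul p q r) = seval e p * seval e q + seval e r.
Proof.
elim: p => [|u p IH] /=; first by rewrite /seval big_nil mul0r add0r.
rewrite [in RHS]/seval big_cons mulrDl -addrA -[_ + seval e r]IH.
move: (saddmul p q r) => r'; rewrite /seval big_distrr /=.
elim: q {IH} => [|u' q IH] /=; first by rewrite big_nil add0r.
by rewrite -[LHS]/(seval e _) seval_insert /seval IH big_cons term_eval_mul addrA.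
Qed.

Lemma seval_opp e p : seval e (sopp p) = - seval e p.
Proof.
rewrite /seval big_map -sumrN; apply: eq_bigr => u _.
by rewrite /term_eval /= (rmorphN int_of_Z) intrN mulNr.
Qed.

Lemma seval_det3 e (c d f : seq spoly) : seval e (sdet3 c d f) =
  det3 (fun i => seval e (nth [::] c i)) (fun i => seval e (nth [::] d i))
    (fun i => seval e (nth [::] f i)).
Proof.
by rewrite /sdet3 /sdet2 !seval_addmul !seval_opp seval_nil !addr0 !mulNr.
Qed.

(** A lower bound for the values of s, t and of the e considered, hence for the gain from each
    additional factor. *)
Let delta := Num.min alpha beta.
Hypotheses (alpha0 : 0 < alpha) (beta0 : 0 < beta) (s_eq : veq alpha s) (t_eq : veq beta t).
Hypothesis int_eq : forall z : int, z != 0 -> veq 0 z%:~R.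
Hypothesis int_inv : forall z : int, z != 0 -> exists2 h, vge 0 h & h * z%:~R = 1.

Let delta0 : 0 < delta. Proof. by rewrite lt_min alpha0. Qed.

Let monomial_ge e i j k : vge delta e ->
  vge (i%:R * alpha + j%:R * beta + k%:R * delta) (s ^+ i * t ^+ j * e ^+ k).
Proof.
move=> he; apply: value_geM; last exact: value_geX.
by apply: value_geM; apply: value_geX; apply: value_eq_ge.
Qed.

Let larger_value i j i' j' k' : (i <= i')%N -> (j <= j')%N -> (i + j < i' + j' + k')%N ->
  i%:R * alpha + j%:R * beta + delta <= i'%:R * alpha + j'%:R * beta + k'%:R * delta.
Proof.
move=> ii jj lt; rewrite -(subnKC ii) -(subnKC jj) !natrD !mulrDl.
have a0 : (i' - i)%:R * delta <= (i' - i)%:R * alpha :> R by rewrite ler_wpM2l // ge_min lexx.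
have b0 : (j' - j)%:R * delta <= (j' - j)%:R * beta :> R.
  by rewrite ler_wpM2l // ge_min lexx orbT.
have : 1 * delta <= ((i' - i) + (j' - j) + k')%N%:R * delta.
  rewrite ler_wpM2r ?(ltW delta0) // ler1n; lia.
rewrite !natrD !mulrDl; lra.
Qed.

Lemma leads_value e i j p : vge delta e -> leads i j p ->
  veq (i%:R * alpha + j%:R * beta) (seval e p).
Proof.
move=> he /hasP[u up /and3P[/eqP u1 u2 /allP large]].
rewrite /seval (big_rem u up) /=; apply: value_eq_sum => [|u' u'p].
  rewrite /term_eval u1 expr0 mulr1 -[_ + _]add0r.
  apply: value_eqM; last by apply: value_eqM; apply: value_eqX.
  apply: int_eq; apply: contraNneq u2 => E; apply/eqP.
  by rewrite -[u.2]int_of_ZK E.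
exists (i%:R * alpha + j%:R * beta + delta); first by rewrite ltrDl.
have /and3P[ii jj lt] := large u' u'p.
by apply/value_ge_int/(value_ge_le (larger_value ii jj lt))/monomial_ge.
Qed.

Lemma seval_ge0 e p : vge delta e -> vge 0 (seval e p).
Proof.
move=> he; apply: value_ge_sum => u _ _; apply/value_ge_int.
apply: value_ge_le (monomial_ge _ _ _ he).
by rewrite !addr_ge0 ?mulr_ge0 ?ler0n // ltW.
Qed.

Let subX_ge d e e' k : vge delta e -> vge delta e' -> vge d (e' - e) ->
  vge (d + k%:R * delta) (e' ^+ k.+1 - e ^+ k.+1).
Proof.
move=> he he' hd; rewrite subrXX; apply: value_geM => //.
apply: value_ge_sum => i _ _; have ik : (i <= k)%N by rewrite -ltnS.
have -> : k%:R * delta = (k - i)%:R * delta + i%:R * delta by rewrite -mulrDl -natrD subnK.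
by apply: value_geM; apply: value_geX.
Qed.

(** Newton iteration with the derivative frozen at the integer coefficient of e, whose inverse has
    value at least 0. Each step improves the value by [delta]. *)
Lemma newton_root p n : has (newton_start p) p -> exists2 e, vge delta e &
  vge (n.+1%:R * delta) (seval e p).
Proof.
move=> /hasP[u up /and3P[/eqP u1 u2 /allP large]].
elim: n => [|n [e he hn]].
  (* At e = 0 only terms containing s or t survive, each of value at least [delta]. *)
  exists 0; first exact: value_ge0.
  rewrite mul1r /seval (big_rem u up) /= {1}/term_eval u1 expr1 !mulr0 add0r.
  apply: value_ge_sum => -[[[i j] k] c] /large /= lt _; apply: value_ge_int => /=.
  have [k0|k0] := eqVneq k 0%N; last by rewrite expr0n (negPf k0) mulr0; apply: value_ge0.
  have {}lt : (0 + 0 < i + j + k)%N by lia.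
  apply: value_ge_le (monomial_ge _ _ _ (value_ge0 _ _)).
  by have := larger_value (leq0n _) (leq0n _) lt; rewrite !mul0r !add0r.
have u20 : int_of_Z u.2 != 0.
  by apply: contraNneq u2 => E; apply/eqP; rewrite -[u.2]int_of_ZK E.
have [h h0 hu] := int_inv u20.
pose e' := e - h * seval e p.
have de : vge (n.+1%:R * delta) (e' - e).
  rewrite /e' addrAC subrr add0r; apply: value_geN; rewrite -[_ * delta]add0r.
  exact: value_geM.
have he' : vge delta e'.
  rewrite -[e'](subrK e) addrC; apply: value_geD => //; apply: value_ge_le de.
  by rewrite ler_peMl ?(ltW delta0) // ler1n.
exists e' => //.
(* The correction makes the linear term absorb [seval e p], so only the increments of the other
   terms remain. *)
have -> : seval e' p = \sum_(u' <- rem u p) (term_eval e' u' - term_eval e u').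
  rewrite sumrB; apply/eqP; rewrite eq_sym subr_eq eq_sym -subr_eq0; apply/eqP.
  rewrite {1}/seval (big_rem u up) /=.
  have -> : \sum_(y <- rem u p) term_eval e y = seval e p - term_eval e u.
    by rewrite /seval (big_rem u up) /= addrAC subrr add0r.
  rewrite /term_eval u1 !expr0 !mul1r !expr1 /e'.
  have E : (int_of_Z u.2)%:~R * (h * seval e p) = seval e p.
    by rewrite mulrA [_ * h]mulrC hu mul1r.
  by rewrite !mulrBr E; ring.
apply: value_ge_sum => u' /large lt _.
rewrite /term_eval -mulrBr -mulrBr; apply: value_ge_int.
case: u' lt => [[[i j] k] c] /= lt; case: k lt => [|k] lt.
  by rewrite !expr0 subrr mulr0; apply: value_ge0.
have {}lt : (0 + 0 < i + j + k)%N by lia.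
rewrite -natr1 mulrDl mul1r addrC.
apply: (@value_ge_le _ _ _ ((i%:R * alpha + j%:R * beta) + (n.+1%:R * delta + k%:R * delta))).
  have := larger_value (leq0n i) (leq0n j) lt; rewrite !mul0r; lra.
apply: value_geM; last exact: subX_ge.
by apply: value_geM; apply: value_geX; apply: value_eq_ge.
Qed.

End SparseEvaluation.

(** * Charts of realizations along the edges *)

Section StarCharts.
Let m (i j k : nat) (c : Z) := (i, j, k, c).
Arguments m (i j k)%_nat_scope c%_Z_scope.
Local Open Scope nat_scope.

(* Realizations over Z[s, t, e] modulo an equation G(s, t, e) = 0 solvable for e
   near 0: the equation, the ten columns, and the multiples of G to be
   subtracted from some of the minors. *)
Definition star_charts : seq (seq (nat * nat * nat * Z) * seq (seq (seq (nat * nat * nat * Z)))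
    * seq (seq nat * seq (nat * nat * nat * Z))) := [::
    ([:: m 0 0 1 (-4); m 1 0 0 1; m 1 0 1 1; m 1 1 0 1; m 1 1 1 (-6); m 1 1 2 1; m 1 2 0 (-2);
    m 1 2 2 2; m 2 2 0 2; m 2 2 1 (-2); m 2 3 0 (-2); m 2 3 2 2],
     [:: [:: [:: m 0 0 0 1]; [::]; [::]];
         [:: [::]; [:: m 0 0 0 1]; [::]];
         [:: [::]; [::]; [:: m 0 0 0 1]];
         [:: [:: m 0 0 0 1]; [:: m 0 0 0 1]; [:: m 0 0 0 1]];
         [:: [:: m 0 0 0 1; m 1 1 0 1]; [:: m 1 2 0 1; m 1 2 1 1]; [:: m 1 1 0 1; m 1 2 0 (-1);
    m 1 2 1 1]];
         [:: [:: m 0 0 0 1; m 1 1 0 1]; [:: m 0 1 0 2; m 1 2 0 2]; [:: m 1 1 0 1; m 1 2 0 (-1);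
    m 1 2 1 1]];
         [:: [:: m 0 0 0 1]; [::]; [:: m 1 2 0 (-1); m 1 2 1 1]];
         [:: [:: m 0 0 0 1]; [:: m 0 1 0 2]; [:: m 0 0 0 1]];
         [:: [:: m 0 0 0 (-2); m 1 1 0 (-4); m 2 2 0 (-2)]; [:: m 1 2 0 (-2); m 1 2 1 (-2);
    m 2 3 0 (-2); m 2 3 1 (-2)]; [:: m 2 2 0 (-1); m 2 2 1 (-1); m 2 3 0 1; m 2 3 2 (-1)]];
         [:: [:: m 0 0 0 1]; [:: m 1 2 0 (-1); m 1 2 1 1]; [:: m 1 2 0 (-1); m 1 2 1 1]]],
     [:: ([:: 3; 6; 8], [:: m 1 2 0 1])]);
    ([:: m 0 0 1 2; m 0 0 2 1; m 0 1 0 4; m 0 1 1 4; m 0 1 2 1; m 1 0 0 2; m 1 0 1 1;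
    m 1 1 0 (-5); m 1 1 1 (-2); m 1 2 0 6; m 1 2 1 5; m 1 2 2 1; m 2 1 0 1; m 2 2 0 (-3);
    m 2 2 1 (-1); m 2 3 0 2; m 2 3 1 1],
     [:: [:: [:: m 0 0 0 1]; [::]; [::]];
         [:: [::]; [:: m 0 0 0 1]; [::]];
         [:: [::]; [::]; [:: m 0 0 0 1]];
         [:: [:: m 0 0 0 1]; [:: m 0 0 0 1]; [:: m 0 0 0 1]];
         [:: [:: m 0 0 0 1; m 1 1 0 1]; [:: m 0 1 0 2; m 0 1 1 1; m 1 2 0 1]; [:: m 0 1 0 2;
    m 0 1 1 1; m 1 1 0 1]];
         [:: [:: m 0 0 0 1; m 1 1 0 1]; [:: m 0 1 0 1; m 1 2 0 1]; [:: m 0 1 0 2; m 0 1 1 1;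
    m 1 1 0 1]];
         [:: [:: m 0 0 0 1]; [::]; [:: m 0 1 0 2; m 0 1 1 1]];
         [:: [:: m 0 0 0 1]; [:: m 0 1 0 1]; [:: m 0 0 0 1]];
         [:: [:: m 0 0 0 (-1); m 1 1 0 (-2); m 2 2 0 (-1)]; [:: m 0 1 0 (-2); m 0 1 1 (-1);
    m 1 2 0 (-3); m 1 2 1 (-1); m 2 3 0 (-1)]; [:: m 0 1 0 (-4); m 0 1 1 (-4); m 0 1 2 (-1);
    m 1 1 0 (-2); m 1 1 1 (-1); m 1 2 0 (-2); m 1 2 1 (-1); m 2 2 0 (-1)]];
         [:: [:: m 0 0 0 1]; [:: m 0 1 0 2; m 0 1 1 1]; [:: m 0 1 0 2; m 0 1 1 1]]],
     [:: ([:: 3; 6; 8], [:: m 0 1 0 1])]);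
    ([:: m 0 0 1 1; m 0 1 0 1; m 1 0 0 2; m 1 0 1 3; m 1 0 2 1; m 1 1 0 (-4); m 1 1 1 (-2);
    m 1 2 0 1; m 2 1 0 (-4); m 2 1 1 (-4); m 2 1 2 (-1); m 2 2 0 (-2); m 2 2 1 (-3); m 2 2 2 (-1);
    m 2 3 0 2; m 2 3 1 1; m 3 3 0 4; m 3 3 1 4; m 3 3 2 1],
     [:: [:: [:: m 0 0 0 1]; [::]; [::]];
         [:: [::]; [:: m 0 0 0 1]; [::]];
         [:: [::]; [::]; [:: m 0 0 0 1]];
         [:: [:: m 0 0 0 1]; [:: m 0 0 0 1]; [:: m 0 0 0 1]];
         [:: [:: m 0 0 0 1; m 1 1 0 2; m 1 1 1 1]; [:: m 1 2 0 1; m 2 2 0 2; m 2 2 1 1];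
    [:: m 1 1 0 2; m 1 1 1 1; m 1 2 0 1]];
         [:: [:: m 0 0 0 1; m 1 1 0 2; m 1 1 1 1]; [:: m 1 1 0 1; m 2 2 0 2; m 2 2 1 1];
    [:: m 1 1 0 2; m 1 1 1 1; m 1 2 0 1]];
         [:: [:: m 0 0 0 1]; [::]; [:: m 1 2 0 1]];
         [:: [:: m 0 0 0 1]; [:: m 1 1 0 1]; [:: m 0 0 0 1]];
         [:: [:: m 0 0 0 (-1); m 1 1 0 (-4); m 1 1 1 (-2); m 2 2 0 (-4); m 2 2 1 (-4);
    m 2 2 2 (-1)]; [:: m 1 2 0 (-1); m 2 2 0 (-2); m 2 2 1 (-1); m 2 3 0 (-2); m 2 3 1 (-1);
    m 3 3 0 (-4); m 3 3 1 (-4); m 3 3 2 (-1)]; [:: m 1 2 0 (-2); m 1 2 1 (-1); m 1 3 0 (-1);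
    m 2 2 0 (-4); m 2 2 1 (-4); m 2 2 2 (-1); m 2 3 0 (-2); m 2 3 1 (-1)]];
         [:: [:: m 0 0 0 1]; [:: m 1 2 0 1]; [:: m 1 2 0 1]]],
     [:: ([:: 3; 6; 8], [:: m 1 2 0 1])]);
    ([:: m 0 0 1 1; m 0 1 0 2; m 0 2 0 1; m 1 0 0 2; m 1 0 1 (-2); m 1 1 0 4; m 1 1 1 (-4);
    m 1 2 0 1; m 1 2 1 (-1); m 2 1 0 1; m 2 1 1 (-2); m 2 1 2 1; m 2 2 0 1; m 2 2 1 (-1);
    m 2 3 0 1; m 2 3 1 (-1); m 3 2 0 1; m 3 2 1 (-2); m 3 2 2 1; m 3 3 0 1; m 3 3 1 (-2);
    m 3 3 2 1],
     [:: [:: [:: m 0 0 0 1]; [::]; [::]];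
         [:: [::]; [:: m 0 0 0 1]; [::]];
         [:: [::]; [::]; [:: m 0 0 0 1]];
         [:: [:: m 0 0 0 1]; [:: m 0 0 0 1]; [:: m 0 0 0 1]];
         [:: [:: m 0 0 0 1; m 0 1 0 1]; [:: m 2 2 0 (-1); m 2 2 1 1]; [:: m 0 1 0 1; m 1 2 0 (-1);
    m 2 2 0 (-1); m 2 2 1 1]];
         [:: [:: m 0 0 0 1; m 0 1 0 1]; [:: m 1 1 0 1; m 1 2 0 1]; [:: m 0 1 0 1; m 1 2 0 (-1);
    m 2 2 0 (-1); m 2 2 1 1]];
         [:: [:: m 0 0 0 1]; [::]; [:: m 1 2 0 (-1); m 2 2 0 (-1); m 2 2 1 1]];
         [:: [:: m 0 0 0 1]; [:: m 1 1 0 1]; [:: m 0 0 0 1]];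
         [:: [:: m 0 0 0 (-1); m 0 1 0 (-2); m 0 2 0 (-1)]; [:: m 2 2 0 1; m 2 2 1 (-1);
    m 2 3 0 1; m 2 3 1 (-1)]; [:: m 1 2 0 1; m 1 2 1 (-1); m 2 3 0 (-1); m 2 3 1 1; m 3 3 0 (-1);
    m 3 3 1 2; m 3 3 2 (-1)]];
         [:: [:: m 0 0 0 1]; [:: m 1 2 0 (-1); m 2 2 0 (-1); m 2 2 1 1]; [:: m 1 2 0 (-1);
    m 2 2 0 (-1); m 2 2 1 1]]],
     [:: ([:: 1; 6; 8], [:: m 1 2 0 1]); ([:: 1; 8; 9], [:: m 1 2 0 (-1)]); ([:: 3; 6;
    8], [:: m 1 2 0 1]); ([:: 6; 8; 9], [:: m 2 4 0 (-1)])]);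
    ([:: m 0 0 1 1; m 0 1 0 2; m 0 1 1 3; m 0 1 2 1; m 1 0 0 (-1); m 1 0 1 (-1); m 1 1 0 (-6);
    m 1 1 1 (-7); m 1 1 2 (-1); m 2 0 0 1; m 2 1 0 6; m 2 1 1 3; m 2 2 0 (-1); m 2 2 1 (-2);
    m 2 2 2 (-1); m 3 1 0 (-1); m 3 1 1 1; m 3 2 0 4; m 3 2 1 5; m 3 2 2 1; m 4 1 0 (-1);
    m 4 2 0 (-5); m 4 2 1 (-3); m 5 2 0 2],
     [:: [:: [:: m 0 0 0 1]; [::]; [::]];
         [:: [::]; [:: m 0 0 0 1]; [::]];
         [:: [::]; [::]; [:: m 0 0 0 1]];
         [:: [:: m 0 0 0 1]; [:: m 0 0 0 1]; [:: m 0 0 0 1]];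
         [:: [:: m 0 0 0 1; m 1 1 0 1; m 1 1 1 1; m 2 1 0 (-1)]; [:: m 2 0 0 1; m 2 1 0 2;
    m 2 1 1 1; m 3 1 0 (-2)]; [:: m 1 0 0 1; m 1 1 0 1; m 1 1 1 1; m 3 1 0 (-1)]];
         [:: [:: m 0 0 0 1; m 1 1 0 1; m 1 1 1 1; m 2 1 0 (-1)]; [:: m 1 0 0 1; m 2 1 0 1;
    m 2 1 1 1; m 3 1 0 (-1)]; [:: m 1 0 0 1; m 1 1 0 1; m 1 1 1 1; m 3 1 0 (-1)]];
         [:: [:: m 0 0 0 1]; [::]; [:: m 2 1 0 1]];
         [:: [:: m 0 0 0 1]; [:: m 1 0 0 1]; [:: m 0 0 0 1]];
         [:: [:: m 0 0 0 (-1); m 1 1 0 (-2); m 1 1 1 (-2); m 2 1 0 2; m 2 2 0 (-1); m 2 2 1 (-2);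
    m 2 2 2 (-1); m 3 2 0 2; m 3 2 1 2; m 4 2 0 (-1)]; [:: m 2 0 0 (-1); m 2 1 0 (-2);
    m 2 1 1 (-1); m 3 1 0 1; m 3 1 1 (-1); m 3 2 0 (-2); m 3 2 1 (-3); m 3 2 2 (-1); m 4 1 0 1;
    m 4 2 0 4; m 4 2 1 3; m 5 2 0 (-2)]; [:: m 2 0 0 (-1); m 2 1 0 (-3); m 2 1 1 (-2);
    m 2 2 0 (-2); m 2 2 1 (-3); m 2 2 2 (-1); m 3 1 0 2; m 3 2 0 2; m 3 2 1 2; m 4 1 0 1;
    m 4 2 0 2; m 4 2 1 1; m 5 2 0 (-2)]];
         [:: [:: m 0 0 0 1]; [:: m 2 1 0 1]; [:: m 2 1 0 1]]],
     [:: ([:: 3; 6; 8], [:: m 2 1 0 1])]);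
    ([:: m 0 0 1 (-1); m 0 1 0 (-1); m 0 1 1 1; m 1 0 1 1; m 1 1 0 2; m 1 1 1 (-2); m 1 2 0 (-1);
    m 1 2 1 1; m 2 1 0 1; m 2 1 1 (-1); m 2 2 0 2; m 2 2 1 (-3); m 2 2 2 1; m 3 3 0 1;
    m 3 3 1 (-2); m 3 3 2 1],
     [:: [:: [:: m 0 0 0 1]; [::]; [::]];
         [:: [::]; [:: m 0 0 0 1]; [::]];
         [:: [::]; [::]; [:: m 0 0 0 1]];
         [:: [:: m 0 0 0 1]; [:: m 0 0 0 1]; [:: m 0 0 0 1]];
         [:: [:: m 1 0 0 1]; [:: m 2 2 0 (-1); m 2 2 1 1]; [:: m 0 0 0 (-1); m 0 1 0 1; m 1 0 0 1;
    m 1 1 0 (-1); m 2 2 0 (-1); m 2 2 1 1]];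
         [:: [:: m 1 0 0 1]; [:: m 1 1 0 1]; [:: m 0 0 0 (-1); m 0 1 0 1; m 1 0 0 1; m 1 1 0 (-1);
    m 2 2 0 (-1); m 2 2 1 1]];
         [:: [:: m 0 0 0 1]; [::]; [:: m 0 1 0 1; m 1 1 0 (-1); m 2 2 0 (-1); m 2 2 1 1]];
         [:: [:: m 0 0 0 1]; [:: m 0 1 0 1]; [:: m 0 0 0 1]];
         [:: [:: m 0 0 0 (-1)]; [:: m 1 2 0 1; m 1 2 1 (-1)]; [:: m 0 1 0 (-1); m 0 1 1 1;
    m 0 2 0 1; m 0 2 1 (-1); m 1 1 0 1; m 1 1 1 (-1); m 1 2 0 (-1); m 1 2 1 1; m 2 3 0 (-1);
    m 2 3 1 2; m 2 3 2 (-1)]];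
         [:: [:: m 0 0 0 1]; [:: m 0 1 0 1; m 1 1 0 (-1); m 2 2 0 (-1); m 2 2 1 1]; [:: m 0 1 0 1;
    m 1 1 0 (-1); m 2 2 0 (-1); m 2 2 1 1]]],
     [:: ([:: 1; 6; 8], [:: m 0 1 0 1]); ([:: 1; 8; 9], [:: m 0 1 0 (-1)]); ([:: 3; 6;
    8], [:: m 0 1 0 1]); ([:: 6; 7; 8], [:: m 0 2 0 (-1)]); ([:: 6; 8; 9], [:: m 0 2 0 1;
    m 1 2 0 (-1)])])].

(** A cyclic group of order ten, generated by the entry sending 0 to 5, whose square rotates the
    blocks 0, ..., 4 and 5, ..., 9. In [star_edge_charts] five charts serve ten edges each and one
    serves five. *)
Definition star_automorphisms : seq (seq nat) := [::
  [:: 0; 1; 2; 3; 4; 5; 6; 7; 8; 9];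
  [:: 1; 2; 3; 4; 0; 6; 7; 8; 9; 5];
  [:: 2; 3; 4; 0; 1; 7; 8; 9; 5; 6];
  [:: 3; 4; 0; 1; 2; 8; 9; 5; 6; 7];
  [:: 4; 0; 1; 2; 3; 9; 5; 6; 7; 8];
  [:: 5; 6; 7; 8; 9; 1; 2; 3; 4; 0];
  [:: 6; 7; 8; 9; 5; 2; 3; 4; 0; 1];
  [:: 7; 8; 9; 5; 6; 3; 4; 0; 1; 2];
  [:: 8; 9; 5; 6; 7; 4; 0; 1; 2; 3];
  [:: 9; 5; 6; 7; 8; 0; 1; 2; 3; 4]].

(* An edge of the fan on which, in a chart precomposed with an automorphism,
   s and t are the coordinates. *)
Definition star_edge_charts : seq ((nat * nat) * (nat * nat)) := [::
  ((20, 25), (0, 0)); ((12, 6), (0, 1)); ((11, 18), (0, 2)); ((3, 4), (0, 3)); ((14, 15), (0, 4));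
    ((16, 17), (0, 5)); ((2, 21), (0, 6)); ((13, 26), (0, 7)); ((10, 5), (0, 8));
    ((0, 1), (0, 9)); ((2, 10), (1, 0)); ((13, 0), (1, 1)); ((10, 16), (1, 2)); ((0, 2), (1, 3));
    ((16, 13), (1, 4)); ((11, 14), (1, 5)); ((3, 20), (1, 6)); ((14, 12), (1, 7));
    ((20, 11), (1, 8)); ((12, 3), (1, 9)); ((10, 25), (2, 0)); ((0, 6), (2, 1));
    ((16, 18), (2, 2)); ((2, 4), (2, 3)); ((13, 15), (2, 4)); ((14, 17), (2, 5));
    ((20, 21), (2, 6)); ((12, 26), (2, 7)); ((11, 5), (2, 8)); ((3, 1), (2, 9));
    ((22, 25), (3, 0)); ((23, 6), (3, 1)); ((29, 18), (3, 2)); ((19, 4), (3, 3));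
    ((9, 15), (3, 4)); ((24, 17), (3, 5)); ((27, 21), (3, 6)); ((28, 26), (3, 7));
    ((7, 5), (3, 8)); ((8, 1), (3, 9)); ((25, 26), (4, 0)); ((6, 5), (4, 1)); ((18, 1), (4, 2));
    ((4, 17), (4, 3)); ((15, 21), (4, 4)); ((8, 22), (5, 0)); ((24, 23), (5, 1));
    ((27, 29), (5, 2)); ((28, 19), (5, 3)); ((7, 9), (5, 4)); ((22, 24), (5, 5));
    ((23, 27), (5, 6)); ((29, 28), (5, 7)); ((19, 7), (5, 8)); ((9, 8), (5, 9))].

End StarCharts.

(** * Minors of the charts and their leading exponents *)

Section StarChartMinors.
Variable chart : seq (nat * nat * nat * Z) * seq (seq (seq (nat * nat * nat * Z)))
    * seq (seq nat * seq (nat * nat * nat * Z)).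

Definition chart_column i := nth [::] chart.1.2 i.

Definition chart_minor (t : seq nat) :=
  sdet3 (chart_column (nth 0%N t 0)) (chart_column (nth 0%N t 1)) (chart_column (nth 0%N t 2)).

Definition chart_multiple t := flatten [seq h.2 | h <- chart.2 & h.1 == t].

(** Congruent to the minor modulo the equation for e. The multiples are such that this is the zero
    polynomial for a nonbasis and displays a leading monomial in s and t for a basis. *)
Definition chart_remainder t :=
  saddmul (sopp (chart_multiple t)) chart.1.1 (chart_minor t).

End StarChartMinors.

Definition star_exponents : seq (seq (nat * nat)) := Eval vm_compute in
  [seq [seq lead_exponent (chart_remainder c t) | t <- star_triples] | c <- star_charts].

Definition permuted_triple (pi t : seq nat) : seq nat := [seq nth 0%N pi i | i <- t].

Definition permuted_index (pi t : seq nat) : nat :=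
  bindex (nth 0%N pi (nth 0%N t 0)) (nth 0%N pi (nth 0%N t 1)) (nth 0%N pi (nth 0%N t 2)).

Definition permuted_exponents (c : nat * nat) : seq (nat * nat) :=
  let ex := nth [::] star_exponents c.1 in let pi := nth [::] star_automorphisms c.2 in
  [seq nth (0, 0)%N ex (permuted_index pi t) | t <- star_triples].

(* The part along the lineality space of three times the weight w. *)
Definition frame_combination (w : seq nat) : zvec :=
  foldr (fun k h => zcomb (Z.of_nat (nth 0%N w (nth 0%N star_frame k))) (nth [::] frame_inverse k) 1 h)
    (nseq 10 0%BZ) (iota 0 (size star_frame)).

(** The weight [w] is the ray up to lineality; all is multiplied by 3 because [frame_inverse] is. *)
Definition exponents_ok (w : seq nat) (ray : zvec) : bool :=
  let u := frame_combination w in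
  all (fun b => Z.eqb (3 * Z.of_nat (nth 0%N w b))%BZ
    (zdot (nth [::] star_incidence b) u + 3 * zdot (nth [::] star_rows b) ray)%BZ) (iota 0 110).

Fact star_charts_ok : all (fun cx =>
  [&& has (newton_start cx.1.1.1) cx.1.1.1,
      all (fun tb => leads tb.2.1 tb.2.2 (chart_remainder cx.1 tb.1)) (zip star_triples cx.2) &
      all (fun t => nilp (chart_remainder cx.1 t)) star_nonbases])
  (zip star_charts star_exponents).
Proof. by vm_compute. Qed.

(** With the bound 20, the 21 in [M_ge] puts the accuracy [M] above the values of all basis
    minors. *)
Fact star_exponents_le : all (all (fun e => (e.1 <= 20)%N && (e.2 <= 20)%N)) star_exponents.
Proof. by vm_compute. Qed.

Fact star_automorphisms_ok : all (fun pi => [&& size pi == 10, uniq pi, all (fun i => i < 10)%N pi,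
  all (fun t => permuted_index pi t < 110) star_triples &
  all (fun t => sort leq (permuted_triple pi t) \in star_nonbases) star_nonbases])%N star_automorphisms.
Proof. by vm_compute. Qed.

Fact star_edge_charts_ok : all (fun ec =>
  let ex := permuted_exponents ec.2 in
  exponents_ok (unzip1 ex) (nth [::] star_rays ec.1.1)
  && exponents_ok (unzip2 ex) (nth [::] star_rays ec.1.2)) star_edge_charts.
Proof. by vm_compute. Qed.

Lemma sort3_mem (x y z : nat) : sort leq [:: x; y; z] \in
  [:: [:: x; y; z]; [:: x; z; y]; [:: y; x; z]; [:: y; z; x]; [:: z; x; y]; [:: z; y; x]].
Proof.
set l := (X in _ \in X); rewrite /sort /=; case: ifP => _ /=; case: ifP => _; try case: ifP => _;
  by rewrite /l !inE eqxx ?orbT.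
Qed.

(** * Minors over polynomials in s and t *)

Section ChartPoints.
Variables (R : realType) (K : fieldType) (v : valuation R K) (alpha beta : R).
Hypothesis rc : residue_char0 v.
Hypotheses (alpha0 : 0 < alpha) (beta0 : 0 < beta).

(** The inner variable ['X%:P] is s, of value [alpha], and the outer variable ['X] is t, of value
    [beta]. *)
Definition chart_filtration : filtration R {poly {poly K}} :=
  poly_filtration (poly_filtration (valuation_filtration v) alpha) beta.

Definition constant_poly : {rmorphism K -> {poly {poly K}}} :=
  [the {rmorphism K -> {poly {poly K}}} of polyC \o polyC].

Local Notation vge := (value_ge chart_filtration).
Local Notation veq := (value_eq chart_filtration).
Local Notation seval := (seval ('X%:P : {poly {poly K}}) 'X).

Lemma constant_poly_eq c : c != 0 -> veq (v c) (constant_poly c).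
Proof. by move=> c0; do 2 apply: value_eq_polyC. Qed.

(** Residue characteristic 0 enters here and in [chart_int_inv]: nonzero integers, among them
    leading coefficients and Newton slopes, are units of value 0. *)
Lemma chart_int_eq (z : int) : z != 0 -> veq 0 z%:~R.
Proof.
move=> z0; rewrite -(rmorph_int constant_poly).
have [n0 vz] := residue_char0_int rc z0.
by rewrite -vz; apply: constant_poly_eq.
Qed.

Lemma chart_int_inv (z : int) : z != 0 ->
  exists2 h : {poly {poly K}}, vge 0 h & h * z%:~R = 1.
Proof.
move=> z0; have [n0 vz] := residue_char0_int rc z0.
exists (constant_poly (z%:~R)^-1).
  have <- : v (z%:~R)^-1 = 0.
    apply: (addIr (v z%:~R)); rewrite -valuationM ?invr_eq0 // mulVf // valuation1 vz addr0 //.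
  by apply/value_eq_ge/constant_poly_eq; rewrite invr_eq0.
by rewrite -(rmorph_int constant_poly) -rmorphM mulVf // rmorph1.
Qed.

Lemma chart_s_eq : veq alpha 'X%:P.
Proof. by apply: value_eq_polyC; apply: value_eq_polyX. Qed.

Lemma chart_t_eq : veq beta 'X.
Proof. exact: value_eq_polyX. Qed.

Variable c : nat.
Local Notation chart := (nth (([::], [::]), [::]) star_charts c).
Local Notation exponents := (nth [::] star_exponents c).
Hypothesis c_lt : (c < size star_charts)%N.
Variable (e : {poly {poly K}}) (M : R).
Hypothesis e_ge : vge (Num.min alpha beta) e.
Hypothesis M_ge : 21 * alpha + 21 * beta <= M.
Hypothesis root_e : vge M (seval e chart.1.1).

Let chart_ok := allP star_charts_ok (chart, exponents).

Lemma star_chart_mem : (chart, exponents) \in zip star_charts star_exponents.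
Proof.
rewrite -nth_zip; last by vm_compute.
by apply: mem_nth; rewrite size_zip minnE; move: c_lt; vm_compute.
Qed.

Let seval_ge0 p : vge 0 (seval e p).
Proof. exact: (seval_ge0 alpha0 beta0 chart_s_eq chart_t_eq). Qed.

Lemma seval_remainder t : seval e (chart_remainder chart t) =
  seval e (chart_minor chart t) - seval e (chart_multiple chart t) * seval e chart.1.1.
Proof. by rewrite seval_addmul seval_opp mulNr addrC. Qed.

(** The minor differs from its remainder by a multiple of the equation, of value at least [M], which
    lies beyond the leading value of the remainder. *)
Lemma basis_minor_value t : t \in star_triples ->
  let ex := nth (0, 0)%N exponents (index t star_triples) in
  veq (ex.1%:R * alpha + ex.2%:R * beta) (seval e (chart_minor chart t)).
Proof.
move=> ts ex; have /and3P[_ /allP lead _] := chart_ok star_chart_mem.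
have sz : size exponents = size star_triples.
  by have : all (fun ex => size ex == size star_triples) star_exponents by [vm_compute];
     move/allP => h; apply/eqP/h/mem_nth.
have exin : ex \in exponents by apply: mem_nth; rewrite sz index_mem.
have tin : (t, ex) \in zip star_triples exponents.
  have -> : (t, ex) = nth (t, (0, 0)%N) (zip star_triples exponents) (index t star_triples).
    by rewrite nth_zip ?sz // nth_index.
  by apply: mem_nth; rewrite size_zip sz minnn index_mem.
have h : veq (ex.1%:R * alpha + ex.2%:R * beta) (seval e (chart_remainder chart t)).
  exact: (leads_value alpha0 beta0 chart_s_eq chart_t_eq chart_int_eq e_ge (lead _ tin)).
rewrite -[seval e (chart_minor _ _)](subrK (seval e (chart_multiple chart t) * seval e chart.1.1)).
rewrite -seval_remainder; apply: value_eqD h _ (value_geM (seval_ge0 _) root_e).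
have /andP[e1 e2] : (ex.1 <= 20)%N && (ex.2 <= 20)%N.
  have := star_exponents_le => /allP/(_ exponents)/(_ (mem_nth _ _))/allP; apply => //.
rewrite add0r; apply: lt_le_trans M_ge.
have : ex.1%:R * alpha <= 20 * alpha by rewrite ler_wpM2r ?(ltW alpha0) // ler_nat.
have : ex.2%:R * beta <= 20 * beta by rewrite ler_wpM2r ?(ltW beta0) // ler_nat.
by move: alpha0 beta0; lra.
Qed.

Lemma nonbasis_minor_value t : t \in star_nonbases -> vge M (seval e (chart_minor chart t)).
Proof.
move=> tn; have /and3P[_ _ /allP/(_ _ tn)/nilP rem0] := chart_ok star_chart_mem.
have := seval_remainder t; rewrite rem0 seval_nil => /esym/eqP.
rewrite subr_eq0 => /eqP->; rewrite -[M]add0r; exact: value_geM.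
Qed.

Local Notation column i := (fun r => seval e (nth [::] (chart_column chart i) r)).

Lemma seval_minor x y z :
  seval e (chart_minor chart [:: x; y; z]) = det3 (column x) (column y) (column z).
Proof. exact: seval_det3. Qed.

Lemma seval_minor_sort x y z : exists b : bool,
  det3 (column x) (column y) (column z) =
  (-1) ^+ b * seval e (chart_minor chart (sort leq [:: x; y; z])).
Proof.
have := sort3_mem x y z; rewrite !inE.
case/orP=> [/eqP->|/orP[/eqP->|/orP[/eqP->|/orP[/eqP->|/orP[/eqP->|/eqP->]]]]]; rewrite seval_minor.
- by exists false; rewrite mul1r.
- by exists true; rewrite /det3 /det2; ring.
- by exists true; rewrite /det3 /det2; ring.
- by exists false; rewrite /det3 /det2; ring.
- by exists false; rewrite /det3 /det2; ring.
- by exists true; rewrite /det3 /det2; ring.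
Qed.

End ChartPoints.

(** * Permuted charts as approximate zeros *)

Lemma sum_filter3 (A : pzRingType) (P : pred nat) (f : nat -> nat -> A) n1 n2 n3 n4 n5 n6 :
  \sum_(t <- [seq t <- [:: (false, (n1, n2)); (true, (n3, n4)); (false, (n5, n6))] | P t.2.1 && P t.2.2])
    (-1) ^+ t.1 * f t.2.1 t.2.2 =
  (if P n1 && P n2 then f n1 n2 else 0) - (if P n3 && P n4 then f n3 n4 else 0)
  + (if P n5 && P n6 then f n5 n6 else 0).
Proof.
rewrite big_filter big_mkcond unlock /= expr0 expr1 !mul1r mulN1r addr0 addrA.
by congr (_ + _ + _); case: ifP; rewrite ?oppr0.
Qed.

Section PermutedChart.
Variables (R : realType) (K : fieldType) (v : valuation R K) (alpha beta : R).
Hypothesis rc : residue_char0 v.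
Hypotheses (alpha0 : 0 < alpha) (beta0 : 0 < beta).
Variables c k : nat.
Local Notation chart := (nth (([::], [::]), [::]) star_charts c).
Local Notation pi := (nth [::] star_automorphisms k).
Hypotheses (c_lt : (c < size star_charts)%N) (k_lt : (k < size star_automorphisms)%N).
Local Notation vge := (value_ge (chart_filtration v alpha beta)).
Local Notation veq := (value_eq (chart_filtration v alpha beta)).
Local Notation seval := (seval ('X%:P : {poly {poly K}}) 'X).
Variable (e : {poly {poly K}}) (M : R).
Hypothesis e_ge : vge (Num.min alpha beta) e.
Hypothesis M_ge : 21 * alpha + 21 * beta <= M.
Hypothesis root_e : vge M (seval e chart.1.1).

Local Notation column i := (fun r => seval e (nth [::] (chart_column chart (nth 0%N pi i)) r)).

Definition triple_det (t : seq nat) : {poly {poly K}} :=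
  det3 (column (nth 0%N t 0)) (column (nth 0%N t 1)) (column (nth 0%N t 2)).

Let pi_ok := allP star_automorphisms_ok _ (mem_nth [::] k_lt).

Lemma triple_det_eq b : (b < 110)%N ->
  let ex := nth (0, 0)%N (permuted_exponents (c, k)) b in
  veq (ex.1%:R * alpha + ex.2%:R * beta) (triple_det (nth [::] star_triples b)).
Proof.
move=> b110 ex; have bs : (b < size star_triples)%N by rewrite size_star_triples.
have ts := mem_nth [::] bs; set t := nth [::] star_triples b in ts *.
have /and5P[/eqP pi10 _ /allP pi_lt /allP/(_ _ ts) lt _] := pi_ok.
have exE : ex = nth (0, 0)%N (nth [::] star_exponents c) (permuted_index pi t).
  by rewrite /ex /permuted_exponents (nth_map [::]).
have /increasing_triplesP[_ t3 /allP t10] := star_triples_increasing ts.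
have pilt i : (i < 3)%N -> (nth 0%N pi (nth 0%N t i) < 10)%N.
  by move=> i3; apply/pi_lt/mem_nth; rewrite pi10 t10 // mem_nth // t3.
have [s E] := seval_minor_sort c e (nth 0%N pi (nth 0%N t 0)) (nth 0%N pi (nth 0%N t 1))
  (nth 0%N pi (nth 0%N t 2)).
rewrite /triple_det E exE; move: lt.
rewrite /permuted_index bindexE ?pilt // -size_star_triples index_mem.
move/(basis_minor_value rc alpha0 beta0 c_lt e_ge M_ge root_e).
by case: s {E}; [rewrite expr1 mulN1r; apply: value_eqN|rewrite mul1r].
Qed.

Lemma triple_det_ge t : t \in star_nonbases -> vge M (triple_det t).
Proof.
move=> tn; have /and5P[_ _ _ _ /allP/(_ _ tn)] := pi_ok.
have [s E] := seval_minor_sort c e (nth 0%N pi (nth 0%N t 0)) (nth 0%N pi (nth 0%N t 1))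
  (nth 0%N pi (nth 0%N t 2)).
rewrite /triple_det E; have /increasing_triplesP[_ t3 _] := star_nonbases_increasing tn.
case: t t3 {tn E} => [|x [|y [|z []]]] //= _.
move/(nonbasis_minor_value alpha0 beta0 c_lt e_ge root_e).
by case: s; [rewrite expr1 mulN1r; apply: value_geN|rewrite mul1r].
Qed.

Lemma triple_det_ge0 t : vge 0 (triple_det t).
Proof.
have g p : vge 0 (seval e p).
  apply: seval_ge0 e_ge => //; first exact: value_eq_polyC (value_eq_polyX _ _).
  exact: value_eq_polyX.
have g2 x y z w : vge 0 (det2 (seval e x) (seval e y) (seval e z) (seval e w)).
  have h p q : vge 0 (seval e p * seval e q) by rewrite -[0](addr0 0); apply: value_geM.
  exact: value_geB.
have g3 p x y z w : vge 0 (seval e p * det2 (seval e x) (seval e y) (seval e z) (seval e w)).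
  by rewrite -[0](addr0 0); apply: value_geM.
by apply: value_geD; [exact: g3|apply: value_geD; exact: g3].
Qed.

(* With these signs the determinants of sorted triples satisfy the three-term
   relations through s as they stand. *)
Let d s x y : {poly {poly K}} :=
  det3 (fun r => (-1) ^+ (s < x)%N * column x r) (fun r => (-1) ^+ (s < y)%N * column y r) (column s).

Let d_sort s x y : (x < y)%N -> (y < 10)%N -> (s < 10)%N -> s \notin [:: x; y] ->
  let t := sort leq [:: x; y; s] in t \in increasing_triples /\ d s x y = triple_det t.
Proof.
rewrite !inE negb_or => xy y10 s10 /andP[sx sy] t.
have x10 := ltn_trans xy y10.
have [sltx|xlts] : (s < x)%N \/ (x < s)%N by apply/orP; rewrite -neq_ltn.
- have slty := ltn_trans sltx xy.
  have -> : t = [:: s; x; y].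
    by rewrite /t /sort /= (ltnW xy) /= leqNgt sltx /=.
  split; first by apply/increasing_triplesP; split; rewrite //= ?sltx ?xy ?s10 ?x10 ?y10.
  by rewrite /d det3_sign sltx slty /triple_det /= mul1r /det3 /det2; ring.
have [slty|ylts] : (s < y)%N \/ (y < s)%N by apply/orP; rewrite -neq_ltn.
- have -> : t = [:: x; s; y].
    by rewrite /t /sort /= (ltnW xy) /= (ltnW xlts) leqNgt slty /=.
  split; first by apply/increasing_triplesP; split; rewrite //= ?xlts ?slty ?s10 ?x10 ?y10.
  rewrite /d det3_sign slty ltnNge (ltnW xlts) /triple_det /= /det3 /det2; ring.
have -> : t = [:: x; y; s].
  by rewrite /t /sort /= (ltnW xy) /= (ltnW xlts) (ltnW ylts).
split; first by apply/increasing_triplesP; split; rewrite //= ?xy ?ylts ?s10 ?x10 ?y10.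
by rewrite /d det3_sign !ltnNge (ltnW xlts) (ltnW ylts) mul1r.
Qed.

Definition chart_point (b : basis M_star) : {poly {poly K}} :=
  triple_det (nth [::] star_triples (var_index bvar 110 b)).

Let M0 : 0 <= M.
Proof. by apply: le_trans M_ge; move: alpha0 beta0; lra. Qed.

Let d_value s x y : (x < y)%N -> (y < 10)%N -> (s < 10)%N -> s \notin [:: x; y] ->
  if (bindex x y s < 110)%N then d s x y = chart_point (bvar (bindex x y s)) /\ vge 0 (d s x y)
  else vge M (d s x y).
Proof.
move=> xy y10 s10 sxy; have [ti ->] := d_sort xy y10 s10 sxy.
rewrite bindexE ?(ltn_trans xy) //; case: ifP => lt.
  split; last exact: triple_det_ge0.
  rewrite /chart_point (index_varK bvar_inj bvar_surj) // nth_index //.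
  by rewrite -index_mem size_star_triples.
apply/triple_det_ge/increasing_star_triples => //.
by rewrite -index_mem size_star_triples lt.
Qed.

(** If a nonbasis occurs, its determinant has value at least [M] and the other factor at least 0, so
    replacing the product by 0 is an error of value at least [M]. *)
Let product_value s x y z w : (x < y)%N -> (y < 10)%N -> (z < w)%N -> (w < 10)%N -> (s < 10)%N ->
  s \notin [:: x; y; z; w] ->
  vge M (d s x y * d s z w - (if (bindex x y s < 110)%N && (bindex z w s < 110)%N then
    chart_point (bvar (bindex x y s)) * chart_point (bvar (bindex z w s)) else 0)).
Proof.
move=> xy y10 zw w10 s10 sn.
have /(d_value xy y10 s10) : s \notin [:: x; y].
  by apply: contra sn; rewrite !inE => /orP[]->; rewrite ?orbT.
have /(d_value zw w10 s10) : s \notin [:: z; w].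
  by apply: contra sn; rewrite !inE => /orP[]->; rewrite ?orbT.
case: (bindex x y s < 110)%N; case: (bindex z w s < 110)%N => /=.
- by move=> [-> _] [-> _]; rewrite subrr; apply: value_ge0.
- by move=> gM [_ g0]; rewrite subr0 -[M]add0r; apply: value_geM.
- by move=> [_ g0] gM; rewrite subr0 -[M]addr0; apply: value_geM.
- move=> gM gM'; rewrite subr0 -[M]add0r; apply: value_geM => //.
  exact: value_ge_le gM'.
Qed.

(** The signed determinants satisfy the Pluecker identity exactly; the error comes from dropping the
    approximately vanishing ones. *)
Lemma chart_point_relation T : T \in star_relations ->
  vge M (\sum_(t <- T) (-1) ^+ t.1 * (chart_point (bvar t.2.1) * chart_point (bvar t.2.2))).
Proof.
move=> /star_relationsP[s [i [j [l [m [[s10 sn ij] jl lm m10 ->]]]]]].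
have l10 := ltn_trans lm m10; have j10 := ltn_trans jl l10.
have s1 : s \notin [:: i; l; j; m] by apply: contra sn; rewrite !inE => /or4P[]->; rewrite ?orbT.
have s2 : s \notin [:: i; m; j; l] by apply: contra sn; rewrite !inE => /or4P[]->; rewrite ?orbT.
have g1 := product_value ij j10 lm m10 s10 sn.
have g2 := product_value (ltn_trans ij jl) l10 (ltn_trans jl lm) m10 s10 s1.
have g3 := product_value (ltn_trans ij (ltn_trans jl lm)) m10 jl l10 s10 s2.
have pl := det3_plucker (fun r => (-1) ^+ (s < i)%N * column i r) (fun r => (-1) ^+ (s < j)%N * column j r)
  (column s) (fun r => (-1) ^+ (s < l)%N * column l r) (fun r => (-1) ^+ (s < m)%N * column m r).
rewrite -/(d s i j) -/(d s l m) -/(d s i l) -/(d s j m) -/(d s i m) -/(d s j l) in pl.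
have := value_geN (value_geD (value_geB g1 g2) g3).
have E (d1 d2 d3 a1 a2 a3 : {poly {poly K}}) : d1 - d2 + d3 = 0 ->
    - ((d1 - a1) - (d2 - a2) + (d3 - a3)) = a1 - a2 + a3.
  by move=> d0; rewrite -[RHS](subr0) -d0; ring.
rewrite (E _ _ _ _ _ _ pl) => h; apply: (eq_ind _ (vge M) h); symmetry.
exact: (sum_filter3 (fun b => b < 110)%N (fun b b' => chart_point (bvar b) * chart_point (bvar b'))).
Qed.

End PermutedChart.

(** * Points in the open edges *)

Section EdgePoints.
Variables (R : realType) (K : fieldType) (v : valuation R K).
Hypothesis rc : residue_char0 v.

Lemma star_edge_chart_lt ec : ec \in star_edge_charts ->
  (ec.2.1 < size star_charts)%N /\ (ec.2.2 < size star_automorphisms)%N.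
Proof.
have : all (fun ec => (ec.2.1 < size star_charts)%N && (ec.2.2 < size star_automorphisms)%N)
  star_edge_charts by vm_compute.
by move=> /allP h /h /andP.
Qed.

Variables (alpha beta : R).
Hypotheses (alpha0 : 0 < alpha) (beta0 : 0 < beta).

Lemma exponents_ok_value w ray b : exponents_ok w ray -> (b < 110)%N ->
  (nth 0%N w b)%:R = 3^-1 * rdot (nth [::] star_incidence b) (rvec R 10 (frame_combination w))
    + rdot (nth [::] star_rows b) (rvec R 10 ray).
Proof.
have [h1 h2 h3] := star_rows_sizes; move=> ok b110.
have sz (ms : seq zvec) : all (fun g => size g == 10%N) ms -> (size (nth [::] ms b) <= 10)%N.
  move=> /allP h; have [bl|bl] := ltnP b (size ms); last by rewrite nth_default.
  by rewrite (eqP (h _ (mem_nth _ bl))).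
have := allP ok b; rewrite mem_iota => /(_ b110)/Z.eqb_eq/(congr1 (zreal R)).
rewrite zrealD !zrealM !rdot_rvec ?sz // => E.
have nE n : zreal R (Z.of_nat n) = n%:R.
  by elim: n => [|n IH] //; rewrite Nat2Z.inj_succ -Z.add_1_r zrealD IH natr1.
have z3 : zreal R 3%BZ = 3 by [].
rewrite nE z3 in E; lra.
Qed.

Definition exponent_weight (ex : seq (nat * nat)) : weight R (basis M_star) :=
  [ffun b => let e := nth (0, 0)%N ex (var_index bvar 110 b) in e.1%:R * alpha + e.2%:R * beta].

(** The minors have the values of [exponent_weight], which agrees with the point of the edge up to
    lineality; this is the correction. *)
Definition edge_translation (ex : seq (nat * nat)) (u : 'rV[R]_10) : 'rV[R]_10 :=
  u - (alpha / 3) *: rvec R 10 (frame_combination (unzip1 ex))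
    - (beta / 3) *: rvec R 10 (frame_combination (unzip2 ex)).

Lemma embed_exponent_weight ec u : ec \in star_edge_charts ->
  let ex := permuted_exponents ec.2 in
  embed bvar 110 star_rows star_incidence u
    (alpha *: rvec R 10 (nth [::] star_rays ec.1.1) + beta *: rvec R 10 (nth [::] star_rays ec.1.2)) =
  exponent_weight ex + embed bvar 110 star_rows star_incidence (edge_translation ex u) 0.
Proof.
move=> ecin ex; have /andP[ok1 ok2] := allP star_edge_charts_ok ec ecin.
apply/ffunP => b; rewrite ffunE [RHS]ffunE /exponent_weight !ffunE.
have b110 := var_index_lt bvar_surj b; move: (var_index _ _ _) b110 => i i110.
have := exponents_ok_value ok1 i110; have := exponents_ok_value ok2 i110.
have sz : (i < size ex)%N by rewrite size_map size_star_triples.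
rewrite /unzip1 /unzip2 -/ex !(nth_map (0, 0)%N) //= => -> ->.
rewrite /edge_translation !rdotD -!scaleNr !rdotZ.
rewrite rdot0 !mulrDl addr0; move: (rdot _ _) (rdot _ _) (rdot _ _) (rdot _ _) (rdot _ _) => a1 a2 a3 a4 a5.
by field.
Qed.

Lemma edge_grassmannian ec u : ec \in star_edge_charts ->
  grassmannian v M_star (embed bvar 110 star_rows star_incidence u
    (alpha *: rvec R 10 (nth [::] star_rays ec.1.1) + beta *: rvec R 10 (nth [::] star_rays ec.1.2))).
Proof.
move=> ecin; rewrite (embed_exponent_weight u ecin).
have [c_lt k_lt] := star_edge_chart_lt ecin.
rewrite /grassmannian three_term_relations_star.
apply: (approximate_zeros_trop (F := chart_filtration v alpha beta) (iota := constant_poly K)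
  (constant_poly_eq v alpha beta)).
  move=> T t t' hT tT t'T; exact: (incidence_value bvar_inj bvar_surj star_relations_ok _ hT tT t'T).
move=> M0; pose delta := Num.min alpha beta.
have delta0 : 0 < delta by rewrite lt_min alpha0.
(* Large enough for the requested accuracy and for the minors of bases to have their exact
   values. *)
pose M := Num.max M0 (21 * alpha + 21 * beta).
have M_ge : 21 * alpha + 21 * beta <= M by rewrite le_max lexx orbT.
have M00 : 0 <= M by apply: le_trans M_ge; move: alpha0 beta0; lra.
(* Each Newton step gains [delta], so finitely many reach the accuracy [M]. *)
have [n hn] : exists n : nat, M <= n.+1%:R * delta.
  exists (Num.bound (M / delta)); rewrite -ler_pdivrMr // ltW //.
  apply: lt_trans (archi_boundP _) _; first by rewrite divr_ge0 // ltW.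
  by rewrite ltr_nat.
set chart := nth (([::], [::]), [::]) star_charts ec.2.1.
have /allP/(_ (chart, nth [::] star_exponents ec.2.1)) := star_charts_ok.
case/(_ (star_chart_mem c_lt))/and3P => start _ _.
have [e e_ge root] := newton_root alpha0 beta0 (chart_s_eq v alpha beta) (chart_t_eq v alpha beta)
  (chart_int_inv alpha beta rc) n start.
have {}root : value_ge (chart_filtration v alpha beta) M (seval 'X%:P 'X e chart.1.1).
  exact: value_ge_le root.
exists (chart_point ec.2.1 ec.2.2 e); split=> [b|T hT].
  rewrite /exponent_weight ffunE.
  exact: (triple_det_eq rc alpha0 beta0 c_lt k_lt e_ge M_ge root (var_index_lt bvar_surj b)).
have := chart_point_relation alpha0 beta0 c_lt k_lt e_ge M_ge root hT.
by apply: value_ge_le; rewrite le_max lexx.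
Qed.

End EdgePoints.

(** * The Grassmannian *)

Definition star_graph : seq (seq nat) :=
  faces_of [seq sort leq [:: ec.1.1; ec.1.2] | ec <- star_edge_charts].

Fact star_graph_removed : let graph := star_graph in
  all (fun sigma => (sigma \in graph) || (sigma \in star_removed)) (faces_of star_maximal).
Proof. by vm_compute. Qed.

(** The rays of an edge chart are listed in the order of s and t, which need not be increasing;
    hence [perm_eq]. *)
Fact star_graph_faces : let faces := faces_of star_maximal in
  all (fun sigma => (sigma \in faces) &&
  has (fun ec => (ec.1.1 != ec.1.2) && has (perm_eq sigma) (subsequences [:: ec.1.1; ec.1.2]))
    star_edge_charts) star_graph.
Proof. by vm_compute. Qed.

Fact star_graph_count : [/\ count (fun s => size s == 1%N) star_graph = 30%N,
  count (fun s => size s == 2%N) star_graph = 55%N,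
  all (fun s => size s <= 2)%N star_graph & [::] \in star_graph].
Proof. by vm_compute. Qed.

Lemma star_graph_sub sigma : sigma \in star_graph -> sigma \in faces_of star_maximal.
Proof. by move/(allP star_graph_faces)/andP=> []. Qed.

Section StarGrassmannian.
Variables (R : realType) (K : fieldType) (v : valuation R K).
Hypothesis rc : residue_char0 v.
Local Notation relint := (ray_relint (star_lineality R) (star_ray R)).

Lemma grassmannian_dressian w : grassmannian v M_star w -> dressian v M_star w.
Proof. by move=> h f /laurent_ideal_gen; apply: h. Qed.

(** Adding [e] to both coefficients moves a point of a closed edge into the open edge, where
    [edge_grassmannian] applies; closedness then covers vertices and the lineality space. *)
Lemma star_graph_grassmannian sigma w : sigma \in star_graph -> relint sigma w ->
  grassmannian v M_star w.
Proof.
move=> sg /ray_relint_embed[u [lam [lam0 ->]]].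
have /andP[_ /hasP[[[a b] c] ecin /andP[ab /hasP[tau tin st]]]] := allP star_graph_faces _ sg.
rewrite [(a, b, c).1]/= in ab tin; rewrite [(a, b).1]/= [(a, b).2]/= in ab tin.
(* A ray missing from [sigma] gets coefficient 0, so that smaller cones appear as boundary of the
   edge. *)
pose la := if a \in sigma then lam a else 0; pose lb := if b \in sigma then lam b else 0.
have la0 : 0 <= la by rewrite /la; case: ifP => // /lam0/ltW.
have lb0 : 0 <= lb by rewrite /lb; case: ifP => // /lam0/ltW.
pose ra := rvec R 10 (nth [::] star_rays a); pose rb := rvec R 10 (nth [::] star_rays b).
have -> : ray_sum 10 star_rays sigma lam = la *: ra + lb *: rb.
  rewrite /ray_sum (perm_big _ st) /la /lb !(perm_mem st) {la lb la0 lb0 st}.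
  have : tau \in [:: [:: a; b]; [:: a]; [:: b]; [::]] := tin; rewrite !inE.
  have ba : (b == a) = false by rewrite eq_sym (negPf ab).
  by case/or4P=> /eqP->; rewrite ?big_cons big_nil ?in_cons ?in_nil ?eqxx ?(negPf ab) ?ba /=
    ?scale0r ?add0r ?addr0.
apply: (trop_intersection_limit (z := embed bvar 110 star_rows star_incidence 0 (ra + rb))).
move=> e e0; rewrite embedZ embedD scaler0 addr0.
have -> : la *: ra + lb *: rb + e *: (ra + rb) = (la + e) *: ra + (lb + e) *: rb.
  by rewrite scalerDr addrACA -!scalerDl.
have ae : 0 < la + e by rewrite ltr_wpDl.
have be : 0 < lb + e by rewrite ltr_wpDl.
exact: (edge_grassmannian rc ae be ecin).
Qed.

Lemma star_grassmannian w :
  grassmannian v M_star w <-> exists2 sigma, sigma \in star_graph & relint sigma w.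
Proof.
split=> [gw|[sigma sg]]; last exact: star_graph_grassmannian.
have [+ _] := star_relint v w; case/(_ (grassmannian_dressian gw)) => sigma sD h.
exists sigma; last exact: h.
have /orP[sg|sr] := allP star_graph_removed _ sD; first exact: sg.
by case: (star_removed_grassmannian rc sr h gw).
Qed.

(** The sum of the rays of a removed cone already lies outside the Grassmannian, so such a cone is
    not contained in it; the cones of the graph are. *)
Lemma star_grassmannian_fan :
  grassmannian_fan v M_star = ray_fan (star_lineality R) (star_ray R) star_graph.
Proof.
have fg sigma p : sigma \in star_graph -> filter p sigma \in star_graph by apply: faces_of_filter.
apply/seteqP; split=> [C []|_ [sigma sg <-]].
  rewrite star_fanE => -[sigma sD <-] sub; exists sigma; last exact: erefl.
  have hs : relint sigma (combi (star_ray R) sigma (fun=> 1)).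
    by exists 0, (fun=> 1); rewrite mem0v add0r.
  have /orP[sg|sr] := allP star_graph_removed _ sD; first exact: sg.
  by case: (star_removed_grassmannian rc sr hs (sub _ (ray_relint_cone hs))).
split; first by rewrite star_fanE; exists sigma; [exact: star_graph_sub sg | exact: erefl].
by move=> w /ray_cone_relint[p hp]; exact: (star_graph_grassmannian (fg _ p sg) hp).
Qed.

Local Open Scope card_scope.

Lemma grassmannian_fan_star : let F := grassmannian_fan v M_star in
  [/\ polyhedral_fan F, fan_support F = grassmannian v M_star & complex_dim F 1] /\
  [/\ cells F 0 #= `I_30 & cells F 1 #= `I_55] /\
  (forall C, cells F 1 C -> vertices_of F C #= `I_2).
Proof.
have uD : uniq star_graph by apply: undup_uniq.
have sD sigma : sigma \in star_graph -> sorted ltn sigma by move/star_graph_sub/star_faces_sorted.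
have fD sigma p : sigma \in star_graph -> filter p sigma \in star_graph by apply: faces_of_filter.
have iD sigma tau w : sigma \in star_graph -> tau \in star_graph ->
    relint sigma w -> relint tau w -> sigma = tau.
  by move=> /star_graph_sub + /star_graph_sub; apply: (@star_relint_inj R K v).
have pD sigma tau w : sigma \in star_graph -> tau \in star_graph ->
    relint sigma w -> relint tau (- w) -> w \in star_lineality R.
  by move=> /star_graph_sub + /star_graph_sub; apply: (@star_relint_pointed R K v).
have [c1 c2 c3 nD] := star_graph_count.
move=> F; rewrite /F star_grassmannian_fan; split; [split|split; [split|]].
- exact: ray_fanP sD fD iD.
- apply/seteqP; split=> w.
    by move/(fan_support_relint _ _ fD) => h; have [_] := star_grassmannian w; apply.
  by move=> h; apply/(fan_support_relint _ _ fD); have [+ _] := star_grassmannian w; apply.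
- by apply: (complex_dim_ray_fan sD fD iD pD nD); rewrite ?has_count ?c2.
- by have := card_cells_ray_fan uD sD fD iD pD nD 0; rewrite c1.
- by have := card_cells_ray_fan uD sD fD iD pD nD 1; rewrite c2.
- by move=> C; apply: (card_vertices_of sD fD iD pD nD).
Qed.

End StarGrassmannian.

Local Open Scope card_scope.

Theorem proposition4p1 (R : realType) :
  (forall (K : fieldType) (v : valuation R K),
     let F := dressian_fan v M_star in
     [/\ polyhedral_fan F, fan_support F = dressian v M_star & complex_dim F 2] /\
     [/\ cells F 0 #= `I_30, cells F 1 #= `I_65 & cells F 2 #= `I_20] /\
     (forall C, cells F 1 C -> vertices_of F C #= `I_2) /\
     (forall C, cells F 2 C -> vertices_of F C #= `I_3)) /\
  (forall (K : closedFieldType) (v : valuation R K), residue_char0 v ->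
     let F := grassmannian_fan v M_star in
     [/\ polyhedral_fan F, fan_support F = grassmannian v M_star
       & complex_dim F 1] /\
     [/\ cells F 0 #= `I_30 & cells F 1 #= `I_55] /\
     (forall C, cells F 1 C -> vertices_of F C #= `I_2)).
Proof.
split=> [K v|K v rc]; first exact: (dressian_fan_star v).
exact: (grassmannian_fan_star rc).
Qed.
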